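(* Let $\mathcal D$ be a symmetric power law distribution with index $p=1$, and let $\mathbf A\sim\mathcal D^{n\times d}$ have i.i.d. entries drawn from $\mathcal D$. Let $\mathbf S\in\mathbb R^{r\times n}$ be drawn as a CountSketch matrix (independently of $\mathbf A$). Then for any $r$ with $C(d\log d)^2\le r\le o(\sqrt n)$, where $C$ is a large enough constant, \[ \Pr\Big\{\frac1\kappa\|\mathbf A\mathbf x\|_1\le\|\mathbf S\mathbf A\mathbf x\|_1\le\|\mathbf A\mathbf x\|_1,\ \forall\mathbf x\in\mathbb R^d\Big\}\ge\frac{99}{100} \] for \[ \kappa=O\Big(\frac{\log n}{\log(r/(d^2\log d))}\Big). \]
   Context: A symmetric power law distribution with index $p$ is a symmetric distribution on $\mathbb R$ with cdf $F$ satisfying $1-F(x)\sim c\,x^{-p}$ as $x\to\infty$ for some constant $c>0$. A CountSketch matrix $\mathbf S\in\mathbb R^{r\times n}$ is drawn by choosing a uniformly random hash function $H:[n]\to[r]$ and independent uniform random signs $\Lambda_i\in\{\pm1\}$, and setting $\mathbf S_{H(i),i}=\Lambda_i$ for each $i\in[n]$ and all other entries $0$. *)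

(* Defs.v *)
From HB Require Import structures.
From mathcomp Require Export all_boot all_order all_algebra.
From mathcomp Require Export all_classical all_reals all_analysis.
Export Order.TTheory GRing.Theory Num.Theory.
Export numFieldNormedType.Exports.

Set Implicit Arguments.
Unset Strict Implicit.
Unset Printing Implicit Defensive.

Local Open Scope classical_set_scope.
Local Open Scope ring_scope.

Definition symmetric_dist (R : realType) (D : probability (measurableTypeR R) R)
    : Prop :=
  forall B : set (measurableTypeR R), measurable B ->
    D (-%R @^-1` B) = D B.

Definition symmetric_power_law (R : realType) (p : R)
    (D : probability (measurableTypeR R) R) : Prop :=
  symmetric_dist D /\
  exists2 c : R, 0 < c &
    (1 - fine (D `]-oo, x]%classic)) / (c * x `^ (- p)) @[x --> +oo] --> (1 : R).

Definition sigma_of (T : Type) (disp : measure_display)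
    (U : measurableType disp) (X : T -> U) : set (set T) :=
  preimage_set_system setT X measurable.

(* A finite type carries the sigma-algebra of all its subsets. *)
Definition sigma_of_fin (T : Type) (U : finType) (X : T -> U) : set (set T) :=
  preimage_set_system setT X setT.

Definition mutually_independent (R : realType) (disp : measure_display)
    (T : measurableType disp) (P : probability T R) (I : finType)
    (F : I -> set (set T)) : Prop :=
  forall (J : {set I}) (E : I -> set T),
    (forall i, i \in J -> F i (E i)) ->
    P (\bigcap_(i in [set` J]) E i) = (\prod_(i in J) P (E i))%E.

(* A boolean s i encodes the sign (-1) ^+ s i. *)
Definition countsketch_mx (R : realType) (r n : nat)
    (h : {ffun 'I_n -> 'I_r}) (s : 'I_n -> bool) : 'M[R]_(r, n) :=
  \matrix_(k, i) (if h i == k then (-1) ^+ s i else 0).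

Definition uniform_hash (R : realType) (disp : measure_display)
    (T : measurableType disp) (P : probability T R) (r n : nat)
    (H : T -> {ffun 'I_n -> 'I_r}) : Prop :=
  forall h, measurable (H @^-1` [set h]) /\
            P (H @^-1` [set h]) = (((r ^ n)%:R : R)^-1)%:E.

Definition uniform_sign (R : realType) (disp : measure_display)
    (T : measurableType disp) (P : probability T R) (L : T -> bool) : Prop :=
  forall b, measurable (L @^-1` [set b]) /\
            P (L @^-1` [set b]) = (2^-1 : R)%:E.

(* One joint independence over the n * d entries, the hash function and the n
   signs: it covers the independence of the entries, of the hash function and
   the signs, and of A and the sketch. *)
Definition sketch_model (R : realType) (D : probability (measurableTypeR R) R)
    (disp : measure_display) (T : measurableType disp) (P : probability T R)
    (n d r : nat) (A : 'I_n -> 'I_d -> {RV P >-> measurableTypeR R})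
    (H : T -> {ffun 'I_n -> 'I_r}) (L : 'I_n -> T -> bool) : Prop :=
  [/\ forall i j (B : set (measurableTypeR R)), measurable B ->
        distribution P (A i j) B = D B,
      uniform_hash P H,
      forall i, uniform_sign P (L i) &
      mutually_independent P
        (fun k : (('I_n * 'I_d) + (unit + 'I_n))%type =>
           match k with
           | inl ij => sigma_of (A ij.1 ij.2)
           | inr (inl _) => sigma_of_fin H
           | inr (inr i) => sigma_of_fin (L i)
           end)].

Definition l1norm (R : realType) (m : nat) (x : 'cV[R]_m) : R :=
  \sum_(i < m) `|x i ord0|.

(* Main.v *)
From mathcomp Require Import ring lra measurable_realfun.
Require Import Defs.

(* Condition on the hash function and on the signs: the entries of A stay
   i.i.d. with law D, all buckets have size at most 2 N with N = n / r (up to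
   probability r^2 / n), and the entries B_kj of S A are independent sums of at
   most 2 N entries of A. Truncation and symmetry give
   P(|B_kj| >= v) <= C N / v, and the one-big-jump event gives the matching
   lower bound.

   In every row k whose largest entry reaches 2^m N (with 2^m of order d log d)
   keep that entry and charge the others: for all x,
     |S A x|_1 >= sum_j |x_j| (signal_j - 2 noise_j).
   On the other side |A x|_1 <= sum_j |x_j| sum_k U_kj with U_kj the sum of the
   |A_ij| over bucket k, and U_kj <= |B_kj| + (2 sum_{i <> i'} |A_ij A_i'j|)^(1/2),
   so a single huge entry of A costs nothing: it also appears in B_kj.
   The rows being independent, Chebyshev's inequality shows that, for all d
   columns at once, signal_j >= c n log(r / (d^2 log d)), noise_j is at most a
   quarter of signal_j, and sum_k U_kj <= signal_j + K n log n. *)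

Set Implicit Arguments.
Unset Strict Implicit.
Unset Printing Implicit Defensive.

Local Open Scope classical_set_scope.
Local Open Scope ring_scope.

(** * Expectation of bounded measurable functions *)

(** With index 1 the entries have no mean; a count of dyadic levels replaces it. An entry of S A / N
    reaches 2^l with probability of order 2^-l, so each level adds the same amount to a mean capped
    at 2^s, while the second moment is of order 2^s. Both logarithms in kappa are such counts. The
    signal of a column uses the levels from m to s. The cap 2^s is of order r / d, which is what
    Chebyshev and the union over d columns allow. The floor 2^m is of order d log d: a rival above
    2^m has probability of order d / 2^m, and each of the m lower levels pays it, so the mean noise
    per row is of order d m / 2^m. The ratio 2^s / 2^m is of order r / (d^2 log d). The numerator
    log n counts the levels below 2^L, of order n^2, which with high probability no entry of A
    reaches.

    Both sides are compared through sums weighted by the |x_j|, so one event per column serves all x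
    and no net is involved. The failure budget is split in two: 1/200 for overloaded hash functions,
    where r = o(sqrt n) enters as 200 r^2 <= n, and 1/200 for the entries given the sketch. *)

Section BoundedMeasurable.
Context {disp : measure_display} {T : measurableType disp} {R : realType}.
Implicit Types (f g : T -> R) (e : T -> bool).

(** The matrix entries need not be integrable, so every variable whose expectation is taken below is
    truncated or a finite sum of indicators. On this class linearity and monotonicity need no
    separate integrability argument. *)
Definition bounded_measurable f :=
  measurable_fun setT f /\ exists M, forall t, `|f t| <= M.

Lemma bm_measurable f : bounded_measurable f -> measurable_fun setT f.
Proof. by case. Qed.

Lemma bm_ext f g : f =1 g -> bounded_measurable f -> bounded_measurable g.
Proof. by move=> /funext ->. Qed.

Lemma bm_cst (c : R) : bounded_measurable (fun=> c).
Proof. by split; [exact: measurable_cst|exists `|c|]. Qed.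

Lemma bmD f g : bounded_measurable f -> bounded_measurable g ->
  bounded_measurable (fun t => f t + g t).
Proof.
move=> [mf [M hM]] [mg [M' hM']]; split; first exact: measurable_funD.
by exists (M + M') => t; rewrite (le_trans (ler_normD _ _))// lerD.
Qed.

Lemma bmM f g : bounded_measurable f -> bounded_measurable g ->
  bounded_measurable (fun t => f t * g t).
Proof.
move=> [mf [M hM]] [mg [M' hM']]; split; first exact: measurable_funM.
by exists (M * M') => t; rewrite normrM ler_pM.
Qed.

Lemma bmN f : bounded_measurable f -> bounded_measurable (fun t => - f t).
Proof.
move=> bf; apply: (@bm_ext (fun t => -1 * f t)); first by move=> t; rewrite mulN1r.
by apply: bmM => //; exact: bm_cst.
Qed.

Lemma bmB f g : bounded_measurable f -> bounded_measurable g ->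
  bounded_measurable (fun t => f t - g t).
Proof. by move=> bf bg; apply: bmD => //; exact: bmN. Qed.

Lemma bmX f k : bounded_measurable f -> bounded_measurable (fun t => f t ^+ k).
Proof.
move=> bf; elim: k => [|k IHk]; first exact: bm_cst.
by apply: (bm_ext _ (bmM bf IHk)) => t; rewrite exprS.
Qed.

Lemma bm_sum (I : Type) (s : seq I) (P : pred I) (F : I -> T -> R) :
  (forall i, P i -> bounded_measurable (F i)) ->
  bounded_measurable (fun t => \sum_(i <- s | P i) F i t).
Proof.
move=> bF; elim: s => [|i s IHs].
  by apply: (bm_ext _ (bm_cst 0)) => t; rewrite big_nil.
case Pi : (P i).
  by apply: (bm_ext _ (bmD (bF _ Pi) IHs)) => t; rewrite big_cons Pi.
by apply: (bm_ext _ IHs) => t; rewrite big_cons Pi.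
Qed.

Lemma bm_bool e : measurable_fun setT e -> bounded_measurable (fun t => (e t)%:R).
Proof.
move=> me; split; last first.
  by exists 1 => t; case: (e t); rewrite ?normr1 ?normr0.
have -> : (fun t => (e t)%:R : R) = fun t => if e t then 1 else 0.
  by apply/funext => t; case: (e t).
by apply: measurable_fun_ifT => //; exact: measurable_cst.
Qed.

Lemma measurable_ge f (v : R) : measurable_fun setT f ->
  measurable_fun setT (fun t => v <= f t).
Proof. by move=> mf; apply: measurable_fun_ler => //; exact: measurable_cst. Qed.

Lemma measurable_le f (v : R) : measurable_fun setT f ->
  measurable_fun setT (fun t => f t <= v).
Proof. by move=> mf; apply: measurable_fun_ler => //; exact: measurable_cst. Qed.

Lemma bm_sqrt f : bounded_measurable f ->
  bounded_measurable (fun t => Num.sqrt (f t)).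
Proof.
move=> [mf [M hM]]; split.
  apply: measurableT_comp mf.
  by apply: continuous_measurable_fun; exact: sqrt_continuous.
exists (Num.sqrt M) => t; rewrite ger0_norm ?sqrtr_ge0//.
rewrite ler_wsqrtr //; exact: le_trans (ler_norm _) (hM t).
Qed.

Lemma measurable_existsb (I : finType) (P : pred I) (F : I -> T -> bool) :
  (forall i, measurable_fun setT (F i)) ->
  measurable_fun setT (fun t => [exists i, P i && F i t]).
Proof.
move=> mF.
suff h (s : seq I) : measurable_fun setT (fun t => has (fun i => P i && F i t) s).
  apply: eq_measurable_fun (h (enum I)) => t _.
  apply/hasP/existsP => [[i _ ?]|[i ?]]; exists i => //.
  by rewrite mem_enum.
elim: s => [|i s IHs]; first exact: measurable_cst.
apply: (@measurable_or _ _ _ (fun t => P i && F i t)) IHs.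
by case: (P i) => /=; [exact: mF|exact: measurable_cst].
Qed.

End BoundedMeasurable.

Section Expectation.
Context {disp : measure_display} {T : measurableType disp} {R : realType}.
Variable P : probability T R.
Implicit Types (f g : T -> R) (e : T -> bool).

Definition expect f : R := \int[P]_t f t.

Definition pr e : R := expect (fun t => (e t)%:R).

Lemma bm_integrable f : bounded_measurable f -> P.-integrable setT (EFin \o f).
Proof.
move=> [mf [M hM]]; apply: measurable_bounded_integrable => //.
  by rewrite -ge0_fin_numE// fin_num_measure.
exists M; split; first exact: num_real.
by move=> y My t _; exact: le_trans (hM t) (ltW My).
Qed.

Lemma eq_ex f g : f =1 g -> expect f = expect g.
Proof. by move=> /funext ->. Qed.

Lemma ex_cst c : expect (fun=> c) = c.
Proof. by rewrite /expect Rintegral_cst//= probability_setT mulr1. Qed.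

Lemma exD f g : bounded_measurable f -> bounded_measurable g ->
  expect (fun t => f t + g t) = expect f + expect g.
Proof. by move=> bf bg; rewrite /expect RintegralD//; exact: bm_integrable. Qed.

Lemma exZ c f : bounded_measurable f -> expect (fun t => c * f t) = c * expect f.
Proof. by move=> bf; rewrite /expect RintegralZl//; exact: bm_integrable. Qed.

Lemma exN f : bounded_measurable f -> expect (fun t => - f t) = - expect f.
Proof.
move=> bf; rewrite -mulN1r -exZ//; apply: eq_ex => t; by rewrite mulN1r.
Qed.

Lemma exB f g : bounded_measurable f -> bounded_measurable g ->
  expect (fun t => f t - g t) = expect f - expect g.
Proof. by move=> bf bg; rewrite exD ?exN//; exact: bmN. Qed.

Lemma le_ex f g : bounded_measurable f -> bounded_measurable g ->
  (forall t, f t <= g t) -> expect f <= expect g.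
Proof. by move=> bf bg fg; apply: le_Rintegral => //; exact: bm_integrable. Qed.

Lemma ex_ge0 f : (forall t, 0 <= f t) -> 0 <= expect f.
Proof. by move=> f0; apply: Rintegral_ge0. Qed.

Lemma ex_sum (I : Type) (s : seq I) (Q : pred I) (F : I -> T -> R) :
  (forall i, Q i -> bounded_measurable (F i)) ->
  expect (fun t => \sum_(i <- s | Q i) F i t) = \sum_(i <- s | Q i) expect (F i).
Proof.
move=> bF; elim: s => [|i s IHs].
  by rewrite big_nil -[RHS](ex_cst 0); apply: eq_ex => t; rewrite big_nil.
rewrite big_cons; case Qi : (Q i); rewrite -IHs.
  rewrite -exD; [|exact: bF|exact: bm_sum].
  by apply: eq_ex => t; rewrite big_cons Qi.
by apply: eq_ex => t; rewrite big_cons Qi.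
Qed.

Lemma prE e : measurable_fun setT e -> P [set t | e t] = (pr e)%:E.
Proof.
move=> me.
have mA : measurable [set t | e t].
  by have := me measurableT [set true] I; rewrite setTI.
rewrite /pr /expect /Rintegral fineK.
  rewrite -[in LHS](setIT [set t | e t]) -integral_indic//; apply: eq_integral => t _.
  by rewrite indicE mem_setE.
have bfe := bm_bool (R := R) me.
exact: (integrable_fin_num measurableT (bm_integrable bfe)).
Qed.

Lemma pr_ge0 e : 0 <= pr e.
Proof. by apply: ex_ge0 => t; rewrite ler0n. Qed.

Lemma le_pr e e' : measurable_fun setT e -> measurable_fun setT e' ->
  (forall t, e t -> e' t) -> pr e <= pr e'.
Proof.
move=> me me' ee'; apply: le_ex; [exact: bm_bool|exact: bm_bool|move=> t].
by have := ee' t; case: (e t) => [->//|_]; rewrite ler0n.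
Qed.

Lemma pr_neg e : measurable_fun setT e -> pr (fun t => ~~ e t) = 1 - pr e.
Proof.
move=> me; rewrite -[X in X - _](ex_cst 1) -exB; [|exact: bm_cst|exact: bm_bool].
by apply: eq_ex => t; case: (e t); rewrite ?subrr ?subr0.
Qed.

Lemma pr_exists (I : finType) (Q : pred I) (F : I -> T -> bool) :
  (forall i, measurable_fun setT (F i)) ->
  pr (fun t => [exists i, Q i && F i t]) <= \sum_(i | Q i) pr (F i).
Proof.
move=> mF; rewrite -ex_sum; last by move=> i _; exact: bm_bool.
apply: le_ex.
- by apply: bm_bool; exact: measurable_existsb.
- by apply: bm_sum => i _; exact: bm_bool.
move=> t; case: existsP => [[i /andP[Qi Fi]]|_]; last first.
  by apply: sumr_ge0 => i _; rewrite ler0n.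
by rewrite (bigD1 i)//= Fi lerDl sumr_ge0// => j _; rewrite ler0n.
Qed.

Lemma pr_or e e' : measurable_fun setT e -> measurable_fun setT e' ->
  pr (fun t => e t || e' t) <= pr e + pr e'.
Proof.
move=> me me'; rewrite -exD; [|exact: bm_bool|exact: bm_bool].
apply: le_ex; [apply: bm_bool; exact: measurable_or| |].
  by apply: bmD; exact: bm_bool.
by move=> t; case: (e t); case: (e' t); rewrite ?addr0 ?add0r ?lexx// lerDl ler01.
Qed.

Lemma markov_ex f a : bounded_measurable f -> (forall t, 0 <= f t) -> 0 < a ->
  pr (fun t => a <= f t) <= expect f / a.
Proof.
move=> bf f0 a0; rewrite ler_pdivlMr// mulrC -exZ; last first.
  by apply: bm_bool; apply: measurable_ge; exact: bm_measurable.
apply: le_ex => //.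
  apply: bmM; first exact: bm_cst.
  by apply: bm_bool; apply: measurable_ge; exact: bm_measurable.
by move=> t; case: (leP a (f t)); rewrite ?mulr1 ?mulr0.
Qed.

End Expectation.

(** * Independence of disjoint groups *)

Section ProductExpectation.
Context {disp : measure_display} {T : measurableType disp} {R : realType}.
Variable P : probability T R.
Implicit Types f g : T -> R.

Definition indep_fun f g := forall A B : set R, measurable A -> measurable B ->
  P ((f @^-1` A) `&` (g @^-1` B)) = (P (f @^-1` A) * P (g @^-1` B))%E.

(* The law of (f, g) is the product of the two laws, so Tonelli applies. *)
Lemma ge0_exM_indep f g : bounded_measurable f -> bounded_measurable g ->
  (forall t, 0 <= f t) -> (forall t, 0 <= g t) -> indep_fun f g ->
  expect P (fun t => f t * g t) = expect P f * expect P g.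
Proof.
move=> bf bg f0 g0 ifg.
have mf := bm_measurable bf; have mg := bm_measurable bg.
pose X : {mfun T >-> R} := mfun_Sub (mem_set mf).
pose Y : {mfun T >-> R} := mfun_Sub (mem_set mg).
have mXY : measurable_fun setT (fun t => (f t, g t)).
  exact: measurable_fun_pair.
pose XY : {mfun T >-> (R * R)%type} := mfun_Sub (mem_set mXY).
have joint := @product_measure_unique _ _ R R R (distribution P X)
  (distribution P Y) (distribution P XY).
have {}joint (Z : set (R * R)) : measurable Z ->
    (distribution P X \x distribution P Y)%E Z = distribution P XY Z.
  by apply: joint => A B mA mB; exact: ifg.
pose h (z : R * R) : \bar R := (`|z.1| * `|z.2|)%:E.
have mh : measurable_fun setT h.
  apply/measurable_EFinP; apply: measurable_funM; apply: measurableT_comp => //.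
have h0 z : (0 <= h z)%E by rewrite lee_fin mulr_ge0.
have E1 : (\int[P]_t (f t * g t)%:E = \int[distribution P XY]_z h z)%E.
  rewrite ge0_integral_distribution//; apply: eq_integral => t _ /=.
  by rewrite /h /= !ger0_norm.
have E2 : (\int[distribution P XY]_z h z =
    \int[distribution P X \x distribution P Y]_z h z)%E.
  by apply: eq_measure_integral => A mA _; apply/esym/joint.
have E3 : (\int[distribution P X \x distribution P Y]_z h z =
   (\int[P]_t (f t)%:E) * (\int[P]_t (g t)%:E))%E.
  rewrite fubini_tonelli1//.
  have -> : (\int[P]_t (g t)%:E = \int[distribution P Y]_y (`|y|)%:E)%E.
    rewrite ge0_integral_distribution//=.
      by apply: eq_integral => t _ /=; rewrite ger0_norm.
    exact/measurable_EFinP.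
  have -> : (\int[P]_t (f t)%:E = \int[distribution P X]_y (`|y|)%:E)%E.
    rewrite ge0_integral_distribution//=.
      by apply: eq_integral => t _ /=; rewrite ger0_norm.
    exact/measurable_EFinP.
  rewrite -ge0_integralZr//; last 2 first.
  - exact/measurable_EFinP.
  - by apply: integral_ge0 => y _; rewrite lee_fin.
  apply: eq_integral => x _; rewrite /fubini_F -ge0_integralZl//.
  exact/measurable_EFinP.
rewrite /expect /Rintegral E1 E2 E3 fineM//.
- exact: (integrable_fin_num measurableT (bm_integrable P bf)).
- exact: (integrable_fin_num measurableT (bm_integrable P bg)).
Qed.

(** Adding bounds [M] and [N] of the absolute values makes both factors nonnegative and keeps them
    independent; bilinearity then removes the shifts. *)
Lemma exM_indep f g : bounded_measurable f -> bounded_measurable g ->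
  indep_fun f g -> expect P (fun t => f t * g t) = expect P f * expect P g.
Proof.
move=> bf bg ifg; case: (bf) => _ [M hM]; case: (bg) => _ [N hN].
pose f' t := f t + M; pose g' t := g t + N.
have bf' : bounded_measurable f' by apply: bmD => //; exact: bm_cst.
have bg' : bounded_measurable g' by apply: bmD => //; exact: bm_cst.
have ef' : expect P f' = expect P f + M by rewrite exD ?ex_cst//; exact: bm_cst.
have eg' : expect P g' = expect P g + N by rewrite exD ?ex_cst//; exact: bm_cst.
have := @ge0_exM_indep f' g' bf' bg'.
have -> : expect P (fun t => f' t * g' t) =
    expect P (fun t => f t * g t) + N * expect P f + M * expect P g + M * N.
  rewrite -exZ// -exZ// -(ex_cst P (M * N)).
  rewrite -exD; [|exact: bmM|by apply: bmM => //; exact: bm_cst].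
  rewrite -exD; last by apply: bmM => //; exact: bm_cst.
    rewrite -exD; last exact: bm_cst.
      by apply: eq_ex => t; rewrite /f' /g'; ring.
    apply: bmD; last by apply: bmM => //; exact: bm_cst.
    by apply: bmD; [exact: bmM|apply: bmM => //; exact: bm_cst].
  by apply: bmD; [exact: bmM|apply: bmM => //; exact: bm_cst].
rewrite ef' eg' => H.
suff : expect P (fun t => f t * g t) + N * expect P f + M * expect P g + M * N =
  (expect P f + M) * (expect P g + N) by move=> E; lra.
apply: H.
- by move=> t; have := hM t; rewrite ler_norml /f' => /andP[]; lra.
- by move=> t; have := hN t; rewrite ler_norml /g' => /andP[]; lra.
- move=> A B mA mB.
  have tr (c : R) (C : set R) : measurable C ->
      measurable ((fun x : R => x + c) @^-1` C).
    move=> mC; have := @measurable_funD _ R R setT id (cst c).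
    by move=> /(_ (@measurable_id _ _ _) (measurable_cst _)) /(_ measurableT C mC);
      rewrite setTI.
  exact: (ifg _ _ (tr M A mA) (tr N B mB)).
Qed.

End ProductExpectation.

Section IndependentGroups.
Context {disp : measure_display} {T : measurableType disp} {R : realType}.
Variables (P : probability T R) (I : finType) (F : I -> set (set T)).
Hypothesis FT : forall i, F i setT.
Hypothesis FI : forall i, setI_closed (F i).
Hypothesis Fm : forall i, F i `<=` measurable.
Hypothesis indF : mutually_independent P F.

(** A pi-system containing [setT]; it generates the sigma-algebra of the group [J]. *)
Definition cylinders (J : {set I}) : set (set T) :=
  [set A | exists2 E : I -> set T, (forall i, F i (E i)) &
                                   A = \bigcap_(i in [set` J]) E i].

Lemma cylinders_setI J : setI_closed (cylinders J).
Proof.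
move=> _ _ [E hE ->] [E' hE' ->]; exists (fun i => E i `&` E' i).
  by move=> i; exact: FI.
by rewrite bigcapI.
Qed.

Lemma cylinders_setT J : cylinders J setT.
Proof.
exists (fun=> setT) => //; apply/seteqP; split => // t _ i _ //.
Qed.

Lemma bigcap_finset_measurable (J : {set I}) (E : I -> set T) :
  (forall i, measurable (E i)) -> measurable (\bigcap_(i in [set` J]) E i).
Proof.
move=> mE; apply: fin_bigcap_measurable => [|i _]; last exact: mE.
exact: finite_finset.
Qed.

Lemma cylinders_measurable J : cylinders J `<=` measurable.
Proof.
by move=> _ [E hE ->]; apply: bigcap_finset_measurable => i; exact: Fm (hE i).
Qed.

Lemma sigma_cylinders_measurable J : <<s cylinders J >> `<=` measurable.
Proof.
apply: smallest_sub; last exact: cylinders_measurable.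
exact: sigma_algebra_measurable.
Qed.

(** As [J] and [J'] are disjoint, the two families of events merge into one family [E''] on the
    union, and the product given by [indF] splits along that union. *)
Lemma cylinders_indep (J J' : {set I}) (A B : set T) : [disjoint J & J']%B ->
  cylinders J A -> cylinders J' B -> P (A `&` B) = (P A * P B)%E.
Proof.
move=> JJ' [E hE ->] [E' hE' ->].
pose E'' i := if i \in J then E i else E' i.
have hE'' i : F i (E'' i) by rewrite /E''; case: ifP.
have -> : \bigcap_(i in [set` J]) E i `&` \bigcap_(i in [set` J']) E' i =
    \bigcap_(i in [set` J :|: J']) E'' i.
  apply/seteqP; split => t /=.
    move=> [h h'] i /=; rewrite inE => iJJ'; rewrite /E''.
    by case: ifPn => iJ; [exact: h|apply: h'; move: iJJ'; rewrite (negbTE iJ)].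
  move=> h; split => i /= iJ; have /= := h i; rewrite inE iJ ?orbT /E''.
    by rewrite iJ; exact.
  have /negbTE -> : i \notin J by apply: contraL iJ; move/(disjointFr JJ') ->.
  exact.
rewrite !indF//= (eq_bigl [predU J & J']); last by move=> i; rewrite !inE.
rewrite bigU//=; congr (_ * _)%E.
  by apply: eq_bigr => i iJ; rewrite /E'' iJ.
apply: eq_bigr => i iJ; rewrite /E''.
by have /negbTE -> : i \notin J by apply: contraL iJ; move/(disjointFr JJ') ->.
Qed.

(* Two finite measures agreeing on a pi-system agree on the generated
   sigma-algebra: P(. `&` B) against P B * P. *)
Lemma indep_sigma_left (G : set (set T)) (B : set T) : setI_closed G ->
  G setT -> G `<=` measurable -> measurable B ->
  (forall A, G A -> P (A `&` B) = (P A * P B)%E) ->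
  forall A, <<s G >> A -> P (A `&` B) = (P A * P B)%E.
Proof.
move=> GI GT Gm mB GB A sGA.
have PBfin : P B \is a fin_num by rewrite fin_num_measure.
have PB0 : 0 <= fine (P B) by rewrite fine_ge0.
pose m1 : {measure set T -> \bar R} := mrestr P mB.
pose m2 : {measure set T -> \bar R} := mscale (NngNum PB0) P.
have E C : m2 C = (P C * P B)%E by rewrite /m2/= /mscale /= fineK// muleC.
rewrite -E -[LHS]/(m1 A).
apply: (@g_sigma_algebra_measure_unique _ _ _ G Gm (fun=> setT)) => //.
- by rewrite bigcup_const//; exists 0%N.
- by move=> C GC; rewrite E; exact: GB.
- by move=> _; rewrite /m1 /= /mrestr setTI -ge0_fin_numE.
Qed.

(** The pi-system argument is used twice, one side at a time: first for the left event with [B]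
    fixed, then, for each left cylinder, for the right event. *)
Lemma sigma_indep (J J' : {set I}) (A B : set T) : [disjoint J & J']%B ->
  <<s cylinders J >> A -> <<s cylinders J' >> B -> P (A `&` B) = (P A * P B)%E.
Proof.
move=> JJ' sA sB.
have mB := sigma_cylinders_measurable sB.
apply: (indep_sigma_left (@cylinders_setI J) (@cylinders_setT J)
  (@cylinders_measurable J) mB) sA.
move=> C cC; rewrite setIC muleC.
have mC := cylinders_measurable cC.
apply: (indep_sigma_left (@cylinders_setI J') (@cylinders_setT J')
  (@cylinders_measurable J') mC) sB.
by move=> D cD; rewrite setIC muleC; exact: cylinders_indep cC cD.
Qed.

(** The same space [T] with the smaller sigma-algebra of the group. Dependence on the sources in [J]
    alone becomes ordinary measurability, so the [bm_] and [measurable_] lemmas apply to it as they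
    stand. *)
Definition group_sigma (J : {set I}) := g_sigma_algebraType (cylinders J).

Lemma group_measurableP (J : {set I}) d' (U : measurableType d') (f : T -> U) :
  measurable_fun setT (f : group_sigma J -> U) -> measurable_fun setT f.
Proof.
move=> mf _ B mB; apply: (@sigma_cylinders_measurable J).
exact: mf measurableT B mB.
Qed.

Lemma group_generator (J : {set I}) (i : I) d' (U : measurableType d')
    (f : T -> U) : i \in J -> (forall B, measurable B -> F i (f @^-1` B)) ->
  measurable_fun setT (f : group_sigma J -> U).
Proof.
move=> iJ hf _ B mB; rewrite setTI; apply: sub_sigma_algebra.
exists (fun k => if k == i then f @^-1` B else setT).
  by move=> k; case: eqP => [->|_//]; exact: hf.
apply/seteqP; split => t /=.
  by move=> Bt k _; case: ifP.
by move=> /(_ i iJ); rewrite eqxx.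
Qed.

Definition group_rv (J : {set I}) (f : T -> R) :=
  bounded_measurable (f : group_sigma J -> R).

Lemma group_bm J f : group_rv J f -> bounded_measurable f.
Proof. by case=> mf bf; split => //; exact: group_measurableP mf. Qed.

Lemma group_exM (J J' : {set I}) (f g : T -> R) : [disjoint J & J']%B ->
  group_rv J f -> group_rv J' g -> expect P (fun t => f t * g t) = expect P f * expect P g.
Proof.
move=> JJ' bf bg; apply: exM_indep; [exact: group_bm bf|exact: group_bm bg|].
move=> A B mA mB; apply: (sigma_indep JJ').
- by have mf := bm_measurable bf; have := mf measurableT A mA; rewrite setTI.
- by have mg := bm_measurable bg; have := mg measurableT B mB; rewrite setTI.
Qed.

Lemma group_prM (J J' : {set I}) (e e' : T -> bool) : [disjoint J & J']%B ->
  measurable_fun setT (e : group_sigma J -> bool) ->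
  measurable_fun setT (e' : group_sigma J' -> bool) ->
  pr P (fun t => e t && e' t) = pr P e * pr P e'.
Proof.
move=> JJ' me me'; rewrite -(group_exM JJ'); [|exact: bm_bool|exact: bm_bool].
by apply: eq_ex => t; case: (e t); rewrite ?mul1r ?mul0r.
Qed.

End IndependentGroups.

(** * Dyadic sums and Chebyshev's inequality *)

Section Dyadic.
Context {R : realType}.
Implicit Types (f g : nat -> bool) (L : nat) (b : R).

(** If [f] is decreasing with j true values below [L], this is 2^j. For the levels [2 ^+ l <= b] it
    is the least power of two above b, capped at 2^L. Being linear in indicators, it has a mean
    computed from level probabilities alone. *)
Definition dyad f L : R := 1 + \sum_(l < L) 2 ^+ l * (f l)%:R.

Definition decreasingb f := forall l, f l.+1 -> f l.

Lemma decreasingb_le f l k : decreasingb f -> (l <= k)%N -> f k -> f l.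
Proof.
move=> df; elim: k => [|k IHk]; first by rewrite leqn0 => /eqP ->.
by rewrite leq_eqVlt => /predU1P[->//|lk] /df; exact: IHk.
Qed.

Lemma dyadS f L : dyad f L.+1 = dyad f L + 2 ^+ L * (f L)%:R.
Proof. by rewrite /dyad big_ord_recr addrA. Qed.

Lemma dyad_full f L : (forall l, (l < L)%N -> f l) -> dyad f L = 2 ^+ L.
Proof.
elim: L => [|L IHL] h; first by rewrite /dyad big_ord0 addr0 expr0.
rewrite dyadS IHL ?h// => [|l lL]; last by apply: h; exact: ltnW.
by rewrite mulr1 exprS; lra.
Qed.

Lemma dyad_ge1 f L : 1 <= dyad f L.
Proof. by rewrite lerDl sumr_ge0// => l _; rewrite mulr_ge0 ?ler0n ?exprn_ge0. Qed.

Lemma dyad_ge0 f L : 0 <= dyad f L.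
Proof. exact: le_trans ler01 (dyad_ge1 f L). Qed.

(** The square of 2^j is 4^j, which telescopes into 1 plus the increments 3 4^l for l < j. The
    square is thus again linear in the indicators. *)
Lemma dyad_sqr f L : decreasingb f ->
  dyad f L ^+ 2 = 1 + \sum_(l < L) 3 * 4 ^+ l * (f l)%:R.
Proof.
move=> df; elim: L => [|L IHL]; first by rewrite /dyad !big_ord0 !addr0 expr1n.
rewrite dyadS big_ord_recr /= addrA -IHL; case fL : (f L); last first.
  by rewrite !mulr0 !addr0.
rewrite dyad_full => [|l lL]; last exact: decreasingb_le (ltnW lL) fL.
have -> : (4 : R) ^+ L = 2 ^+ L ^+ 2 
  by rewrite -exprM mulnC exprM; congr (_ ^+ _); ring.
rewrite /=; ring.
Qed.

Lemma le_dyad b L : b < 2 ^+ L -> b <= dyad (fun l => 2 ^+ l <= b) L.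
Proof.
elim: L => [|L IHL] hb.
  by rewrite /dyad big_ord0 addr0 ltW// -(expr0 (2 : R)).
have [bL|Lb] := ltP b (2 ^+ L).
  rewrite dyadS; apply: (le_trans (IHL bL)).
  by rewrite lerDl mulr_ge0 ?ler0n// exprn_ge0.
rewrite dyad_full ?ltW// => l lL; apply: le_trans Lb.
by rewrite ler_eXn2l ?ltr1n.
Qed.

Lemma dyad_monotone f g L : (forall l, f l -> g l) -> dyad f L <= dyad g L.
Proof.
move=> fg; rewrite lerD2l ler_sum// => l _; rewrite ler_wpM2l ?exprn_ge0//.
by rewrite ler_nat; have := fg l; case: (f l) => // ->.
Qed.

Lemma sum_exp2 L : \sum_(l < L) (2 : R) ^+ l = 2 ^+ L - 1.
Proof.
elim: L => [|L IHL]; first by rewrite big_ord0 expr0 subrr.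
by rewrite big_ord_recr /= IHL exprS; ring.
Qed.

End Dyadic.

(** * Moments of dyadic sums under a tail bound *)

Section DyadicMoments.
Context {disp : measure_display} {T : measurableType disp} {R : realType}.
Variable P : probability T R.
Variable e : nat -> T -> bool.
Hypothesis me : forall l, measurable_fun setT (e l).

Lemma bm_dyad L : bounded_measurable (fun t => dyad (e^~ t) L : R).
Proof.
apply: bmD; first exact: bm_cst.
by apply: bm_sum => l _; apply: bmM; [exact: bm_cst|exact: bm_bool].
Qed.

Lemma ex_dyadE L :
  expect P (fun t => dyad (e^~ t) L) = 1 + \sum_(l < L) 2 ^+ l * pr P (e l).
Proof.
have bs l : bounded_measurable (fun t => 2 ^+ l * (e l t)%:R : R).
  by apply: bmM; [exact: bm_cst|exact: bm_bool].
rewrite exD; [|exact: bm_cst|by apply: bm_sum => l _].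
rewrite ex_cst ex_sum//; congr (_ + _); apply: eq_bigr => l _.
by rewrite exZ//; exact: bm_bool.
Qed.

Lemma ex_dyad_sqrE L : (forall t, decreasingb (e^~ t)) ->
  expect P (fun t => dyad (e^~ t) L ^+ 2) = 1 + \sum_(l < L) 3 * 4 ^+ l * pr P (e l).
Proof.
move=> de; under eq_ex do rewrite dyad_sqr//.
have bs l : bounded_measurable (fun t => 3 * 4 ^+ l * (e l t)%:R : R).
  by apply: bmM; [exact: bm_cst|exact: bm_bool].
rewrite exD; [|exact: bm_cst|by apply: bm_sum => l _].
rewrite ex_cst ex_sum//; congr (_ + _); apply: eq_bigr => l _.
by rewrite exZ//; exact: bm_bool.
Qed.

Variable q : R.
Hypothesis qe : forall l, pr P (e l) <= q / 2 ^+ l.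

(** The weight 2^l cancels the tail q / 2^l: each level costs at most [q], and the mean grows like
    the logarithm of the cap. *)
Lemma ex_dyad_le L : expect P (fun t => dyad (e^~ t) L) <= 1 + q * L%:R.
Proof.
rewrite ex_dyadE lerD2l; have -> : q * L%:R = \sum_(l < L) q.
  by rewrite sumr_const card_ord mulr_natr.
by apply: ler_sum => l _; rewrite mulrC -ler_pdivlMr ?exprn_gt0.
Qed.

(** The weights 4^l leave 3 q 2^l per level, a geometric sum of the order of the cap. *)
Lemma ex_dyad_sqr_le L : (forall t, decreasingb (e^~ t)) ->
  expect P (fun t => dyad (e^~ t) L ^+ 2) <= 1 + 3 * q * 2 ^+ L.
Proof.
have q0 : 0 <= q.
  by have := le_trans (pr_ge0 P (e 0)) (qe 0); rewrite expr0 divr1.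
move=> de; rewrite ex_dyad_sqrE// lerD2l.
apply: (@le_trans _ _ (\sum_(l < L) 3 * q * 2 ^+ l)).
  apply: ler_sum => l _.
  have -> : (4 : R) ^+ l = 2 ^+ l * 2 ^+ l by rewrite -exprMn; congr (_ ^+ _); ring.
  have := qe l; rewrite ler_pdivlMr ?exprn_gt0// => h.
  have h2 : 0 <= (2 : R) ^+ l by rewrite exprn_ge0.
  by have := ler_wpM2l h2 h; lra.
rewrite -mulr_sumr sum_exp2 ler_wpM2l ?mulr_ge0//; lra.
Qed.

End DyadicMoments.

(** * Second moments of sums over disjoint groups *)

Section IndependentSums.
Context {disp : measure_display} {T : measurableType disp} {R : realType}.
Variables (P : probability T R) (I : finType) (F : I -> set (set T)).
Hypothesis FT : forall i, F i setT.
Hypothesis FI : forall i, setI_closed (F i).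
Hypothesis Fm : forall i, F i `<=` measurable.
Hypothesis indF : mutually_independent P F.
Variables (K : finType) (G : pred K) (J : K -> {set I}) (Z : K -> T -> R).
Hypothesis disJ : forall k k', k != k' -> [disjoint J k & J k']%B.
Hypothesis bZ : forall k, group_rv F (J k) (Z k).

Let bmZ k : bounded_measurable (Z k) := group_bm Fm (bZ k).

Lemma ex_sqr_sum_centered : (forall k, expect P (Z k) = 0) ->
  expect P (fun t => (\sum_(k | G k) Z k t) ^+ 2) =
  \sum_(k | G k) expect P (fun t => Z k t ^+ 2).
Proof.
move=> Z0.
have -> : (fun t => (\sum_(k | G k) Z k t) ^+ 2) =
    fun t => \sum_(k | G k) \sum_(k' | G k') Z k t * Z k' t.
  by apply/funext => t; rewrite expr2 mulr_suml; apply: eq_bigr => k _;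
    rewrite mulr_sumr.
rewrite ex_sum; last by move=> k _; apply: bm_sum => k' _; exact: bmM.
apply: eq_bigr => k Gk; rewrite ex_sum; last by move=> k' _; exact: bmM.
rewrite (bigD1 k)//= big1 ?addr0 => [|k' /andP[_ k'k]].
  by apply: eq_ex => t; rewrite expr2.
by rewrite (group_exM FT FI Fm indF (disJ _) (bZ k) (bZ k')) ?Z0 ?mul0r// eq_sym.
Qed.

End IndependentSums.

Section Chebyshev.
Context {disp : measure_display} {T : measurableType disp} {R : realType}.
Variables (P : probability T R) (I : finType) (F : I -> set (set T)).
Hypothesis FT : forall i, F i setT.
Hypothesis FI : forall i, setI_closed (F i).
Hypothesis Fm : forall i, F i `<=` measurable.
Hypothesis indF : mutually_independent P F.
Variables (K : finType) (J : K -> {set I}) (Z : K -> T -> R).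
Hypothesis disJ : forall k k', k != k' -> [disjoint J k & J k']%B.
Hypothesis bZ : forall k, group_rv F (J k) (Z k).

Let bmZ k : bounded_measurable (Z k) := group_bm Fm (bZ k).

Lemma chebyshev_sum (lam : R) : 0 < lam ->
  pr P (fun t => lam <= `|\sum_k Z k t - \sum_k expect P (Z k)|) <=
  (\sum_k expect P (fun t => Z k t ^+ 2)) / lam ^+ 2.
Proof.
move=> lam0.
pose Y k t := Z k t - expect P (Z k).
have bY k : group_rv F (J k) (Y k) by exact: (bmB (bZ k) (bm_cst _)).
have bmY k : bounded_measurable (Y k) := group_bm Fm (bY k).
have Y0 k : expect P (Y k) = 0.
  by rewrite exB ?ex_cst ?subrr//; exact: bm_cst.
pose S t := \sum_k Y k t.
have bS : bounded_measurable S by apply: bm_sum.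
have -> : (fun t => lam <= `|\sum_k Z k t - \sum_k expect P (Z k)|) =
    fun t => lam ^+ 2 <= S t ^+ 2.
  apply/funext => t; rewrite /S /Y sumrB -[RHS]/(_ <= _).
  by rewrite -[X in _ = (_ <= X)]real_normK ?num_real// ler_sqr// nnegrE ltW.
apply: le_trans (markov_ex P (bmX 2 bS) _ (exprn_gt0 2 lam0)) _.
  by move=> t; rewrite sqr_ge0.
rewrite ler_pM2r ?invr_gt0 ?exprn_gt0//.
rewrite (ex_sqr_sum_centered FT FI Fm indF xpredT disJ bY Y0); apply: ler_sum => k _.
(* Expanding about the mean leaves the second moment minus the squared mean, and the latter is
   dropped. *)
have -> : (fun t => Y k t ^+ 2) = fun t =>
    Z k t ^+ 2 + (- 2 * expect P (Z k)) * Z k t + expect P (Z k) ^+ 2.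
  by apply/funext => t; rewrite /Y; ring.
have b1 : bounded_measurable (fun t => - 2 * expect P (Z k) * Z k t).
  by apply: bmM => //; exact: bm_cst.
rewrite exD; [|by apply: bmD => //; exact: bmX|exact: bm_cst].
rewrite exD//; last exact: bmX.
by rewrite exZ// ex_cst; have := sqr_ge0 (expect P (Z k)); rewrite expr2; lra.
Qed.

Lemma chebyshev_sum_upper (a b lam : R) : 0 < lam ->
  (forall k, expect P (Z k) <= a) -> (forall k, expect P (fun t => Z k t ^+ 2) <= b) ->
  pr P (fun t => #|K|%:R * a + lam <= \sum_k Z k t) <= #|K|%:R * b / lam ^+ 2.
Proof.
move=> lam0 ha hb.
have mS : measurable_fun setT (fun t => \sum_k Z k t).
  by apply: bm_measurable; exact: bm_sum.
apply: (@le_trans _ _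
    (pr P (fun t => lam <= `|\sum_k Z k t - \sum_k expect P (Z k)|))).
  apply: le_pr; [exact: measurable_ge| |].
    apply: measurable_ge; apply: measurableT_comp => //.
    by apply: measurable_funB => //; exact: measurable_cst.
  move=> t h; apply: le_trans (ler_norm _).
  have : \sum_k expect P (Z k) <= #|K|%:R * a.
    rewrite (le_trans (ler_sum _ (fun k _ => ha k)))// sumr_const.
    by rewrite mulr_natl.
  lra.
apply: le_trans (chebyshev_sum lam0) _.
rewrite ler_pM2r ?invr_gt0 ?exprn_gt0//.
by rewrite (le_trans (ler_sum _ (fun k _ => hb k)))// sumr_const mulr_natl.
Qed.

Lemma chebyshev_sum_lower (s b lam : R) : 0 < lam ->
  s <= \sum_k expect P (Z k) -> (forall k, expect P (fun t => Z k t ^+ 2) <= b) ->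
  pr P (fun t => \sum_k Z k t <= s - lam) <= #|K|%:R * b / lam ^+ 2.
Proof.
move=> lam0 hs hb.
have mS : measurable_fun setT (fun t => \sum_k Z k t).
  by apply: bm_measurable; exact: bm_sum.
apply: (@le_trans _ _
    (pr P (fun t => lam <= `|\sum_k Z k t - \sum_k expect P (Z k)|))).
  apply: le_pr; [exact: measurable_le| |].
    apply: measurable_ge; apply: measurableT_comp => //.
    by apply: measurable_funB => //; exact: measurable_cst.
  by move=> t h; rewrite distrC; apply: le_trans (ler_norm _); lra.
apply: le_trans (chebyshev_sum lam0) _.
rewrite ler_pM2r ?invr_gt0 ?exprn_gt0//.
by rewrite (le_trans (ler_sum _ (fun k _ => hb k)))// sumr_const mulr_natl.
Qed.

End Chebyshev.

(** * Sums of independent symmetric variables *)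

Section SigmaOf.
Context {disp : measure_display} {T : measurableType disp} {R : realType}.
Variable X : T -> measurableTypeR R.

Lemma sigma_ofT : sigma_of X setT.
Proof. by exists setT => //; rewrite preimage_setT setTI. Qed.

Lemma sigma_ofI : setI_closed (sigma_of X).
Proof.
move=> _ _ [A mA <-] [B mB <-]; exists (A `&` B); first exact: measurableI.
by rewrite !setTI preimage_setI.
Qed.

Lemma sigma_of_measurable : measurable_fun setT X -> sigma_of X `<=` measurable.
Proof. by move=> mX _ [A mA <-]; exact: mX. Qed.

Lemma sigma_of_preimage (A : set (measurableTypeR R)) : measurable A ->
  sigma_of X (X @^-1` A).
Proof. by move=> mA; exists A => //; rewrite setTI. Qed.

End SigmaOf.

Section IidSums.
Context {disp : measure_display} {T : measurableType disp} {R : realType}.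
Variables (P : probability T R) (D : probability (measurableTypeR R) R).
Variables (I : finType) (X : I -> T -> measurableTypeR R).
Hypothesis mX : forall i, measurable_fun setT (X i).
Hypothesis lawX : forall i (B : set (measurableTypeR R)), measurable B ->
  P (X i @^-1` B) = D B.
Hypothesis indX : mutually_independent P (fun i => sigma_of (X i)).
Hypothesis symD : symmetric_dist D.

Notation F := (fun i => sigma_of (X i)).
Let FT i : F i setT := @sigma_ofT _ _ _ (X i).
Let FI i : setI_closed (F i) := @sigma_ofI _ _ _ (X i).
Let Fm i : F i `<=` measurable := sigma_of_measurable (mX i).

Definition tail (D : probability (measurableTypeR R) R) (v : R) : R :=
  fine (D [set x | v <= `|x|]).

Let Xr i t : R := X i t.

Lemma group_X (J : {set I}) i : i \in J ->
  measurable_fun setT (Xr i : group_sigma F J -> R).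
Proof.
move=> iJ; apply: (@group_generator _ _ _ F FT J i _ _ (Xr i) iJ) => B mB.
exact: sigma_of_preimage.
Qed.

Lemma group_sum (J : {set I}) (G : {set I}) : G \subset J ->
  measurable_fun setT ((fun t => \sum_(i in G) Xr i t) : group_sigma F J -> R).
Proof.
move=> /fintype.subsetP GJ.
have -> : (fun t => \sum_(i in G) Xr i t) =
    (fun t => \sum_(i <- enum G) Xr i t) by apply/funext => t; rewrite big_enum.
have : {subset enum G <= J} by move=> i; rewrite mem_enum; exact: GJ.
elim: (enum G) => [_|i s IHs sJ].
  rewrite (_ : (fun _ => _) = cst 0); first exact: measurable_cst.
  by apply/funext => t; rewrite big_nil.
rewrite (_ : (fun _ => _) = (fun t => Xr i t + \sum_(i <- s) Xr i t)); last first.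
  by apply/funext => t; rewrite big_cons.
apply: measurable_funD; first by apply: group_X; apply: sJ; rewrite mem_head.
by apply: IHs => k ks; apply: sJ; rewrite inE ks orbT.
Qed.

Lemma pr_law i (B : set (measurableTypeR R)) (e : T -> bool) : measurable B ->
  (forall t, B (X i t) <-> e t) -> pr P e = fine (D B).
Proof.
move=> mB eB.
have E : [set t | e t] = X i @^-1` B.
  by apply/seteqP; split => t /=; rewrite eB.
have me : measurable_fun setT e.
  apply: (measurable_fun_bool true); rewrite setTI.
  rewrite (_ : e @^-1` [set true] = X i @^-1` B); last first.
    by rewrite -E; apply/seteqP; split.
  by have := @mX i measurableT _ mB; rewrite setTI.
by have := prE P me; rewrite E lawX// => ->.
Qed.

Let mgeR (v : R) : measurable ([set x | v <= x] : set (measurableTypeR R)).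
Proof.
have -> : [set x : measurableTypeR R | v <= x] = `[v, +oo[%classic.
  by apply/seteqP; split => x /=; rewrite in_itv/= andbT.
exact: measurable_itv.
Qed.

Let mleR (v : R) : measurable ([set x | x <= v] : set (measurableTypeR R)).
Proof.
have -> : [set x : measurableTypeR R | x <= v] = `]-oo, v]%classic.
  by apply/seteqP; split => x /=; rewrite in_itv.
exact: measurable_itv.
Qed.

Let mabsR (v : R) : measurable ([set x | v <= `|x|] : set (measurableTypeR R)).
Proof.
have -> : [set x : measurableTypeR R | v <= `|x|] =
    [set x | v <= x] `|` [set x | x <= - v].
  apply/seteqP; split => x /=; rewrite ler_normr lerNr.
    by move=> /orP[]; [left|right].
  by move=> [->|->]; rewrite ?orbT.
exact: measurableU.
Qed.

Lemma pr_abs i v : pr P (fun t => v <= `|Xr i t|) = tail D v.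
Proof. exact: (@pr_law i [set x | v <= `|x|]). Qed.

Lemma pr_half i v : 0 < v ->
  pr P (fun t => v <= Xr i t) = tail D v / 2 /\
  pr P (fun t => Xr i t <= - v) = tail D v / 2.
Proof.
move=> v0.
have h1 : pr P (fun t => v <= Xr i t) = fine (D [set x | v <= x]).
  exact: (@pr_law i [set x | v <= x]).
have h2 : pr P (fun t => Xr i t <= - v) = fine (D [set x | x <= - v]).
  exact: (@pr_law i [set x | x <= - v]).
have h3 : D [set x | x <= - v] = D [set x | v <= x].
  rewrite -(symD (mleR (- v))); congr (D _).
  by apply/seteqP; split => x /=; rewrite lerN2.
have h4 : tail D v = fine (D [set x | v <= x]) + fine (D [set x | x <= - v]).
  rewrite /tail -fineD ?fin_num_measure// -measureU//; last first.
    apply/seteqP; split => x //= [ha hb].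
    by have := le_trans ha hb; rewrite leNgt gtrN.
  congr (fine (D _)); apply/seteqP; split => x /=; rewrite ler_normr lerNr.
    by move=> /orP[]; [left|right].
  by move=> [->|->]; rewrite ?orbT.
by rewrite h1 h2 h4 h3; split; lra.
Qed.

(* X and - X have the same law, and the integrand is odd. *)
Lemma ex_trunc i (v : R) : expect P (fun t => Xr i t * (`|Xr i t| <= v)%R%:R) = 0.
Proof.
pose f (x : R) := x * (`|x| <= v)%R%:R.
have mf : measurable_fun setT (f : measurableTypeR R -> R).
  apply: measurable_funM => //; apply: bm_measurable; apply: bm_bool.
  apply: measurable_le; exact: normr_measurable.
have bf : bounded_measurable (f : measurableTypeR R -> R).
  split => //; exists `|v| => x; rewrite /f; case: (leP `|x| v) => h.
    by rewrite mulr1 (le_trans h)// ler_norm.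
  by rewrite mulr0 normr0.
pose Y : {mfun T >-> measurableTypeR R} := mfun_Sub (mem_set (mX i)).
have bfX : bounded_measurable (fun t => f (X i t)).
  case: bf => _ [M hM]; split; last by exists M => t; exact: hM.
  exact: measurableT_comp mf (mX i).
have E1 : expect P (fun t => f (X i t)) = expect D f.
  rewrite /expect /Rintegral; congr fine.
  transitivity (\int[distribution P Y]_y (f y)%:E)%E.
    rewrite integral_distribution//; first exact/measurable_EFinP.
    exact: (bm_integrable P bfX).
  by apply: eq_measure_integral => A mA _; exact: lawX.
pose neg : measurableTypeR R -> measurableTypeR R := -%R.
have mN : measurable_fun setT neg by exact: (@oppr_measurable R setT).
pose N : {mfun measurableTypeR R >-> measurableTypeR R} :=
  @mfun_Sub _ _ (measurableTypeR R) (measurableTypeR R) neg (mem_set mN).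
have bfN : bounded_measurable (fun x : measurableTypeR R => f (- x)).
  case: bf => _ [M hM]; split; last by exists M => t; exact: hM.
  exact: measurableT_comp mf mN.
have E2 : expect D f = expect D (fun x => f (- x)).
  rewrite /expect /Rintegral; congr fine.
  transitivity (\int[distribution D N]_y (f y)%:E)%E.
    by apply: eq_measure_integral => A mA _; apply/esym/symD.
  rewrite integral_distribution//; first exact/measurable_EFinP.
  exact: (bm_integrable D bfN).
have E3 : expect D (fun x => f (- x)) = - expect D f.
  by rewrite -exN//; apply: eq_ex => x; rewrite /f normrN mulNr.
have -> : expect P (fun t => Xr i t * (`|Xr i t| <= v)%R%:R) = expect P (fun t => f (X i t)).
  by [].
by rewrite E1; lra.
Qed.

Variable c1 : R.
Hypothesis c1_ge1 : (1 : R) <= c1.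
Hypothesis tail_le : forall v, 0 < v -> tail D v <= c1 / v.

Let mabsX i (v : R) : measurable_fun setT (fun t => v <= `|Xr i t|).
Proof.
by apply: measurable_ge; apply: measurableT_comp => //; exact: mX.
Qed.

Lemma exists_pow2 (v : R) : 1 <= v -> exists2 L : nat, v < 2 ^+ L & 2 ^+ L <= 2 * v.
Proof.
move=> v1.
have expect : exists L : nat, v < 2 ^+ L.
  have [k hk] : exists k : nat, v < k%:R.
    exists (Num.trunc v).+1; exact: truncnS_gt.
  exists k; apply: (lt_le_trans hk); rewrite -natrX ler_nat.
  by apply: ltnW; exact: ltn_expl.
exists (ex_minn expect); case: ex_minnP => // -[|L] hL hmin.
  by move: hL; rewrite expr0 ltNge v1.
rewrite exprS ler_wpM2l// leNgt; apply/negP => /hmin.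
by rewrite ltnn.
Qed.

Lemma dyad_absX_moments i L :
  expect P (fun t => dyad (fun l => 2 ^+ l <= `|Xr i t|) L) <= 1 + c1 * L%:R /\
  expect P (fun t => dyad (fun l => 2 ^+ l <= `|Xr i t|) L ^+ 2) <= 1 + 3 * c1 * 2 ^+ L.
Proof.
have me l := mabsX i (2 ^+ l).
have qe l : pr P (fun t => 2 ^+ l <= `|Xr i t|) <= c1 / 2 ^+ l.
  by rewrite pr_abs tail_le// exprn_gt0.
split; first exact: (ex_dyad_le me qe).
apply: (ex_dyad_sqr_le me qe) => t l; apply: le_trans.
by rewrite ler_eXn2l ?ltr1n.
Qed.

(** With 2^L in (v, 2 v], the truncated variable is dominated by [dyad] capped at 2^L, whose second
    moment is at most 1 + 6 c1 v. The constant 7 absorbs the 1, since c1 v >= 1. *)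
Lemma ex_trunc_sqr i v : 1 <= v ->
  expect P (fun t => (Xr i t * (`|Xr i t| <= v)%R%:R) ^+ 2) <= 7 * c1 * v.
Proof.
move=> v1; have [L vL Lv] := exists_pow2 v1.
have [_ h] := dyad_absX_moments i L.
apply: le_trans (le_trans h _); last first.
  have c1g := c1_ge1.
  have : 3 * c1 * 2 ^+ L <= 3 * c1 * (2 * v) by rewrite ler_wpM2l//; lra.
  have : 1 * 1 <= c1 * v by apply: ler_pM.
  lra.
apply: le_ex.
- apply: bmX; split.
    apply: measurable_funM; first exact: mX.
    apply: bm_measurable; apply: bm_bool; apply: measurable_le.
    by apply: measurableT_comp => //; exact: mX.
  exists v => t; case: (leP `|Xr _ t| v) => h'; rewrite ?mulr1// mulr0 normr0; lra.
- by apply: bmX; apply: bm_dyad => l; exact: mabsX.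
move=> t; case: (leP `|Xr _ t| v) => h'; last by rewrite mulr0 expr0n sqr_ge0.
rewrite mulr1 -real_normK ?num_real// ler_sqr ?nnegrE ?dyad_ge0//.
by apply: le_dyad; exact: le_lt_trans h' vL.
Qed.

(** Either some summand reaches [v], which costs #|G| c1 / v by the union bound, or the sum equals
    that of the summands truncated at [v]. These are centred by symmetry, with second moments at
    most 7 c1 v, so Markov's inequality for the square costs 7 #|G| c1 / v; hence 8. *)
Lemma sum_tail_le (G : {set I}) v : 1 <= v ->
  pr P (fun t => v <= `|\sum_(i in G) Xr i t|) <= 8 * c1 * #|G|%:R / v.
Proof.
move=> v1; have v0 : 0 < v by lra.
pose Y i t := Xr i t * (`|Xr i t| <= v)%R%:R.
have bY i : group_rv F [set i] (Y i).
  split; last first.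
    exists v => t; rewrite /Y; case: (leP `|Xr _ t| v) => h';
      rewrite ?mulr1// mulr0 normr0; lra.
  have mi := @group_X [set i]%SET i (set11 i).
  apply: measurable_funM => //.
  apply: bm_measurable; apply: bm_bool; apply: measurable_le.
  by apply: measurableT_comp.
have bmY i : bounded_measurable (Y i) := group_bm Fm (bY i).
pose B' t := \sum_(i in G) Y i t.
have bB' : bounded_measurable B' by apply: bm_sum.
have mB : measurable_fun setT (fun t => \sum_(i in G) Xr i t).
  by apply: (group_measurableP Fm (J := G)); exact: group_sum.
pose e1 t := [exists i, (i \in G) && (v <= `|Xr i t|)].
pose e2 t := v ^+ 2 <= B' t ^+ 2.
have me1 : measurable_fun setT e1.
  exact: measurable_existsb (fun i => mabsX i v).
have me2 : measurable_fun setT e2.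
  by apply: measurable_ge; apply: bm_measurable; exact: bmX.
apply: (@le_trans _ _ (pr P (fun t => e1 t || e2 t))).
  apply: le_pr; [|exact: measurable_or|].
    by apply: measurable_ge; apply: measurableT_comp.
  move=> t h; rewrite /e1 /e2; case: existsP => //= hn.
  suff -> : B' t = \sum_(i in G) Xr i t.
    by rewrite -[leRHS]real_normK ?num_real// ler_sqr ?nnegrE// ltW.
  apply: eq_bigr => i iG; rewrite /Y; case: (leP `|Xr _ t| v) => h'.
    by rewrite mulr1.
  by exfalso; apply: hn; exists i; rewrite iG ltW.
apply: le_trans (pr_or P me1 me2) _.
have h1 : pr P e1 <= #|G|%:R * (c1 / v).
  apply: le_trans (pr_exists P (mem G) (fun i => mabsX i v)) _.
  rewrite mulr_natl -sumr_const; apply: ler_sum => i _.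
  by rewrite pr_abs tail_le.
have h2 : pr P e2 <= #|G|%:R * (7 * c1 * v) / v ^+ 2.
  apply: le_trans (markov_ex P (bmX 2 bB') _ (exprn_gt0 2 v0)) _.
    by move=> t; rewrite sqr_ge0.
  rewrite ler_pM2r ?invr_gt0 ?exprn_gt0// /B'.
  rewrite (@ex_sqr_sum_centered _ _ _ P I F FT FI Fm indX _ (mem G)
    (fun i => [set i]%SET) Y _ bY) /=.
  - rewrite mulr_natl -sumr_const; apply: ler_sum => i _.
    exact: ex_trunc_sqr.
  - by move=> i k ik; rewrite disjoints1 inE.
  - by move=> i; exact: ex_trunc.
rewrite (le_trans (lerD h1 h2))//.
rewrite le_eqVlt; apply/orP; left; apply/eqP; field; lra.
Qed.

(** One big jump: [e i] asks that |X_i| reach [v], that no other summand does, and that the rest not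
    have the opposite sign, so that it cannot cancel the jump. These events are disjoint. The sign
    condition costs a factor 1/2 by the symmetry of X_i, and the others stay below [v] with
    probability at least 1/2; hence the 4. *)
Lemma sum_tail_ge (G : {set I}) v : 0 < v -> #|G|%:R * tail D v <= 1 / 2 ->
  #|G|%:R * (tail D v / 4) <= pr P (fun t => v <= `|\sum_(i in G) Xr i t|).
Proof.
move=> v0 small.
have p0 : 0 <= tail D v by rewrite fine_ge0.
pose rest i t := \sum_(k in G :\ i) Xr k t.
pose oth i t := ~~ [exists k, (k \in G :\ i) && (v <= `|Xr k t|)].
pose e i t := (v <= `|Xr i t|) && oth i t && (0 <= Xr i t * rest i t).
have mrest i : measurable_fun setT (rest i : group_sigma F (G :\ i) -> R).
  by apply: group_sum; exact: subxx.
have mrest' i : measurable_fun setT (rest i) := group_measurableP Fm (@mrest i).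
have moth i : measurable_fun setT (oth i : group_sigma F (G :\ i) -> bool).
  apply: measurable_neg.
  (* Repeating the membership inside makes the event constant for [k] outside the group, hence
     measurable for the sigma-algebra of the group whatever [k] is. *)
  have -> : (fun t => [exists k, (k \in G :\ i) && (v <= `|Xr k t|)]) =
     fun t => [exists k, (k \in G :\ i) && ((k \in G :\ i) && (v <= `|Xr k t|))].
    by apply/funext => t; apply: eq_existsb => k; rewrite andbA andbb.
  apply: (@measurable_existsb _ (group_sigma F (G :\ i)) I (mem (G :\ i))
   (fun k t => (k \in G :\ i) && (v <= `|Xr k t|))) => k.
  case: (boolP (k \in G :\ i)) => kG; last exact: measurable_cst.
  by apply: measurable_ge; apply: measurableT_comp => //; exact: group_X.
have moth' i : measurable_fun setT (oth i) := group_measurableP Fm (@moth i).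
have me i : measurable_fun setT (e i).
  apply: measurable_and; first by apply: measurable_and => //; exact: mabsX.
  apply: measurable_ge; apply: measurable_funM => //; exact: mX.
have dis i : [disjoint [set i]%SET & G :\ i]%B.
  by rewrite disjoints1 !inE eqxx.
have mi i : measurable_fun setT (Xr i : group_sigma F [set i]%SET -> R).
  exact: (@group_X [set i]%SET i (set11 i)).
have p_oth i : i \in G -> 1 / 2 <= pr P (oth i).
  move=> iG; rewrite pr_neg; last exact: measurable_existsb (fun k => mabsX k v).
  have := pr_exists P (mem (G :\ i)) (fun k => mabsX k v).
  have : \sum_(k in G :\ i) pr P (fun t => v <= `|Xr k t|) <= #|G|%:R * tail D v.
    under eq_bigr do rewrite pr_abs.
    rewrite sumr_const mulr_natl ler_wpMn2l// subset_leq_card//.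
    exact: subD1set.
  move=> h1 h2; have := le_trans h2 h1; lra.
have pe i : i \in G -> tail D v / 4 <= pr P (e i).
  move=> iG; have [hp hn] := pr_half i v0.
  (* The sign of [rest i] splits [oth i] in two. Each piece is paired with the half-line of X_i on
     the same side, which is independent of it and has mass [tail D v / 2]. *)
  pose o1 t := oth i t && (0 <= rest i t).
  pose o2 t := oth i t && ~~ (0 <= rest i t).
  have mo1 : measurable_fun setT (o1 : group_sigma F (G :\ i) -> bool).
    by apply: measurable_and => //; exact: measurable_ge.
  have mo2 : measurable_fun setT (o2 : group_sigma F (G :\ i) -> bool).
    by apply: measurable_and => //; apply: measurable_neg; exact: measurable_ge.
  have q1 := group_prM FT FI Fm indX (dis i) (measurable_ge v (mi i)) mo1.
  have q2 := group_prM FT FI Fm indX (dis i) (measurable_le (- v) (mi i)) mo2.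
  have b1 : bounded_measurable (fun t => ((v <= Xr i t)%R && o1 t)%:R : R).
    apply: bm_bool; apply: measurable_and; last exact: group_measurableP mo1.
    apply: measurable_ge; exact: mX.
  have b2 : bounded_measurable (fun t => ((Xr i t <= - v)%R && o2 t)%:R : R).
    apply: bm_bool; apply: measurable_and; last exact: group_measurableP mo2.
    apply: measurable_le; exact: mX.
  have : expect P (fun t => ((v <= Xr i t)%R && o1 t)%:R +
                        ((Xr i t <= - v)%R && o2 t)%:R) <= pr P (e i).
    apply: le_ex; [exact: bmD|exact: bm_bool|move=> t].
    rewrite /o1 /o2 /e; case: (oth i t); rewrite ?andbF ?addr0 ?ler0n// !andbT /=.
    case: (leP 0 (rest i t)) => hr /=; rewrite ?andbF ?andbT ?addr0 ?add0r.
      case: (leP v (Xr i t)) => hx; last by rewrite ler0n.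
      rewrite (le_trans hx (ler_norm _)) mulr_ge0//; lra.
    case: (leP (Xr i t) (- v)) => hx; last by rewrite ler0n.
    have -> : v <= `|Xr i t| by rewrite ler_normr lerNr hx orbT.
    have -> // : 0 <= Xr i t * rest i t.
    by rewrite mulr_le0//; [lra|exact: ltW].
  rewrite exD// -/(pr P _) -/(pr P _) q1 q2 hp hn -mulrDr.
  have <- : pr P (oth i) = pr P o1 + pr P o2.
    rewrite -exD; [|apply: bm_bool; exact: group_measurableP mo1
                    |apply: bm_bool; exact: group_measurableP mo2].
    apply: eq_ex => t; rewrite /o1 /o2; case: (oth i t); case: (0 <= rest i t);
      by rewrite /= ?addr0 ?add0r.
  apply: le_trans.
  have := ler_wpM2l p0 (p_oth _ iG); lra.
have mB : measurable_fun setT (fun t => \sum_(i in G) Xr i t).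
  by apply: (group_measurableP Fm (J := G)); exact: group_sum.
apply: (@le_trans _ _ (\sum_(i in G) pr P (e i))).
  by rewrite mulr_natl -sumr_const; exact: ler_sum.
rewrite -ex_sum; last by move=> i _; exact: bm_bool.
apply: le_ex.
- by apply: bm_sum => i _; exact: bm_bool.
- by apply: bm_bool; apply: measurable_ge; apply: measurableT_comp.
move=> t.
(* At most one [e i] holds at a given point, so the sum of their indicators is at most 1. *)
case: (pickP (fun i => (i \in G) && e i t)) => [i /andP[iG ei]|no]; last first.
  rewrite big1 ?ler0n// => i iG; have := no i; rewrite /= iG /= => ->//.
rewrite (bigD1 i)//= big1 ?addr0 => [|k /andP[kG ki]].
  rewrite ei (bigD1 i)//=.
  have -> : \sum_(k in G | k != i) Xr k t = rest i t.
    by apply: eq_bigl => k; rewrite !inE andbC.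
  move: ei => /andP[/andP[vX _] pos].
  suff -> : v <= `|Xr i t + rest i t| by [].
  apply: le_trans vX _.
  rewrite -ler_sqr ?nnegrE// !real_normK ?num_real//.
  have := sqr_ge0 (rest i t); rewrite sqrrD mulr2n; lra.
move: ei => /andP[/andP[vX _] _].
case ek : (e k t) => //; move: ek => /andP[/andP[_ ok] _].
by move: ok => /existsP[]; exists i; rewrite !inE eq_sym ki iG vX.
Qed.

End IidSums.

(** * Tail bounds of a power law of index 1 *)

Section PowerLawTail.
Context {R : realType}.
Variable D : probability (measurableTypeR R) R.

Let mgt (v : R) : measurable ([set x | v < x] : set (measurableTypeR R)).
Proof.
have -> : [set x : measurableTypeR R | v < x] = `]v, +oo[%classic.
  by apply/seteqP; split => x /=; rewrite in_itv/= andbT.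
exact: measurable_itv.
Qed.

Let mlt (v : R) : measurable ([set x | x < v] : set (measurableTypeR R)).
Proof.
have -> : [set x : measurableTypeR R | x < v] = `]-oo, v[%classic.
  by apply/seteqP; split => x /=; rewrite in_itv.
exact: measurable_itv.
Qed.

Let mabs (v : R) : measurable ([set x | v <= `|x|] : set (measurableTypeR R)).
Proof.
have := @measurable_ge _ _ R (@Num.norm R R : measurableTypeR R -> R) v.
move=> /(_ (@normr_measurable R setT)) /(_ measurableT [set true] I).
by rewrite setTI.
Qed.

Lemma ccdf_fine (v : R) :
  fine (D [set x | v < x]) = 1 - fine (D `]-oo, v]%classic).
Proof.
have -> : [set x : measurableTypeR R | v < x] = ~` `]-oo, v]%classic.
  by apply/seteqP; split => x /=; rewrite in_itv/= ltNge => /negP.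
have m : measurable (`]-oo, v]%classic : set (measurableTypeR R)).
  exact: measurable_itv.
by rewrite probability_setC// fineB ?fin_num_measure.
Qed.

(** From some x1 on, the one-sided tail is within a factor 2 of c / x. The upper bound is taken at v
    / 2 because the distribution function controls open half-lines, whereas [tail] is that of a
    closed condition. *)
Lemma power_law_tails : symmetric_power_law 1 D ->
  exists c1 c2 x0 : R, [/\ 1 <= c1, 0 < c2, 0 < x0,
    forall v, 0 < v -> tail D v <= c1 / v &
    forall v, x0 <= v -> c2 / v <= tail D v].
Proof.
move=> [symD [c c0 lim]].
have [x1 [x1_gt0 hx1]] : exists x1 : R, 0 < x1 /\ forall x, x1 <= x ->
    c / 2 / x <= fine (D [set y | x < y]) <= 2 * c / x.
  have half0 : (0 : R) < 1 / 2 by lra.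
  have /cvgrPdist_lt /(_ _ half0) [M [_ hM]] := lim.
  exists (`|M| + 1); split; first by rewrite ltr_wpDl.
  move=> x Mx; have x0 : 0 < x by apply: lt_le_trans Mx; rewrite ltr_wpDl.
  have /hM : M < x.
    by apply: lt_le_trans Mx; apply: le_lt_trans (ler_norm M) _; rewrite ltrDl.
  rewrite /= -ccdf_fine powR_inv1; last exact: ltW.
  rewrite ltr_norml => /andP[h1 h2].
  set s := fine _ in h1 h2 *.
  have E : s = s / (c * x^-1) * (c / x) by field; rewrite !gt_eqF.
  have cx : 0 < c / x by rewrite divr_gt0.
  set z := s / (c * x^-1) in h1 h2 E.
  rewrite E; apply/andP; split.
    rewrite [leLHS](_ : _ = 1 / 2 * (c / x)); last by ring.
    by rewrite ler_pM2r//; lra.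
  rewrite -[leRHS]mulrA ler_pM2r//; lra.
(* The 8 c is two sides of 2 c / (v / 2); the 2 x1 makes the bound at least 1 when v <= 2 x1; the 1
   ensures that the constant is at least 1. *)
exists (1 + 8 * c + 2 * x1), (c / 2), x1; split => //; first lra; first lra.
- move=> v v0.
  have p1 : tail D v <= 1.
    rewrite -lee_fin /tail fineK ?fin_num_measure//; exact: probability_le1.
  have [vx|xv] := leP v (2 * x1).
    apply: le_trans p1 _; rewrite ler_pdivlMr// mul1r; lra.
  have hv : x1 <= v / 2 by lra.
  have /andP[_ h] := hx1 _ hv.
  have hs : tail D v <= fine (D [set y | v / 2 < y]) + fine (D [set y | y < - (v / 2)]).
    rewrite /tail -fineD ?fin_num_measure// fine_le ?fin_num_measure//.
      by rewrite fin_numD !fin_num_measure.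
    apply: le_trans (measureU2 _ _ _) => //.
    rewrite le_measure ?inE//; first exact: measurableU.
    move=> x /=; rewrite ler_normr => /orP[] hx; [left|right]; lra.
  have E : D [set y | y < - (v / 2)] = D [set y | v / 2 < y].
    rewrite -(symD _ (mlt (- (v / 2)))); congr (D _).
    by apply/seteqP; split => x /=; rewrite ltrN2.
  rewrite E in hs.
  apply: le_trans hs _; rewrite ler_pdivlMr//.
  move: h; rewrite ler_pdivlMr; last by lra.
  set y := fine _ => h; have : y * (v / 2) = y * v / 2 by ring.
  lra.
- move=> v xv; have /andP[h _] := hx1 _ xv; apply: le_trans h _.
  rewrite fine_le ?fin_num_measure// le_measure ?inE// => x /= hx.
  by rewrite (le_trans (ltW hx))// ler_norm.
Qed.

End PowerLawTail.

(** * Deterministic inequalities *)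

Section Deterministic.
Context {R : realType}.

Definition beaten d (m : R) (b : 'I_d -> R) (j : 'I_d) : bool :=
  [exists k, (k != j) && ((m <= `|b k|) && (`|b j| <= `|b k|))].

(* In a row whose largest entry reaches m, that entry is kept as signal and all
   the others, which are beaten, are charged as noise. *)
Lemma row_lower_bound d (m : R) (b x : 'I_d -> R) :
  \sum_j `|x j| * (`|b j| * (m <= `|b j|)%R%:R - 2 * (`|b j| * (beaten m b j)%:R))
    <= `|\sum_j b j * x j|.
Proof.
have [/existsP[j0 hj0]|/existsPn none] := boolP [exists j, m <= `|b j|]; last first.
  apply: (@le_trans _ _ 0) => //; apply: sumr_le0 => j _.
  rewrite (negbTE (none j)) mulr0 sub0r mulrN oppr_le0.
  by rewrite !mulr_ge0.
pose w := [arg max_(j > j0) `|b j|]%O.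
have [wmax mw] : (forall j, `|b j| <= `|b w|) /\ m <= `|b w|.
  rewrite /w; case: arg_maxP => // i _ hi; split; first by move=> j; exact: hi.
  by apply: le_trans hj0 _; exact: hi.
rewrite [X in _ <= `|X|](bigD1 w)//=.
apply: (@le_trans _ _ (`|b w * x w| - `|\sum_(j | j != w) b j * x j|)); last first.
  rewrite -[X in _ <= `|_ + X|]opprK; apply: le_trans (lerB_dist _ _).
  by rewrite normrN.
apply: (@le_trans _ _ (`|b w * x w| - \sum_(j | j != w) `|b j * x j|)); last first.
  by rewrite lerD2l lerN2; exact: ler_norm_sum.
rewrite (bigD1 w)//= -sumrN; apply: lerD.
  rewrite normrM mulrC ler_wpM2r// mw mulr1 lerBlDr lerDl.
  by rewrite !mulr_ge0.
(* For a losing column, one copy of the doubled noise cancels the signal it may have been credited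
   with, and the other pays for [|b j * x j|]. *)
apply: ler_sum => j jw.
have -> : beaten m b j by apply/existsP; exists w; rewrite eq_sym jw mw wmax.
rewrite normrM mulr1 [leLHS]mulrC -[leRHS]mulNr ler_wpM2r//.
by case: (m <= `|b j|); rewrite ?mulr1 ?mulr0; have := normr_ge0 (b j); lra.
Qed.

(** The squares of the two sums share their diagonal, so they differ by at most twice the
    off-diagonal part, and the square root is subadditive. Only products of distinct entries
    survive, whose expectations factor. The majorants [z] leave room for dyadic rounding. *)
Lemma l1_le_cancellation (I : finType) (G : {set I}) (y z : I -> R) :
  (forall i, i \in G -> `|y i| <= z i) ->
  \sum_(i in G) `|y i| <= `|\sum_(i in G) y i| +
    Num.sqrt (2 * \sum_(i in G) \sum_(k in G | k != i) z i * z k).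
Proof.
move=> yz.
set Xi := \sum_(i in G) _.
pose Xi0 := \sum_(i in G) \sum_(k in G | k != i) `|y i| * `|y k|.
have Xi0le : Xi0 <= Xi.
  apply: ler_sum => i iG; apply: ler_sum => k /andP[kG _].
  by apply: ler_pM => //; exact: yz.
have Xi00 : 0 <= Xi0 by do 2 (apply: sumr_ge0 => ? _); rewrite mulr_ge0.
have sqE (f : I -> R) : (\sum_(i in G) f i) ^+ 2 = \sum_(i in G) f i ^+ 2 +
    \sum_(i in G) \sum_(k in G | k != i) f i * f k.
  rewrite expr2 mulr_suml -big_split /=; apply: eq_bigr => i iG.
  by rewrite mulr_sumr (bigD1 i)//= expr2.
have lowB : - Xi0 <= \sum_(i in G) \sum_(k in G | k != i) y i * y k.
  rewrite -sumrN; apply: ler_sum => i _; rewrite -sumrN; apply: ler_sum => k _.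
  by rewrite -normrM lerNl; apply: le_trans (ler_norm _) _; rewrite normrN.
rewrite -ler_sqr ?nnegrE; last 2 first.
- by apply: sumr_ge0.
- by rewrite addr_ge0// sqrtr_ge0.
rewrite sqE sqrrD real_normK ?num_real// sqr_sqrtr; last by lra.
rewrite sqE -/Xi0; under eq_bigr do rewrite real_normK ?num_real//.
have : 0 <= `|\sum_(i in G) y i| * Num.sqrt (2 * Xi).
  by rewrite mulr_ge0// sqrtr_ge0.
by rewrite mulr2n; lra.
Qed.

Lemma sum_pow2_le (b : R) L : 0 <= b ->
  \sum_(l < L) 2 ^+ l * (2 ^+ l <= b)%R%:R <= 2 * b.
Proof.
move=> b0; elim: L => [|L IHL]; first by rewrite big_ord0; lra.
have [h|h] := leP (2 ^+ L) b; last first.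
  by rewrite big_ord_recr /= (lt_geF h) mulr0 addr0.
apply: (@le_trans _ _ (\sum_(l < L.+1) 2 ^+ l)).
  apply: ler_sum => l _; rewrite ler_piMr ?exprn_ge0//.
  by rewrite lern1 leq_b1.
by rewrite sum_exp2 exprS; lra.
Qed.

(** The levels below [m] give 2^-m each and the others a geometric tail. This factor m is what puts
    a logarithm into the order d log d of 2^m. *)
Lemma sum_inv_pow2_maxn m L :
  \sum_(l < L) ((2 : R) ^+ maxn l m)^-1 <= (m%:R + 2) / 2 ^+ m.
Proof.
have p0 k : (0 : R) < (2 ^+ k)^-1 by rewrite invr_gt0 exprn_gt0.
suff -> : \sum_(l < L) ((2 : R) ^+ maxn l m)^-1 =
    (minn L m)%:R / 2 ^+ m + 2 / 2 ^+ m - 2 / 2 ^+ maxn L m.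
  have h1 : (minn L m)%:R / 2 ^+ m <= m%:R / 2 ^+ m :> R.
    by rewrite ler_pM2r// ler_nat geq_minr.
  have h2 : (0 : R) <= 2 / 2 ^+ maxn L m by rewrite mulr_ge0// ltW.
  by rewrite [leRHS]mulrDl; lra.
elim: L => [|L IHL]; first by rewrite big_ord0 min0n max0n mul0r; ring.
rewrite big_ord_recr /= IHL; have [Lm|mL] := ltnP L m.
  rewrite (minn_idPl Lm) (maxn_idPr Lm).
  by rewrite -[L.+1]addn1 natrD; ring.
rewrite (minn_idPr (leqW mL)) (maxn_idPl (leqW mL)).
rewrite exprS; field.
by rewrite !expf_neq0.
Qed.

End Deterministic.

(** * The sketched matrix for a fixed hash function *)

Section SketchedMatrix.
Context {disp : measure_display} {T : measurableType disp} {R : realType}.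
Variables (P : probability T R) (D : probability (measurableTypeR R) R).
Variables (n d r : nat) (X : 'I_n * 'I_d -> T -> measurableTypeR R).
Hypothesis mX : forall p, measurable_fun setT (X p).
Hypothesis lawX : forall p (B : set (measurableTypeR R)), measurable B ->
  P (X p @^-1` B) = D B.
Hypothesis indX : mutually_independent P (fun p => sigma_of (X p)).
Hypothesis symD : symmetric_dist D.
Variables c1 c2 x0 : R.
Hypothesis c1_ge1 : 1 <= c1.
Hypothesis c2_gt0 : 0 < c2.
Hypothesis tail_le : forall v, 0 < v -> tail D v <= c1 / v.
Hypothesis tail_ge : forall v, x0 <= v -> c2 / v <= tail D v.
Variables (h : {ffun 'I_n -> 'I_r}) (N : R).
Hypothesis nN : n%:R = N * r%:R.
Hypothesis N_ge1 : 1 <= N.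

Definition bucket (k : 'I_r) : {set 'I_n} := [set i | h i == k]%SET.

Hypothesis load : forall k, #|bucket k|%:R <= 2 * N.

Notation F := (fun p => sigma_of (X p)).
Let FT i : F i setT := @sigma_ofT _ _ _ (X i).
Let FI i : setI_closed (F i) := @sigma_ofI _ _ _ (X i).
Let Fm i : F i `<=` measurable := sigma_of_measurable (mX i).

(** Index sets carrying the independence of a sketch: distinct rows have disjoint [crow], and within
    a row the column [j] and its competitors live on the disjoint sets [cell k j] and
    [cother k j]. *)
Definition cell k (j : 'I_d) : {set 'I_n * 'I_d} := finset.setX (bucket k) [set j]%SET.
Definition crow k : {set 'I_n * 'I_d} := finset.setX (bucket k) [set: 'I_d]%SET.
Definition cother k (j : 'I_d) : {set 'I_n * 'I_d} :=
  finset.setX (bucket k) [set~ j]%SET.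

(** Dividing by the mean bucket size makes the level probabilities of order 2^-l, free of n and
    r. *)
Definition entry k j t : R := (\sum_(p in cell k j) X p t) / N.
Definition large l k j t : bool := 2 ^+ l <= `|entry k j t|.

(** The constant 8 c1 of [sum_tail_le] times a bucket size of at most 2 N, divided by N. *)
Let q : R := 16 * c1.
Let q_ge1 : 1 <= q. Proof. by have := c1_ge1; rewrite /q; lra. Qed.
Let N_gt0 : 0 < N. Proof. by have := N_ge1; lra. Qed.

Lemma card_cell k j : #|cell k j| = #|bucket k|.
Proof. by rewrite cardsX cards1 muln1. Qed.

Lemma sum_card_bucket : \sum_k #|bucket k|%:R = n%:R :> R.
Proof.
rewrite -natr_sum; congr (_%:R).
rewrite -[RHS]card_ord -sum1_card (partition_big h xpredT)//=.
by apply: eq_bigr => k _; rewrite -sum1_card; apply: eq_bigl => i; rewrite inE.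
Qed.

Lemma disjoint_crow k k' : k != k' -> [disjoint crow k & crow k']%B.
Proof.
move=> kk'; apply/pred0P => -[i j] /=; rewrite !inE !andbT.
by case: eqP => //= ->; exact: negbTE.
Qed.

Lemma disjoint_cell k j : [disjoint cell k j & cother k j]%B.
Proof.
by apply/pred0P => -[i j'] /=; rewrite !inE; case: (h i == k) => //=; rewrite andbN.
Qed.

Lemma cell_sub_crow k j : cell k j \subset crow k.
Proof. by apply/fintype.subsetP => -[i j']; rewrite !inE => /andP[->]. Qed.

Lemma cell_sub_cother k j j' : j' != j -> cell k j' \subset cother k j.
Proof.
by move=> jj'; apply/fintype.subsetP => -[i j'']; rewrite !inE => /andP[-> /eqP ->].
Qed.

Lemma group_large (J : {set 'I_n * 'I_d}) l k j : cell k j \subset J ->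
  measurable_fun setT (large l k j : group_sigma F J -> bool).
Proof.
move=> sJ; apply: measurable_ge; apply: measurableT_comp => //.
apply: measurable_funM; last exact: measurable_cst.
exact: group_sum.
Qed.

Lemma measurable_large l k j : measurable_fun setT (large l k j).
Proof. exact: (group_measurableP Fm (@group_large (cell k j) l k j (subxx _))). Qed.

Lemma large_decreasing k j t : decreasingb (fun l => large l k j t).
Proof. by move=> l; apply: le_trans; rewrite ler_eXn2l ?ltr1n. Qed.

Lemma largeE l k j t :
  large l k j t = (2 ^+ l * N <= `|\sum_(p in cell k j) X p t|).
Proof. by rewrite /large normrM normfV (gtr0_norm N_gt0) ler_pdivlMr. Qed.

Lemma pr_large_le l k j : pr P (large l k j) <= q / 2 ^+ l.
Proof.
have -> : large l k j = fun t => 2 ^+ l * N <= `|\sum_(p in cell k j) X p t|.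
  by apply/funext => t; rewrite largeE.
have Ng := N_gt0; have N1 := N_ge1; have c1g := c1_ge1.
have p2 : (0 : R) < 2 ^+ l by rewrite exprn_gt0.
have v1 : 1 <= 2 ^+ l * N by rewrite -[leLHS]mulr1 ler_pM// exprn_ege1// ler1n.
apply: le_trans (sum_tail_le mX lawX indX symD c1_ge1 tail_le _ v1) _.
rewrite card_cell ler_pdivrMr ?mulr_gt0// /q.
have -> : 16 * c1 / 2 ^+ l * (2 ^+ l * N) = 8 * c1 * (2 * N) by field; rewrite gt_eqF.
by rewrite ler_wpM2l//; lra.
Qed.

(** The bucket size stays in the bound because a bucket may be small; the sum over all buckets is n.
    The condition 4 c1 <= 2^l brings the bucket size times the tail, at most 2 c1 / 2^l, below the
    1/2 that [sum_tail_ge] asks for. *)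
Lemma pr_large_ge l k j : x0 <= 2 ^+ l * N -> 4 * c1 <= 2 ^+ l ->
  #|bucket k|%:R * c2 / (4 * N) <= 2 ^+ l * pr P (large l k j).
Proof.
move=> hx hc.
have -> : large l k j = fun t => 2 ^+ l * N <= `|\sum_(p in cell k j) X p t|.
  by apply/funext => t; rewrite largeE.
have Ng := N_gt0; have N1 := N_ge1; have c1g := c1_ge1.
have p2 : (0 : R) < 2 ^+ l by rewrite exprn_gt0.
have v0 : 0 < 2 ^+ l * N by rewrite mulr_gt0.
have b0 : (0 : R) <= #|bucket k|%:R by [].
have small : #|cell k j|%:R * tail D (2 ^+ l * N) <= 1 / 2.
  rewrite card_cell; apply: (@le_trans _ _ (2 * N * (c1 / (2 ^+ l * N)))).
    by apply: ler_pM => //; [rewrite fine_ge0|exact: tail_le].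
  have -> : 2 * N * (c1 / (2 ^+ l * N)) = 2 * c1 / 2 ^+ l.
    by field; rewrite !gt_eqF.
  by rewrite ler_pdivrMr//; lra.
have := sum_tail_ge mX lawX indX symD v0 small.
rewrite card_cell => H; rewrite [leRHS]mulrC -ler_pdivrMr//; apply: le_trans H.
have -> : #|bucket k|%:R * c2 / (4 * N) / 2 ^+ l =
    #|bucket k|%:R * (c2 / (2 ^+ l * N) / 4) by field; rewrite !gt_eqF.
by rewrite ler_wpM2l// ler_pM2r ?invr_gt0//; exact: tail_ge.
Qed.

(** * Signal of a column *)

Variables m s u L : nat.
Hypothesis ms : (m < s)%N.
Hypothesis m_x0 : x0 <= 2 ^+ m * N.
Hypothesis m_c1 : 4 * c1 <= 2 ^+ m.
Hypothesis r_gt0 : (0 < r)%N.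

Let rR_gt0 : (0 : R) < r%:R. Proof. by rewrite ltr0n. Qed.
Let w : R := (s - m)%:R.
Let w_ge1 : 1 <= w. Proof. by rewrite ler1n subn_gt0. Qed.

(** Entries count from level [m] on, and stopping at [s] keeps the second moment of order 2^s. The
    other cutoffs are caps of the same kind: [u] for the noise, [L] for single entries of the
    matrix. *)
Definition signal k j t : R := \sum_(m <= l < s) 2 ^+ l * (large l k j t)%:R.

Lemma signal_le_dyad k j t : signal k j t <= dyad (fun l => large l k j t) s.
Proof.
rewrite /dyad -(big_mkord xpredT (fun l => 2 ^+ l * (large l k j t)%:R)).
rewrite (@big_cat_nat _ _ _ m 0 s)//=; last exact: ltnW.
rewrite addrA lerDr addr_ge0// big_mkord sumr_ge0//.
Qed.

Lemma signal_ge0 k j t : 0 <= signal k j t.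
Proof. by apply: sumr_ge0 => l _; rewrite mulr_ge0// exprn_ge0. Qed.

Lemma signal_le_entry k j t :
  signal k j t <= 2 * (`|entry k j t| * (2 ^+ m <= `|entry k j t|)%R%:R).
Proof.
case: (leP (2 ^+ m) `|entry k j t|) => hm; last first.
  rewrite !mulr0 /signal big_nat big1// => l /andP[ml _].
  rewrite /large lt_geF ?mulr0//; apply: lt_le_trans hm _.
  by rewrite ler_eXn2l ?ltr1n.
rewrite mulr1; apply: le_trans (sum_pow2_le s (normr_ge0 _)).
rewrite -(big_mkord xpredT (fun l => 2 ^+ l * (2 ^+ l <= `|entry k j t|)%R%:R)).
rewrite [leRHS](@big_cat_nat _ _ _ m 0 s)//=; last exact: ltnW.
by rewrite lerDr big_mkord sumr_ge0.
Qed.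

(** Each of the w levels contributes at least #|bucket k| c2 / (4 N) to the mean, hence w c2 r / 4
    over all rows. Chebyshev with half of it as deviation and second moments at most 4 q 2^s gives
    256 as 4 times 8^2. *)
Lemma signal_event j :
  pr P (fun t => \sum_k signal k j t <= w * c2 * r%:R / 8) <=
  256 * q * 2 ^+ s / (w ^+ 2 * c2 ^+ 2 * r%:R).
Proof.
have wg := w_ge1; have cg := c2_gt0; have rg := rR_gt0; have qg := q_ge1.
have Ng := N_gt0.
have bsig k (J : {set 'I_n * 'I_d}) : cell k j \subset J ->
    group_rv F J (signal k j).
  move=> sJ; apply: bm_sum => l _; apply: bmM; first exact: bm_cst.
  by apply: bm_bool; exact: group_large.
have bmsig k : bounded_measurable (signal k j) :=
  group_bm Fm (bsig k _ (subxx _)).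
have w0 : 0 < w * c2 * r%:R / 8 by rewrite divr_gt0// !mulr_gt0//; lra.
have -> : w * c2 * r%:R / 8 = w * c2 * r%:R / 4 - w * c2 * r%:R / 8 by field.
apply: le_trans (chebyshev_sum_lower FT FI Fm indX (@disjoint_crow)
  (fun k => bsig k _ (cell_sub_crow k j)) (b := 4 * q * 2 ^+ s) w0 _ _) _.
- apply: (@le_trans _ _ (\sum_k #|bucket k|%:R * c2 / (4 * N) * w)).
    rewrite -!mulr_suml sum_card_bucket nN.
    by rewrite le_eqVlt; apply/orP; left; apply/eqP; field; rewrite gt_eqF.
  apply: ler_sum => k _; rewrite /signal ex_sum; last first.
    by move=> l _; apply: bmM; [exact: bm_cst|apply: bm_bool; exact: measurable_large].
  rewrite mulr_natr -sumr_const_nat; apply: ler_sum_nat => l /andP[ml _].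
  rewrite exZ; last by apply: bm_bool; exact: measurable_large.
  have m2 : (2 : R) ^+ m <= 2 ^+ l by rewrite ler_eXn2l ?ltr1n.
  apply: pr_large_ge; last exact: le_trans m_c1 m2.
  by apply: le_trans m_x0 _; rewrite ler_pM2r.
- move=> k.
  apply: (@le_trans _ _
    (expect P (fun t => dyad (fun l => large l k j t) s ^+ 2))).
    apply: le_ex.
    + exact: bmX.
    + by apply: bmX; apply: bm_dyad => l; exact: measurable_large.
    + move=> t; rewrite ler_sqr ?nnegrE ?signal_ge0 ?dyad_ge0//.
      exact: signal_le_dyad.
  apply: le_trans (ex_dyad_sqr_le (fun l => @measurable_large l k j)
    (fun l => pr_large_le l k j) _ _) _.
    by move=> t; exact: large_decreasing.
  have h2 : (1 : R) <= 2 ^+ s by rewrite exprn_ege1// ler1n.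
  have : 1 * 1 <= q * 2 ^+ s by apply: ler_pM.
  lra.
rewrite card_ord le_eqVlt; apply/orP; left; apply/eqP; field.
by rewrite !gt_eqF//; lra.
Qed.

(* On the rows where another column wins, the entry of column j is charged to
   the noise; a dyadic level l of that entry needs a rival at level max(l, m). *)
Definition rival l k j t : bool := [exists j', (j' != j) && large l k j' t].
Definition noise_level k j t l : bool := large l k j t && rival (maxn l m) k j t.
(** Without the factor [rival m k j t], the constant 1 inside [dyad] would be charged in every row,
    also where no competitor exists; with it the mean carries the factor d / 2^m. *)
Definition noise k j t : R := (rival m k j t)%:R * dyad (noise_level k j t) u.

Lemma rival_le l l' k j t : (l <= l')%N -> rival l' k j t -> rival l k j t.
Proof.
move=> ll' /existsP[j' /andP[jj' hj']]; apply/existsP; exists j'; rewrite jj' /=.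
exact: decreasingb_le (@large_decreasing k j' t) ll' hj'.
Qed.

Lemma group_rival l k j :
  measurable_fun setT (rival l k j : group_sigma F (cother k j) -> bool).
Proof.
have -> : rival l k j =
  fun t => [exists j', (j' != j) && ((j' != j) && large l k j' t)].
  by apply/funext => t; apply: eq_existsb => j'; rewrite andbA andbb.
apply: (@measurable_existsb _ (group_sigma F (cother k j)) _ (fun j' => j' != j)
  (fun j' t => (j' != j) && large l k j' t)) => j'.
case: (boolP (j' != j)) => jj'; last exact: measurable_cst.
by apply: group_large; exact: cell_sub_cother.
Qed.

Lemma measurable_rival l k j : measurable_fun setT (rival l k j).
Proof. exact: (group_measurableP Fm (@group_rival l k j)). Qed.

Lemma pr_rival l k j : pr P (rival l k j) <= d%:R * q / 2 ^+ l.
Proof.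
have qg := q_ge1.
have q0 : 0 <= q / 2 ^+ l by rewrite mulr_ge0 ?invr_ge0 ?exprn_ge0//; lra.
apply: le_trans (pr_exists P (fun j' => j' != j)
  (fun j' => @measurable_large l k j')) _.
apply: (@le_trans _ _ (\sum_(j' < d | j' != j) q / 2 ^+ l)).
  by apply: ler_sum => j' _; exact: pr_large_le.
rewrite sumr_const -mulrA mulr_natl ler_wpMn2l//.
by rewrite -[leqRHS]card_ord max_card.
Qed.

Lemma noise_level_decreasing k j t : decreasingb (noise_level k j t).
Proof.
move=> l /andP[hl hr]; apply/andP; split; first exact: large_decreasing hl.
apply: rival_le hr; rewrite geq_max leq_maxr andbT.
exact: leq_trans (leqnSn l) (leq_maxl _ _).
Qed.

Lemma noise_level_rival k j t l : noise_level k j t l -> rival m k j t.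
Proof. by move=> /andP[_]; apply: rival_le; exact: leq_maxr. Qed.

Lemma noiseE k j t : noise k j t =
  (rival m k j t)%:R + \sum_(l < u) 2 ^+ l * (noise_level k j t l)%:R.
Proof.
rewrite /noise /dyad mulrDr mulr1 mulr_sumr; congr (_ + _).
apply: eq_bigr => l _; have := @noise_level_rival k j t l.
by case: (noise_level k j t l) => [->//|_]; rewrite ?mul1r// !mulr0.
Qed.

Lemma noise_sqrE k j t : noise k j t ^+ 2 =
  (rival m k j t)%:R + \sum_(l < u) 3 * 4 ^+ l * (noise_level k j t l)%:R.
Proof.
rewrite /noise exprMn dyad_sqr; last exact: noise_level_decreasing.
have -> : ((rival m k j t)%:R : R) ^+ 2 = (rival m k j t)%:R.
  by case: (rival m k j t); rewrite ?expr1n// expr0n.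
rewrite mulrDr mulr1 mulr_sumr; congr (_ + _).
apply: eq_bigr => l _; have := @noise_level_rival k j t l.
by case: (noise_level k j t l) => [->//|_]; rewrite ?mul1r// !mulr0.
Qed.

Lemma measurable_noise_level k j l : measurable_fun setT ((noise_level k j)^~ l).
Proof.
by apply: measurable_and; [exact: measurable_large|exact: measurable_rival].
Qed.

(** The entry depends on [cell k j] and its rivals on [cother k j], so the two tails multiply. This
    double decay cancels the weight 4^l and keeps the second moment of the noise linear in [u]. *)
Lemma pr_noise_level k j l : pr P ((noise_level k j)^~ l) <=
  q / 2 ^+ l * (d%:R * q / 2 ^+ maxn l m).
Proof.
rewrite (group_prM FT FI Fm indX (disjoint_cell k j)
  (group_large l (subxx _)) (@group_rival (maxn l m) k j)).
by apply: ler_pM; rewrite ?pr_ge0 ?pr_large_le ?pr_rival.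
Qed.

(** Per row, the mean is at most d q / 2^m for [rival m] plus d q^2 (m + 2) / 2^m for the levels,
    and the second moment is at most d q + 3 d q^2 u. *)
Lemma noise_event j (a lam : R) : 0 < lam ->
  d%:R * q * (1 + 2 * q + m%:R * q) / 2 ^+ m <= a ->
  pr P (fun t => r%:R * a + lam <= \sum_k noise k j t) <=
  r%:R * (d%:R * q * (1 + 3 * q * u%:R)) / lam ^+ 2.
Proof.
move=> lam0 ha; have qg := q_ge1.
have bn k : group_rv F (crow k) (noise k j).
  have mr l : measurable_fun setT (rival l k j : group_sigma F (crow k) -> bool).
    apply: (@measurable_existsb _ (group_sigma F (crow k)) _ (fun j' => j' != j)
      (fun j' t => large l k j' t)) => j'.
    by apply: group_large; exact: cell_sub_crow.
  apply: bmM; first by apply: bm_bool; exact: mr.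
  apply: (@bm_dyad _ (group_sigma F (crow k)) R (fun l t => noise_level k j t l)).
  move=> l; apply: measurable_and; last exact: mr.
  by apply: group_large; exact: cell_sub_crow.
have bnl k l : bounded_measurable (fun t => (noise_level k j t l)%:R : R).
  by apply: bm_bool; exact: measurable_noise_level.
have br k : bounded_measurable (fun t => (rival m k j t)%:R : R).
  by apply: bm_bool; exact: measurable_rival.
have p2 l : (0 : R) < 2 ^+ l by rewrite exprn_gt0.
have dq0 : 0 <= d%:R * q by rewrite mulr_ge0//; lra.
rewrite -[X in X%:R * _ / _]card_ord -[X in X%:R * a]card_ord.
apply: (chebyshev_sum_upper FT FI Fm indX (@disjoint_crow) bn lam0) => k.
- apply: le_trans ha; under eq_ex do rewrite noiseE.
  rewrite exD//; last first.
    by apply: bm_sum => l _; apply: bmM => //; exact: bm_cst.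
  rewrite ex_sum; last by move=> l _; apply: bmM => //; exact: bm_cst.
  have hr := pr_rival m k j.
  have hs : \sum_(l < u) expect P (fun t => 2 ^+ l * (noise_level k j t l)%:R) <=
      d%:R * q * q * ((m%:R + 2) / 2 ^+ m).
    apply: (@le_trans _ _ (\sum_(l < u) d%:R * q * q * ((2 : R) ^+ maxn l m)^-1)).
      apply: ler_sum => l _; rewrite exZ//.
      have := ler_wpM2l (ltW (p2 l)) (pr_noise_level k j l).
      move=> /le_trans; apply; rewrite le_eqVlt; apply/orP; left; apply/eqP.
      by field; rewrite !gt_eqF.
    rewrite -mulr_sumr ler_wpM2l//; first by rewrite mulr_ge0//; lra.
    exact: sum_inv_pow2_maxn.
  rewrite (le_trans (lerD hr hs))// le_eqVlt; apply/orP; left; apply/eqP.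
  by field; rewrite gt_eqF.
- under eq_ex do rewrite noise_sqrE.
  rewrite exD//; last first.
    by apply: bm_sum => l _; apply: bmM => //; exact: bm_cst.
  rewrite ex_sum; last by move=> l _; apply: bmM => //; exact: bm_cst.
  have hr : pr P (rival m k j) <= d%:R * q.
    apply: le_trans (pr_rival m k j) _; rewrite ler_pdivrMr// ler_peMr//.
    by rewrite exprn_ege1// ler1n.
  have hs : \sum_(l < u) expect P (fun t => 3 * 4 ^+ l * (noise_level k j t l)%:R) <=
      3 * d%:R * q * q * u%:R.
    apply: (@le_trans _ _ (\sum_(l < u) 3 * d%:R * q * q)); last first.
      by rewrite sumr_const card_ord [leRHS]mulr_natr.
    apply: ler_sum => l _; rewrite exZ//.
    have p4 : (0 : R) <= 3 * 4 ^+ l by rewrite mulr_ge0// exprn_ge0.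
    have := ler_wpM2l p4 (pr_noise_level k j l).
    move=> /le_trans; apply.
    have -> : (4 : R) ^+ l = 2 ^+ l * 2 ^+ l by rewrite -exprMn; congr (_ ^+ _); ring.
    have -> : 3 * (2 ^+ l * 2 ^+ l) * (q / 2 ^+ l * (d%:R * q / 2 ^+ maxn l m)) =
       3 * d%:R * q * q * (2 ^+ l / 2 ^+ maxn l m).
      by field; rewrite !gt_eqF.
    have q0 : 0 <= q by lra.
    have A0 : 0 <= 3 * d%:R * q * q.
      by apply: mulr_ge0 => //; apply: mulr_ge0 => //; apply: mulr_ge0.
    rewrite ler_piMr//.
    by rewrite ler_pdivrMr// mul1r ler_eXn2l ?ltr1n// leq_maxl.
  rewrite (le_trans (lerD hr hs))// le_eqVlt; apply/orP; left; apply/eqP.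
  by ring.
Qed.

(** Entries below 2^m are not signal but still count in the upper bound on |A x|_1; for them the cap
    [m] is enough, with mean at most 1 + q m per row. *)
Lemma small_event j :
  pr P (fun t => r%:R * (1 + q * m%:R) + r%:R <=
                 \sum_k dyad (fun l => large l k j t) m) <=
  (1 + 3 * q * 2 ^+ m) / r%:R.
Proof.
have rg := rR_gt0.
have bn k : group_rv F (crow k) (fun t => dyad (fun l => large l k j t) m : R).
  exact: (@bm_dyad _ (group_sigma F (crow k)) R (fun l t => large l k j t)
    (fun l => @group_large (crow k) l k j (cell_sub_crow k j)) m).
have := chebyshev_sum_upper FT FI Fm indX (@disjoint_crow) bn rg
  (fun k => ex_dyad_le (fun l => @measurable_large l k j)
    (fun l => pr_large_le l k j) m)
  (fun k => ex_dyad_sqr_le (fun l => @measurable_large l k j)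
    (fun l => pr_large_le l k j) m (fun t => @large_decreasing k j t)).
rewrite card_ord => /le_trans; apply.
rewrite le_eqVlt; apply/orP; left; apply/eqP; field; by rewrite gt_eqF.
Qed.

(** * Cancellation inside a bucket *)

Definition bound p t : R := dyad (fun l => 2 ^+ l <= `|X p t : R|) L.

Definition cross k j t : R := \sum_(p in cell k j)
  \sum_(p' in cell k j | p' != p) bound p t * bound p' t.

(** The second moment of the square root is the mean of 2 [cross], over at most (2 N)^2 pairs of
    distinct, hence independent, entries. Only the means 1 + c1 L enter, so it is at most 8 th^2,
    and a deviation of r th has probability at most 8 / r. *)
Lemma cross_event j (th : R) : th = N * (1 + c1 * L%:R) ->
  pr P (fun t => r%:R * (3 * th) + r%:R * th <=
                 \sum_k Num.sqrt (2 * cross k j t)) <= 8 / r%:R.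
Proof.
move=> thE; have rg := rR_gt0; have c1g := c1_ge1; have Ng := N_gt0.
have y1 : 1 <= 1 + c1 * L%:R by rewrite lerDl mulr_ge0//; lra.
have th0 : 0 < th by rewrite thE mulr_gt0//; lra.
have mabs (J : {set 'I_n * 'I_d}) p l : p \in J ->
    measurable_fun setT ((fun t => 2 ^+ l <= `|X p t : R|) : group_sigma F J -> bool).
  move=> pJ; apply: measurable_ge; apply: measurableT_comp => //.
  exact: (@group_X _ _ _ _ X J p pJ).
have gb (J : {set 'I_n * 'I_d}) p : p \in J -> group_rv F J (bound p).
  move=> pJ; exact: (@bm_dyad _ (group_sigma F J) R
    (fun l t => 2 ^+ l <= `|X p t : R|) (fun l => @mabs J p l pJ) L).
have bb p : bounded_measurable (bound p).
  exact: (group_bm Fm (gb [set p]%SET p (set11 p))).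
have eb p : expect P (bound p) <= 1 + c1 * L%:R.
  by have [] := dyad_absX_moments mX lawX tail_le p L.
have b0 p t : 0 <= bound p t by exact: dyad_ge0.
have ecross k : expect P (fun t => 2 * cross k j t) <= 8 * th ^+ 2.
  rewrite exZ; last by do 2 (apply: bm_sum => ? _); exact: bmM.
  rewrite /cross ex_sum; last by move=> p _; apply: bm_sum => p' _; exact: bmM.
  have : \sum_(p in cell k j) expect P (fun t => \sum_(p' in cell k j | p' != p)
     bound p t * bound p' t) <= \sum_(p in cell k j) \sum_(p' in cell k j)
     (1 + c1 * L%:R) ^+ 2.
    apply: ler_sum => p _; rewrite ex_sum; last by move=> p' _; exact: bmM.
    rewrite [leRHS](bigID (fun p' => p' != p)) /= -[leLHS]addr0 lerD//.
      apply: ler_sum => p' /andP[_ pp'].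
      have dis : [disjoint [set p]%SET & [set p']%SET]%B.
        by rewrite disjoints1 inE eq_sym.
      rewrite (group_exM FT FI Fm indX dis (gb _ p (set11 p)) (gb _ p' (set11 p'))).
      by rewrite expr2 ler_pM// ex_ge0.
    by apply: sumr_ge0 => p' _; rewrite sqr_ge0.
  set y := 1 + _ in y1 thE eb *.
  rewrite !sumr_const card_cell -mulrnA -[y ^+ 2 *+ _]mulr_natr natrM => H.
  set z := #|_|%:R in H.
  have z2 : z * z <= 2 * N * (2 * N) by rewrite ler_pM//; exact: load.
  have y2 : 0 <= y ^+ 2 by rewrite sqr_ge0.
  rewrite thE; have -> : 8 * (N * y) ^+ 2 = 2 * (y ^+ 2 * (2 * N * (2 * N))) by ring.
  by rewrite ler_pM2l//; apply: le_trans H _; rewrite ler_wpM2l.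
have bc k : group_rv F (crow k) (fun t => Num.sqrt (2 * cross k j t)).
  apply: bm_sqrt; apply: bmM; first exact: bm_cst.
  have sub p : p \in cell k j -> p \in crow k.
    exact: (fintype.subsetP (cell_sub_crow k j)).
  apply: bm_sum => p pc; apply: bm_sum => p' /andP[p'c _].
  by apply: bmM; apply: gb; exact: sub.
have bmc k : bounded_measurable (fun t => Num.sqrt (2 * cross k j t)) :=
  group_bm Fm (bc k).
have c0 k t : 0 <= 2 * cross k j t.
  rewrite mulr_ge0//; do 2 (apply: sumr_ge0 => ? _); by rewrite mulr_ge0.
have esq k : expect P (fun t => Num.sqrt (2 * cross k j t) ^+ 2) <= 8 * th ^+ 2.
  by apply: le_trans (ecross k); under eq_ex do rewrite sqr_sqrtr//.
have em k : expect P (fun t => Num.sqrt (2 * cross k j t)) <= 3 * th.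
  (* AM-GM: 2 z <= z^2 / (3 th) + 3 th *)
  have : expect P (fun t => Num.sqrt (2 * cross k j t)) <=
      expect P (fun t => (6 * th)^-1 * Num.sqrt (2 * cross k j t) ^+ 2 + 3 / 2 * th).
    apply: le_ex => //.
      apply: bmD; last exact: bm_cst.
      by apply: bmM; [exact: bm_cst|exact: bmX].
    move=> t; set z := Num.sqrt _.
    have -> : (6 * th)^-1 * z ^+ 2 + 3 / 2 * th =
        (6 * th)^-1 * (z - 3 * th) ^+ 2 + z by field; rewrite gt_eqF.
    by rewrite lerDr mulr_ge0 ?sqr_ge0// invr_ge0 mulr_ge0// ltW.
  move=> /le_trans; apply; rewrite exD; [|by apply: bmM; [exact: bm_cst|exact: bmX]
    |exact: bm_cst].
  rewrite exZ; last exact: bmX.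
  rewrite ex_cst.
  have i0 : 0 <= (6 * th)^-1 by rewrite invr_ge0 mulr_ge0// ltW.
  have := ler_wpM2l i0 (esq k).
  have -> : (6 * th)^-1 * (8 * th ^+ 2) = 4 / 3 * th by field; rewrite gt_eqF.
  lra.
have rth : 0 < r%:R * th by rewrite mulr_gt0.
have := chebyshev_sum_upper FT FI Fm indX (@disjoint_crow) bc rth em esq.
rewrite card_ord => /le_trans; apply.
rewrite le_eqVlt; apply/orP; left; apply/eqP; field; by rewrite !gt_eqF.
Qed.

(** * Exceptional events *)

Definition double k jj t : bool := large u k jj.1 t && large u k jj.2 t.

(** Excluding two entries above 2^u in one row keeps every beaten entry below the noise cap; the
    independence of distinct columns squares the tail. *)
Lemma double_event :
  pr P (fun t => [exists x : 'I_r * ('I_d * 'I_d),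
    (x.2.1 != x.2.2) && double x.1 x.2 t]) <= r%:R * d%:R ^+ 2 * (q / 2 ^+ u) ^+ 2.
Proof.
have qg := q_ge1.
apply: le_trans (pr_exists P (fun x : 'I_r * ('I_d * 'I_d) => x.2.1 != x.2.2) _) _.
  by move=> x; apply: measurable_and; exact: measurable_large.
apply: (@le_trans _ _ (\sum_(x : 'I_r * ('I_d * 'I_d) | x.2.1 != x.2.2)
    (q / 2 ^+ u) ^+ 2)).
  apply: ler_sum => -[k [j j']] /= jj'.
  rewrite /double (group_prM FT FI Fm indX (disjoint_cell k j)
    (group_large u (subxx _)) (group_large u (cell_sub_cother k _))) /=; last first.
    by rewrite eq_sym.
  by rewrite expr2 ler_pM ?pr_ge0 ?pr_large_le.
rewrite sumr_const -[leLHS]mulr_natl ler_wpM2r ?sqr_ge0// -natrX -natrM ler_nat.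
apply: leq_trans (max_card _) _.
by rewrite !card_prod !card_ord mulnn.
Qed.

(** Off this event every entry is below 2^L, where [bound] dominates it. *)
Lemma huge_event :
  pr P (fun t => [exists p : 'I_n * 'I_d, true && (2 ^+ L <= `|X p t : R|)]) <=
  n%:R * d%:R * c1 / 2 ^+ L.
Proof.
apply: le_trans (pr_exists P xpredT (F := fun p t => 2 ^+ L <= `|X p t : R|) _) _.
  move=> p; apply: measurable_ge; apply: measurableT_comp => //; exact: mX.
under eq_bigr do rewrite (pr_abs mX lawX).
apply: (@le_trans _ _ (\sum_(p : 'I_n * 'I_d) c1 / 2 ^+ L)).
  by apply: ler_sum => p _; rewrite tail_le// exprn_gt0.
by rewrite sumr_const card_prod !card_ord -[leLHS]mulr_natl natrM mulrA.
Qed.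

(* Off these events the signal dominates: the sum of the entries of column j
   above 2 ^+ m is at least w c2 r / 16, its noise at most a quarter of that. *)
Definition bad_column j t : bool :=
  [|| \sum_k signal k j t <= w * c2 * r%:R / 8,
      r%:R * (w * c2 / 128) + r%:R * w * c2 / 128 <= \sum_k noise k j t,
      r%:R * (1 + q * m%:R) + r%:R <= \sum_k dyad (fun l => large l k j t) m |
      r%:R * (3 * (N * (1 + c1 * L%:R))) + r%:R * (N * (1 + c1 * L%:R)) <=
        \sum_k Num.sqrt (2 * cross k j t)].

Definition bad t : bool :=
  [|| [exists j, true && bad_column j t],
      [exists x : 'I_r * ('I_d * 'I_d), (x.2.1 != x.2.2) && double x.1 x.2 t] |
      [exists p : 'I_n * 'I_d, true && (2 ^+ L <= `|X p t : R|)]].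

(** A beaten entry stays below 2^u, since otherwise the entry beating it would reach 2^u too. At
    each level l it reaches, the latter is a rival at level max(l, m), so [noise_level] records that
    level. *)
Lemma noise_dominates k j t :
  ~~ [exists x : 'I_r * ('I_d * 'I_d), (x.2.1 != x.2.2) && double x.1 x.2 t] ->
  `|entry k j t| * (beaten (2 ^+ m) (fun j => entry k j t) j)%:R <= noise k j t.
Proof.
move=> /existsPn nodouble.
have n0 : 0 <= noise k j t by rewrite mulr_ge0// dyad_ge0.
case: (boolP (beaten _ _ _)) => [/existsP[j' /and3P[jj' mj' jlej']]|_]; last first.
  by rewrite mulr0.
have rv l : large l k j t -> rival (maxn l m) k j t.
  move=> hl; apply/existsP; exists j'; rewrite jj' /large /=.
  by case: (leqP l m) => _ //; exact: le_trans hl jlej'.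
have -> : noise k j t = dyad (noise_level k j t) u.
  have -> : noise k j t = (rival m k j t)%:R * dyad (noise_level k j t) u by [].
  suff -> : rival m k j t by rewrite mul1r.
  by apply/existsP; exists j'; rewrite jj'.
rewrite mulr1; apply: le_trans (le_dyad (L := u) _) _.
  rewrite ltNge; apply/negP => hu.
  have /= := nodouble (k, (j, j')); rewrite eq_sym jj' /= /double /large /= hu /=.
  by rewrite (le_trans hu jlej').
by apply: dyad_monotone => l hl; rewrite /noise_level (rv l hl) andbT.
Qed.

(** The left side is at most N (S + r M1), where M1 collects the small entries and the cancellation.
    As S >= w c2 r / 16, the term r M1 is at most 16 M1 / (w c2) times S. As S - 2 No >= S / 2, the
    condition on [kappa] is twice the resulting factor. *)
Lemma good_column (kappa : R) j t : ~~ bad t ->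
  2 + 32 * (2 + q * m%:R + 4 * (1 + c1 * L%:R)) / (w * c2) <= kappa ->
  \sum_k \sum_(p in cell k j) `|X p t : R| <= kappa * (N *
   (\sum_k `|entry k j t| * (2 ^+ m <= `|entry k j t|)%R%:R -
    2 * \sum_k `|entry k j t| * (beaten (2 ^+ m) (fun j => entry k j t) j)%:R)).
Proof.
rewrite /bad !negb_or => /and3P[/existsPn /(_ j) /= hcol nod /existsPn nohuge].
move: hcol; rewrite /bad_column !negb_or -!ltNge => /and4P[hsig hnoise hsmall hcross].
move=> hk.
have wg := w_ge1; have cg := c2_gt0; have rg := rR_gt0; have Ng := N_gt0.
set S := \sum_k `|entry k j t| * (2 ^+ m <= _)%R%:R.
set No := \sum_k `|entry k j t| * (beaten _ _ _)%:R.
have hNo : No <= \sum_k noise k j t.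
  by apply: ler_sum => k _; exact: noise_dominates.
have hS : \sum_k signal k j t <= 2 * S.
  by rewrite mulr_sumr; apply: ler_sum => k _; exact: signal_le_entry.
have hE : \sum_k `|entry k j t| <= S + \sum_k dyad (fun l => large l k j t) m.
  rewrite -big_split /=; apply: ler_sum => k _.
  case: (leP (2 ^+ m) `|entry k j t|) => hm.
    by rewrite mulr1 lerDl dyad_ge0.
  by rewrite mulr0 add0r; exact: le_dyad hm.
have hU : \sum_k \sum_(p in cell k j) `|X p t : R| <=
    N * \sum_k `|entry k j t| + \sum_k Num.sqrt (2 * cross k j t).
  rewrite mulr_sumr -big_split /=; apply: ler_sum => k _.
  have -> : N * `|entry k j t| = `|\sum_(p in cell k j) (X p t : R)|.
    rewrite /entry normrM normfV (gtr0_norm Ng); field; by rewrite gt_eqF.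
  apply: l1_le_cancellation => p _; apply: le_dyad.
  by have := nohuge p; rewrite -ltNge.
set M1 := 2 + q * m%:R + 4 * (1 + c1 * L%:R) in hk *.
have M10 : 0 <= M1.
  have c1g := c1_ge1; have qg := q_ge1.
  have h1 : 0 <= q * m%:R by rewrite mulr_ge0//; lra.
  have h2 : 0 <= c1 * L%:R by rewrite mulr_ge0//; lra.
  by rewrite /M1; lra.
have sig0 : w * c2 * r%:R / 16 <= S by lra.
(* The two terms w c2 / 128 of [bad_column] bound the noise by w c2 r / 64, a quarter of the lower
   bound [sig0] on S. *)
have hNo4 : 4 * No <= S.
  have -> : S = 4 * (S / 4) by field.
  have : r%:R * (w * c2 / 128) + r%:R * w * c2 / 128 = w * c2 * r%:R / 64 by field.
  lra.
have wc : 0 < w * c2 by rewrite mulr_gt0//; lra.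
have hM : r%:R * M1 <= 16 * M1 / (w * c2) * S.
  have i0 : 0 <= 16 * M1 / (w * c2) by rewrite mulr_ge0 ?mulr_ge0// invr_ge0 ltW.
  have := ler_wpM2l i0 sig0.
  have -> // : 16 * M1 / (w * c2) * (w * c2 * r%:R / 16) = r%:R * M1.
  by field; rewrite !gt_eqF//; lra.
have S0 : 0 <= S.
  by apply: sumr_ge0 => k _; rewrite mulr_ge0.
have hkS : 2 * S + 32 * M1 / (w * c2) * S <= kappa * S.
  by have := ler_wpM2r S0 hk; rewrite mulrDl.
have kap0 : 0 <= kappa.
  apply: le_trans hk; rewrite addr_ge0// mulr_ge0 ?mulr_ge0//.
  by rewrite invr_ge0 ltW.
have E1 : 32 * M1 / (w * c2) * S = 2 * (16 * M1 / (w * c2) * S) by ring.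
apply: (le_trans hU); apply: (@le_trans _ _ (N * (S + r%:R * M1))).
  have : N * \sum_k `|entry k j t| <= N * (S + r%:R * (1 + q * m%:R) + r%:R).
    by rewrite ler_pM2l//; lra.
  rewrite /M1; lra.
have -> : kappa * (N * (S - 2 * No)) = N * (kappa * (S - 2 * No)) by ring.
rewrite ler_pM2l//.
have : kappa * (S / 2) <= kappa * (S - 2 * No) by rewrite ler_wpM2l//; lra.
lra.
Qed.

(** The lower bound from [row_lower_bound] and the triangle inequality for |A x|_1 are both sums
    over j weighted by |x_j|, so comparing columns settles all x simultaneously. *)
Lemma good_embedding (kappa : R) t : ~~ bad t -> 0 < kappa ->
  2 + 32 * (2 + q * m%:R + 4 * (1 + c1 * L%:R)) / (w * c2) <= kappa ->
  forall x : 'I_d -> R,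
  kappa^-1 * \sum_i `|\sum_j X (i, j) t * x j| <=
  \sum_k `|\sum_j (\sum_(i in bucket k) (X (i, j) t : R)) * x j|.
Proof.
move=> good kap0 hk x; have Ng := N_gt0.
have cellE k j (f : 'I_n * 'I_d -> R) :
    \sum_(p in cell k j) f p = \sum_(i in bucket k) f (i, j).
  have -> : cell k j = [set (i, j) | i in bucket k]%SET.
    apply/setP => -[i j']; rewrite inE /=; apply/andP/imsetP => [[ik]|[i' ik [-> ->]]].
      by rewrite inE => /eqP ->; exists i.
    by split => //; rewrite inE.
  by rewrite big_imset//= => i i' _ _ [].
pose S j := \sum_k `|entry k j t| * (2 ^+ m <= `|entry k j t|)%R%:R.
pose No j := \sum_k `|entry k j t| * (beaten (2 ^+ m) (fun j => entry k j t) j)%:R.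
have low : N * \sum_j `|x j| * (S j - 2 * No j) <=
    \sum_k `|\sum_j (\sum_(i in bucket k) (X (i, j) t : R)) * x j|.
  apply: (@le_trans _ _ (N * \sum_k `|\sum_j entry k j t * x j|)).
    rewrite ler_pM2l//.
    have -> : \sum_j `|x j| * (S j - 2 * No j) = \sum_k \sum_j `|x j| *
        (`|entry k j t| * (2 ^+ m <= `|entry k j t|)%R%:R -
         2 * (`|entry k j t| * (beaten (2 ^+ m) (fun j => entry k j t) j)%:R)).
      rewrite exchange_big /=; apply: eq_bigr => j _.
      by rewrite /S /No mulr_sumr -sumrB mulr_sumr.
    by apply: ler_sum => k _; exact: row_lower_bound.
  rewrite mulr_sumr; apply: ler_sum => k _.
  rewrite -[X in X * _](gtr0_norm Ng) -normrM mulr_sumr.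
  rewrite le_eqVlt; apply/orP; left; apply/eqP; congr (`|_|).
  apply: eq_bigr => j _; rewrite /entry cellE; field; by rewrite gt_eqF.
apply: le_trans low; rewrite mulrC ler_pdivrMr//.
apply: (@le_trans _ _ (\sum_j `|x j| * \sum_k \sum_(p in cell k j) `|X p t : R|)).
  apply: (@le_trans _ _ (\sum_i \sum_j `|x j| * `|X (i, j) t : R|)).
    apply: ler_sum => i _; apply: le_trans (ler_norm_sum _ _ _) _.
    by apply: ler_sum => j _; rewrite normrM mulrC.
  rewrite exchange_big /=; apply: ler_sum => j _; rewrite -mulr_sumr.
  rewrite ler_wpM2l// (partition_big h xpredT)//=; apply: ler_sum => k _.
  by rewrite cellE; under [leRHS]eq_bigl do rewrite inE.
rewrite [leRHS](_ : _ = \sum_j `|x j| * (kappa * (N * (S j - 2 * No j)))); last first.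
  rewrite mulrC mulr_sumr mulr_sumr; apply: eq_bigr => j _; ring.
by apply: ler_sum => j _; rewrite ler_wpM2l//; exact: good_column.
Qed.

(** * Measurability and probability of the bad event *)

Let measurable_absX p l : measurable_fun setT (fun t => 2 ^+ l <= `|X p t : R|).
Proof. by apply: measurable_ge; apply: measurableT_comp => //; exact: mX. Qed.

Let measurable_signal_event j :
  measurable_fun setT (fun t => \sum_k signal k j t <= w * c2 * r%:R / 8).
Proof.
apply: measurable_le; apply: bm_measurable; do 2 (apply: bm_sum => ? _).
by apply: bmM; [exact: bm_cst|apply: bm_bool; exact: measurable_large].
Qed.

Let measurable_noise_event j : measurable_fun setT (fun t =>
  r%:R * (w * c2 / 128) + r%:R * w * c2 / 128 <= \sum_k noise k j t).
Proof.
apply: measurable_ge; apply: bm_measurable; apply: bm_sum => k _.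
apply: bmM; first by apply: bm_bool; exact: measurable_rival.
exact: (bm_dyad (fun l => @measurable_noise_level k j l)).
Qed.

Let measurable_small_event j : measurable_fun setT (fun t =>
  r%:R * (1 + q * m%:R) + r%:R <= \sum_k dyad (fun l => large l k j t) m).
Proof.
apply: measurable_ge; apply: bm_measurable; apply: bm_sum => k _.
exact: (bm_dyad (fun l => @measurable_large l k j)).
Qed.

Let measurable_cross_event j : measurable_fun setT (fun t =>
  r%:R * (3 * (N * (1 + c1 * L%:R))) + r%:R * (N * (1 + c1 * L%:R)) <=
  \sum_k Num.sqrt (2 * cross k j t)).
Proof.
apply: measurable_ge; apply: bm_measurable; apply: bm_sum => k _.
apply: bm_sqrt; apply: bmM; first exact: bm_cst.
do 2 (apply: bm_sum => ? _).
by apply: bmM; exact: (bm_dyad (fun l => @measurable_absX _ l)).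
Qed.

Let measurable_bad_column j : measurable_fun setT (bad_column j).
Proof. by do 3?apply: measurable_or. Qed.

Let measurable_double_event : measurable_fun setT
  (fun t => [exists x : 'I_r * ('I_d * 'I_d),
     (x.2.1 != x.2.2) && double x.1 x.2 t]).
Proof.
apply: measurable_existsb => z.
by apply: measurable_and; exact: measurable_large.
Qed.

Let measurable_huge_event : measurable_fun setT
  (fun t => [exists p : 'I_n * 'I_d, true && (2 ^+ L <= `|X p t : R|)]).
Proof. exact: measurable_existsb (fun p => @measurable_absX p L). Qed.

Lemma measurable_bad : measurable_fun setT bad.
Proof.
do 2?apply: measurable_or => //.
exact: measurable_existsb (fun j => @measurable_bad_column j).
Qed.

Lemma pr_bad : d%:R * q * (1 + 2 * q + m%:R * q) / 2 ^+ m <= c2 / 128 ->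
  pr P bad <=
  d%:R * (256 * q * 2 ^+ s / (w ^+ 2 * c2 ^+ 2 * r%:R) +
          128 ^+ 2 * d%:R * q * (1 + 3 * q * u%:R) / (w ^+ 2 * c2 ^+ 2 * r%:R) +
          (1 + 3 * q * 2 ^+ m) / r%:R + 8 / r%:R) +
  r%:R * d%:R ^+ 2 * (q / 2 ^+ u) ^+ 2 + n%:R * d%:R * c1 / 2 ^+ L.
Proof.
move=> ha; have wg := w_ge1; have cg := c2_gt0; have rg := rR_gt0.
have mdouble := measurable_double_event; have mhuge := measurable_huge_event.
have mcols := @measurable_existsb _ T _ xpredT bad_column
  (fun j => @measurable_bad_column j).
apply: le_trans (pr_or P mcols (measurable_or mdouble mhuge)) _.
rewrite -[leRHS]addrA; apply: lerD; last first.
  apply: le_trans (pr_or P mdouble mhuge) _.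
  by apply: lerD; [exact: double_event|exact: huge_event].
apply: le_trans (pr_exists P xpredT (fun j => @measurable_bad_column j)) _.
rewrite -[X in X%:R * _]card_ord mulr_natl -sumr_const; apply: ler_sum => j _.
have lam0 : 0 < r%:R * w * c2 / 128 by rewrite divr_gt0// !mulr_gt0//; lra.
have ha' : d%:R * q * (1 + 2 * q + m%:R * q) / 2 ^+ m <= w * c2 / 128.
  by apply: le_trans ha _; rewrite ler_pM2r// ler_peMl// ltW.
have e1 := signal_event j.
have e2 := noise_event j lam0 ha'.
have e3 := small_event j.
have e4 := cross_event j (erefl (N * (1 + c1 * L%:R))).
have E2 : r%:R * (d%:R * q * (1 + 3 * q * u%:R)) / (r%:R * w * c2 / 128) ^+ 2 =
    128 ^+ 2 * d%:R * q * (1 + 3 * q * u%:R) / (w ^+ 2 * c2 ^+ 2 * r%:R).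
  by field; rewrite !gt_eqF//; lra.
rewrite E2 in e2.
have m1 := @measurable_signal_event j.
have m2 := @measurable_noise_event j.
have m3 := @measurable_small_event j.
have m4 := @measurable_cross_event j.
have h4 := le_trans (pr_or P m3 m4) (lerD e3 e4).
have h3 := le_trans (pr_or P m2 (measurable_or m3 m4)) (lerD e2 h4).
have h2 := le_trans (pr_or P m1 (measurable_or m2 (measurable_or m3 m4))) (lerD e1 h3).
by apply: le_trans h2 _; rewrite !addrA.
Qed.

End SketchedMatrix.

(** * Bucket sizes of a random hash function *)

Section HashLoad.
Context {R : realType}.
Variables n r : nat.
Hypothesis r_gt0 : (0 < r)%N.
Hypothesis n_gt0 : (0 < n)%N.
Let rR : (0 : R) < r%:R. Proof. by rewrite ltr0n. Qed.

(** Written as a product over all indices, a function of one hash value can be summed over all hash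
    functions by distributivity. *)
Let pick_prod (y : 'I_r -> R) (i : 'I_n) (h : {ffun 'I_n -> 'I_r}) :
  \prod_l (if l == i then y (h l) else 1) = y (h i).
Proof. by rewrite -big_mkcond big_pred1_eq. Qed.

Lemma sum_hash_indep (y z : 'I_r -> R) (i i' : 'I_n) : i != i' ->
  \sum_x y x = 0 -> \sum_(h : {ffun 'I_n -> 'I_r}) y (h i) * z (h i') = 0.
Proof.
move=> ii' y0.
under eq_bigr do rewrite -(pick_prod y i) -(pick_prod z i') -big_split /=.
rewrite -(bigA_distr_bigA (fun l x => (if l == i then y x else 1) *
   (if l == i' then z x else 1))) (bigD1 i)//= eqxx (negbTE ii').
by under eq_bigr do rewrite mulr1; rewrite y0 mul0r.
Qed.

Lemma sum_hash_single (y : 'I_r -> R) (i : 'I_n) :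
  \sum_(h : {ffun 'I_n -> 'I_r}) y (h i) = r%:R ^+ n.-1 * \sum_x y x.
Proof.
under eq_bigr do rewrite -(pick_prod y i).
rewrite -(bigA_distr_bigA (fun l x => if l == i then y x else 1)).
rewrite (bigD1 i)//= eqxx mulrC; congr (_ * _).
rewrite (eq_bigr (fun=> r%:R)) => [|l /negbTE ->]; last first.
  by rewrite sumr_const card_ord.
by rewrite prodr_const cardC1 card_ord.
Qed.

Let N : R := n%:R / r%:R.

(** Chebyshev by counting: the centred indicators [y (h i)] are orthogonal under the sum over [h],
    so the squared deviations total at most r^n N, while each overload contributes at least N^2. *)
Lemma overload_bucket (k : 'I_r) :
  #|[set h : {ffun 'I_n -> 'I_r} | 2 * N < #|bucket h k|%:R]%SET|%:R * N <=
  r%:R ^+ n.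
Proof.
have rg := rR; have N0 : 0 < N by rewrite divr_gt0// ltr0n.
pose y x : R := (x == k)%:R - r%:R^-1.
have y0 : \sum_x y x = 0.
  rewrite sumrB sumr_const card_ord -[X in _ - X]mulr_natl divff ?gt_eqF//.
  by rewrite (bigD1 k)//= eqxx big1 ?addr0 ?subrr// => x /negbTE ->.
have y2 : \sum_x y x * y x <= 1.
  under eq_bigr do rewrite [X in X * _]/y mulrBl.
  rewrite sumrB -mulr_sumr y0 mulr0 subr0 (bigD1 k)//= eqxx mul1r big1.
    by rewrite addr0 /y eqxx lerBlDr lerDl invr_ge0 ltW.
  by move=> x /negbTE ->; rewrite mul0r.
have dev (h : {ffun 'I_n -> 'I_r}) : #|bucket h k|%:R - N = \sum_i y (h i).
  rewrite sumrB sumr_const card_ord -[X in _ = _ - X]mulr_natl; congr (_ - _).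
  rewrite -sum1_card natr_sum big_mkcond /=; apply: eq_bigr => i _.
  by rewrite inE; case: (h i == k).
have var : \sum_(h : {ffun 'I_n -> 'I_r}) (#|bucket h k|%:R - N) ^+ 2 <=
    r%:R ^+ n * N.
  have -> : \sum_(h : {ffun 'I_n -> 'I_r}) (#|bucket h k|%:R - N) ^+ 2 =
     \sum_i \sum_i' \sum_(h : {ffun 'I_n -> 'I_r}) y (h i) * y (h i').
    under eq_bigr do rewrite dev expr2 mulr_suml.
    rewrite exchange_big /=; apply: eq_bigr => i _.
    rewrite exchange_big /=; apply: eq_bigr => h _.
    by rewrite mulr_sumr.
  apply: (@le_trans _ _ (\sum_(i < n) r%:R ^+ n.-1)).
    apply: ler_sum => i _; rewrite (bigD1 i)//= [X in _ + X]big1 ?addr0.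
      rewrite [leLHS](sum_hash_single (fun x => y x * y x) i).
      by rewrite ler_piMr// exprn_ge0// ltW.
    by move=> i' ii'; rewrite sum_hash_indep// eq_sym.
  rewrite sumr_const card_ord -[leLHS]mulr_natr /N.
  have -> : r%:R ^+ n = r%:R * r%:R ^+ n.-1 :> R by rewrite -exprS prednK.
  rewrite le_eqVlt; apply/orP; left; apply/eqP; field; by rewrite gt_eqF.
set B := finset _.
have : #|B|%:R * N ^+ 2 <= r%:R ^+ n * N.
  apply: le_trans var; rewrite mulr_natl -sumr_const.
  rewrite [leRHS](bigID (mem B)) /= -[leLHS]addr0 lerD//.
    apply: ler_sum => h; rewrite inE => hB.
    by rewrite ler_sqr ?nnegrE; lra.
  by apply: sumr_ge0 => h _; rewrite sqr_ge0.
by rewrite expr2 mulrA ler_pM2r.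
Qed.

(** The union over r buckets loses a factor r and N is n / r: the overloaded fraction is at most r^2
    / n. *)
Lemma overload_le :
  #|[set h : {ffun 'I_n -> 'I_r} |
     [exists k, 2 * N < #|bucket h k|%:R]]%SET|%:R * n%:R <=
  r%:R ^+ n * r%:R ^+ 2 :> R.
Proof.
have rg := rR; have N0 : 0 < N by rewrite divr_gt0// ltr0n.
have h1 : #|[set h : {ffun 'I_n -> 'I_r} |
     [exists k, 2 * N < #|bucket h k|%:R]]%SET|%:R <=
   \sum_k #|[set h : {ffun 'I_n -> 'I_r} | 2 * N < #|bucket h k|%:R]%SET|%:R :> R.
  rewrite -natr_sum ler_nat.
  rewrite (_ : [set h : {ffun 'I_n -> 'I_r} | _]%SET =
    \bigcup_k [set h : {ffun 'I_n -> 'I_r} | 2 * N < #|bucket h k|%:R]%SET)%SET.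
    elim/big_ind2: _ => [|a A b B hA hB|//]; first by rewrite cards0.
    by apply: leq_trans (leq_of_leqif (leq_card_setU A B)) _; exact: leq_add.
  apply/setP => h; rewrite inE; apply/existsP/bigcupP => [[k hk]|[k _]].
    by exists k => //; rewrite inE.
  by rewrite inE; exists k.
have h2 := ler_wpM2r (ltW N0) h1.
have h3 : #|[set h : {ffun 'I_n -> 'I_r} |
     [exists k, 2 * N < #|bucket h k|%:R]]%SET|%:R * N <= r%:R * r%:R ^+ n :> R.
  apply: le_trans h2 _; rewrite mulr_suml.
  apply: (@le_trans _ _ (\sum_(k < r) r%:R ^+ n)).
    by apply: ler_sum => k _; exact: overload_bucket.
  by rewrite sumr_const card_ord mulr_natl.
have := ler_wpM2r (ltW rg) h3; rewrite /N -mulrA divfK ?gt_eqF//.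
by move=> /le_trans; apply; rewrite le_eqVlt; apply/orP; left; apply/eqP; ring.
Qed.

End HashLoad.

(** * Conditioning on the sketch *)

Section SketchNorms.
Context {R : realType}.
Variables n d r : nat.
Implicit Types (M : 'M[R]_(n, d)) (x y : 'cV[R]_d).

Lemma l1norm_mulE M x : l1norm (M *m x) = \sum_i `|\sum_j M i j * x j ord0|.
Proof. by apply: eq_bigr => i _; rewrite mxE. Qed.

Lemma l1norm_sketchE (h : {ffun 'I_n -> 'I_r}) (s : 'I_n -> bool) M x :
  l1norm (countsketch_mx R h s *m M *m x) =
  \sum_k `|\sum_(i in bucket h k) (-1) ^+ s i * (M *m x) i ord0|.
Proof.
apply: eq_bigr => k _; rewrite -mulmxA mxE; congr (`|_|).
rewrite [RHS]big_mkcond /=; apply: eq_bigr => i _.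
by rewrite mxE inE; case: eqP => _; rewrite ?mul0r.
Qed.

(** The buckets partition the rows and signs have absolute value 1, so the triangle inequality
    suffices: this half of the distortion holds surely. *)
Lemma sketch_le_l1norm (h : {ffun 'I_n -> 'I_r}) (s : 'I_n -> bool) M x :
  l1norm (countsketch_mx R h s *m M *m x) <= l1norm (M *m x).
Proof.
rewrite l1norm_sketchE /l1norm [leRHS](partition_big h xpredT)//=.
apply: ler_sum => k _; apply: le_trans (ler_norm_sum _ _ _) _.
rewrite le_eqVlt; apply/orP; left; apply/eqP.
apply: eq_big => [i|i _]; first by rewrite inE.
by rewrite normrM normrX normrN1 expr1n mul1r.
Qed.

Lemma l1norm_lipschitz m (M : 'M[R]_(m, d)) x y (e : R) :
  (forall j, `|x j ord0 - y j ord0| <= e) ->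
  l1norm (M *m x) <= l1norm (M *m y) + (\sum_i \sum_j `|M i j|) * e.
Proof.
move=> xy; rewrite mulr_suml -big_split /=; apply: ler_sum => i _.
have -> : (M *m x) i ord0 = (M *m y) i ord0 + \sum_j M i j * (x j ord0 - y j ord0).
  rewrite !mxE -big_split /=; apply: eq_bigr => j _; ring.
apply: le_trans (ler_normD _ _) _; rewrite lerD2l.
apply: le_trans (ler_norm_sum _ _ _) _; rewrite mulr_suml; apply: ler_sum => j _.
by rewrite normrM ler_wpM2l.
Qed.

(* Both sides are Lipschitz in x, so rational vectors are enough. *)
Lemma l1norm_le_rational m1 m2 (M1 : 'M[R]_(m1, d)) (M2 : 'M[R]_(m2, d)) (a : R) :
  0 <= a ->
  (forall v : 'cV[rat]_d,
     a * l1norm (M1 *m map_mx ratr v) <= l1norm (M2 *m map_mx ratr v)) ->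
  forall x : 'cV[R]_d, a * l1norm (M1 *m x) <= l1norm (M2 *m x).
Proof.
move=> a0 hv x.
pose c1 := \sum_i \sum_j `|M1 i j|; pose c2 := \sum_i \sum_j `|M2 i j|.
have c10 : 0 <= c1 by do 2 (apply: sumr_ge0 => ? _).
have c20 : 0 <= c2 by do 2 (apply: sumr_ge0 => ? _).
have C0 : 0 < a * c1 + c2 + 1 by have := mulr_ge0 a0 c10; lra.
apply/ler_addgt0Pr => e e0.
pose del := e / (a * c1 + c2 + 1).
have del0 : 0 < del by rewrite divr_gt0.
have apx j : {v : rat | `|x j ord0 - ratr v| <= del}.
  have xlt : x j ord0 < x j ord0 + del by rewrite ltrDl.
  have /cid[v] := rat_in_itvoo xlt; rewrite in_itv /= => /andP[h1 h2].
  by exists v; rewrite distrC ger0_norm; lra.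
pose v : 'cV[rat]_d := \col_j sval (apx j).
have xv j : `|x j ord0 - (map_mx ratr v : 'cV[R]_d) j ord0| <= del.
  by rewrite !mxE; exact: (svalP (apx j)).
have vx j : `|(map_mx ratr v : 'cV[R]_d) j ord0 - x j ord0| <= del.
  by rewrite distrC.
have h1 := ler_wpM2l a0 (l1norm_lipschitz M1 xv).
have h2 := l1norm_lipschitz M2 vx.
have h3 := hv v.
rewrite -/c1 -/c2 in h1 h2.
have : (a * c1 + c2 + 1) * del = e by rewrite /del; field; rewrite gt_eqF.
by nra.
Qed.

End SketchNorms.

(** * Law of the entries given the hash function and the signs *)

Section Model.
Context {disp : measure_display} {T : measurableType disp} {R : realType}.
Variables (P : probability T R) (D : probability (measurableTypeR R) R).
Variables (n d r : nat) (A : 'I_n -> 'I_d -> {RV P >-> measurableTypeR R}).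
Variables (H : T -> {ffun 'I_n -> 'I_r}) (L : 'I_n -> T -> bool).
Hypothesis model : sketch_model D A H L.
Hypothesis r_gt0 : (0 < r)%N.

Let lawA : forall i j (B : set (measurableTypeR R)), measurable B ->
  P (A i j @^-1` B) = D B.
Proof. by case: model. Qed.

Let mA i j : measurable_fun setT (A i j : T -> R).
Proof. exact: (@measurable_funPT _ _ _ _ (A i j)). Qed.

Lemma measurable_hash_eq h : measurable_fun setT (fun t => H t == h).
Proof.
case: model => _ /(_ h)[mH _] _ _; apply: (measurable_fun_bool true); rewrite setTI.
by rewrite (_ : _ @^-1` _ = H @^-1` [set h])//; apply/seteqP; split => t /= /eqP.
Qed.

Lemma measurable_sign i : measurable_fun setT (L i).
Proof.
case: model => _ _ /(_ i true)[mL _] _; apply: (measurable_fun_bool true).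
by rewrite setTI.
Qed.

Definition sketch_event h (s : {ffun 'I_n -> bool}) t : bool :=
  (H t == h) && [forall i, L i t == s i].

Lemma measurable_sketch_event h s : measurable_fun setT (sketch_event h s).
Proof.
apply: measurable_and; first exact: measurable_hash_eq.
have -> : (fun t => [forall i, L i t == s i]) =
    fun t => ~~ [exists i, true && (L i t (+) s i)].
  apply/funext => t; rewrite negb_exists; apply: eq_forallb => i /=.
  by case: (L i t); case: (s i).
apply: measurable_neg; apply: measurable_existsb => i.
case: (s i) => /=; last first.
  by rewrite (_ : (fun t => _) = L i);
    [exact: measurable_sign|apply/funext => t; rewrite addbF].
rewrite (_ : (fun t => _) = (fun t => ~~ L i t)); last first.
  by apply/funext => t; rewrite addbT.
by apply: measurable_neg; exact: measurable_sign.
Qed.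

Let csize : R := (r ^ n * 2 ^ n)%:R.

Lemma csize_gt0 : 0 < csize.
Proof. by rewrite ltr0n muln_gt0 !expn_gt0 r_gt0. Qed.

(** Joint independence is applied to [J] together with the hash index and all sign indices; the
    latter contribute r^-n and 2^-n. Events on the entries thus keep their product form under
    conditioning. *)
Lemma prob_sketch_event h s (J : {set 'I_n * 'I_d}) (E : 'I_n * 'I_d -> set T) :
  (forall p, p \in J -> sigma_of (A p.1 p.2) (E p)) ->
  P ((\bigcap_(p in [set` J]) E p) `&` [set t | sketch_event h s t]) =
  ((\prod_(p in J) P (E p)) * csize^-1%:E)%E.
Proof.
move=> hE; case: model => _ hH hL ind.
pose J' : {set (('I_n * 'I_d) + (unit + 'I_n))%type} :=
  [set k | if k is inl p then p \in J else true]%SET.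
pose E' (k : (('I_n * 'I_d) + (unit + 'I_n))%type) : set T :=
  match k with
  | inl p => E p
  | inr (inl _) => H @^-1` [set h]
  | inr (inr i) => L i @^-1` [set s i]
  end.
have -> : (\bigcap_(p in [set` J]) E p) `&` [set t | sketch_event h s t] =
    \bigcap_(k in [set` J']) E' k.
  apply/seteqP; split => t /=.
    move=> [hJ /andP[/eqP hHt /forallP hLt]] [p|[[]|i]] /=; rewrite ?inE //.
      by move=> pJ; exact: hJ.
    by move=> _; exact/eqP/hLt.
  move=> hall; split=> [p /= pJ|].
    by have := hall (inl p); rewrite /= inE; exact.
  apply/andP; split.
    by apply/eqP; have := hall (inr (inl tt)); rewrite /= inE; exact.
  by apply/forallP => i; apply/eqP; have := hall (inr (inr i)); rewrite /= inE; exact.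
rewrite ind; last first.
  move=> [p|[[]|i]] /=; rewrite ?inE => kJ.
  - exact: hE.
  - by exists [set h] => //; rewrite setTI.
  - by exists [set s i] => //; rewrite setTI.
rewrite big_sumType /= big_sumType /=; congr (_ * _)%E.
  by apply: eq_bigl => p; rewrite inE.
rewrite (big_pred1 tt); last by case; rewrite inE.
rewrite (proj2 (hH h)) (eq_bigr (fun=> (2^-1 : R)%:E)); last first.
  by move=> i _; rewrite (proj2 (hL i (s i))).
rewrite (eq_bigl xpredT); last by move=> i; rewrite inE.
rewrite prodEFin -EFinM prodr_const card_ord /csize natrM invfM natrX.
by rewrite [in RHS]natrX exprVn.
Qed.

Section Conditioned.
Variables (h : {ffun 'I_n -> 'I_r}) (s : {ffun 'I_n -> bool}).

Let C : set T := [set t | sketch_event h s t].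

Let mC : measurable C.
Proof.
have me := @measurable_sketch_event h s.
by have := me measurableT [set true] I; rewrite setTI.
Qed.

Let PC : P C = csize^-1%:E.
Proof.
have := @prob_sketch_event h s finset.set0 (fun=> setT).
rewrite big_set0 mul1e => <-//; last by move=> p; rewrite inE.
by congr (P _); apply/seteqP; split => t //= [].
Qed.

(** The last argument of [mnormalize] is a fallback for a null event; it is never reached, as [C]
    has probability 1 / csize. *)
Definition cond_prob : probability T R := mnormalize (mrestr P mC) P.

Lemma cond_probE U : cond_prob U = (P (U `&` C) * csize%:E)%E.
Proof.
have cs := csize_gt0.
rewrite /cond_prob /= /mnormalize /= /mrestr setTI -/C PC /=.
by rewrite eqe invr_eq0 gt_eqF//= invrK.
Qed.

Lemma pr_condE e : measurable_fun setT e ->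
  pr P (fun t => e t && sketch_event h s t) = pr cond_prob e / csize.
Proof.
move=> me; have cs := csize_gt0.
have me' : measurable_fun setT (fun t => e t && sketch_event h s t).
  by apply: measurable_and => //; exact: measurable_sketch_event.
have := prE cond_prob me; rewrite cond_probE.
have -> : [set t | e t] `&` C = [set t | e t && sketch_event h s t].
  by apply/seteqP; split => t /=; [case=> -> ->|move=> /andP[]].
rewrite (prE P me') -EFinM => -[<-]; by rewrite mulfK// gt_eqF.
Qed.

(** A sign multiplies a whole row, so it can be moved from the sketch into the matrix: symmetry
    preserves the law of the entries, and |A x|_1 does not change. *)
Definition signed_entry (p : 'I_n * 'I_d) (t : T) : measurableTypeR R :=
  (-1) ^+ s p.1 * A p.1 p.2 t.

Let signed_preimage p (B : set (measurableTypeR R)) : measurable B ->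
  exists2 B' : set (measurableTypeR R), measurable B' &
  signed_entry p @^-1` B = A p.1 p.2 @^-1` B' /\ (symmetric_dist D -> D B' = D B).
Proof.
move=> mB; rewrite /signed_entry; case: (s p.1).
  exists (-%R @^-1` B); last split.
  - have := @oppr_measurable R setT measurableT B mB; by rewrite setTI.
  - by apply/seteqP; split => t /=; rewrite expr1 mulN1r.
  - by move=> ->.
exists B => //; split => //.
by apply/seteqP; split => t /=; rewrite expr0 mul1r.
Qed.

Lemma signed_entry_measurable p : measurable_fun setT (signed_entry p).
Proof. by apply: measurable_funM; [exact: measurable_cst|exact: mA]. Qed.

Let cond_capE (J : {set 'I_n * 'I_d}) (E : 'I_n * 'I_d -> set T) :
  (forall p, p \in J -> sigma_of (A p.1 p.2) (E p)) ->
  cond_prob (\bigcap_(p in [set` J]) E p) = (\prod_(p in J) P (E p))%E.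
Proof.
move=> hE; have cs := csize_gt0.
by rewrite cond_probE prob_sketch_event// -muleA -EFinM mulVf ?mule1// gt_eqF.
Qed.

Let cond_sameE p E : sigma_of (A p.1 p.2) E -> cond_prob E = P E.
Proof.
move=> hE; have := @cond_capE [set p]%SET (fun=> E).
rewrite big_set1 => <-; last by move=> p'; rewrite inE => /eqP ->.
congr (cond_prob _); apply/seteqP; split => t /=; first by move=> ? ?.
by move=> /(_ p); apply; rewrite /= inE.
Qed.

Lemma signed_entry_law p (B : set (measurableTypeR R)) : symmetric_dist D ->
  measurable B -> cond_prob (signed_entry p @^-1` B) = D B.
Proof.
move=> symD mB; have [B' mB' [-> DB]] := signed_preimage p mB.
by rewrite (@cond_sameE p) ?lawA ?DB//; exact: sigma_of_preimage.
Qed.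

Lemma signed_entry_indep :
  mutually_independent cond_prob (fun p => sigma_of (signed_entry p)).
Proof.
move=> J E hE.
have hE' p : p \in J -> sigma_of (A p.1 p.2) (E p).
  move=> /hE [B mB <-]; rewrite setTI.
  by have [B' mB' [-> _]] := signed_preimage p mB; exact: sigma_of_preimage.
rewrite cond_capE//; apply: eq_bigr => p pJ.
by rewrite (@cond_sameE p)//; exact: hE'.
Qed.

End Conditioned.

(** * The distortion event *)

Definition distortion_event (kappa : R) : set T := [set t | forall x : 'cV[R]_d,
  kappa^-1 * l1norm ((\matrix_(i, j) (A i j t : R)) *m x)
    <= l1norm (countsketch_mx R (H t) (fun i => L i t) *m
               (\matrix_(i, j) (A i j t : R)) *m x)
    <= l1norm ((\matrix_(i, j) (A i j t : R)) *m x)].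

Lemma measurable_l1norm_A (x : 'cV[R]_d) :
  measurable_fun setT (fun t => l1norm ((\matrix_(i, j) (A i j t : R)) *m x)).
Proof.
under eq_fun do rewrite l1norm_mulE.
apply: measurable_sum => i; apply: measurableT_comp => //.
apply: measurable_sum => j; apply: measurable_funM; last exact: measurable_cst.
by under eq_fun do rewrite mxE; exact: mA.
Qed.

Lemma measurable_l1norm_SA (x : 'cV[R]_d) :
  measurable_fun setT (fun t => l1norm (countsketch_mx R (H t) (fun i => L i t) *m
    (\matrix_(i, j) (A i j t : R)) *m x)).
Proof.
under eq_fun do rewrite -mulmxA.
apply: measurable_sum => k; apply: measurableT_comp => //.
under eq_fun do rewrite mxE.
apply: measurable_sum => i; apply: measurable_funM.
  under eq_fun do rewrite mxE.
  apply: measurable_fun_ifT; last exact: measurable_cst.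
    have -> : (fun t => H t i == k) =
        fun t => [exists h : {ffun 'I_n -> 'I_r}, (h i == k) && (H t == h)].
      apply/funext => t; apply/idP/existsP => [Hk|[h /andP[hk /eqP ->]]//].
      by exists (H t); rewrite Hk eqxx.
    by apply: measurable_existsb => h; exact: measurable_hash_eq.
  have -> : (fun t => (-1 : R) ^+ L i t) = fun t => if L i t then -1 else 1.
    by apply/funext => t; case: (L i t).
  by apply: measurable_fun_ifT; [exact: measurable_sign|exact: measurable_cst|
    exact: measurable_cst].
under eq_fun do rewrite mxE.
apply: measurable_sum => j; apply: measurable_funM; last exact: measurable_cst.
by under eq_fun do rewrite mxE; exact: mA.
Qed.

(** The quantifier over x is uncountable, but the upper bound holds surely and the lower bound is
    decided on rational vectors, which leaves a countable intersection. *)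
Lemma measurable_distortion_event kappa : 0 < kappa ->
  measurable (distortion_event kappa).
Proof.
move=> kap0.
pose good (v : 'cV[rat]_d) : set T := [set t |
  kappa^-1 * l1norm ((\matrix_(i, j) (A i j t : R)) *m map_mx ratr v)
    <= l1norm (countsketch_mx R (H t) (fun i => L i t) *m
               (\matrix_(i, j) (A i j t : R)) *m map_mx ratr v)].
(* Rational vectors are enumerated by their codes; a number that codes no vector contributes
   [setT]. *)
have -> : distortion_event kappa = \bigcap_k
    (if @unpickle 'cV[rat]_d k is Some v then good v else setT).
  apply/seteqP; split => t /= ht.
    move=> k _; case: (unpickle k) => // v.
    by have /andP[] := ht (map_mx ratr v).
  move=> x; apply/andP; split; last exact: sketch_le_l1norm.
  apply: l1norm_le_rational; first by rewrite invr_ge0 ltW.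
  by move=> v; have := ht (pickle v) I; rewrite pickleK.
apply: bigcapT_measurable => k; case: (unpickle k) => [v|//].
have : measurable_fun setT (fun t =>
  kappa^-1 * l1norm ((\matrix_(i, j) (A i j t : R)) *m map_mx ratr v)
    <= l1norm (countsketch_mx R (H t) (fun i => L i t) *m
               (\matrix_(i, j) (A i j t : R)) *m map_mx ratr v)).
  apply: measurable_fun_ler; last exact: measurable_l1norm_SA.
  by apply: measurable_funM; [exact: measurable_cst|exact: measurable_l1norm_A].
by move=> /(_ measurableT [set true] I); rewrite setTI.
Qed.

End Model.

(* The union bound over the events signal, noise, small and cross for each of
   the d columns, and over the events double and huge. *)
Definition failure_bound (R : realType) (c1 c2 : R) (n d r m s u L : nat) : R :=
  d%:R * (256 * (16 * c1) * 2 ^+ s / ((s - m)%:R ^+ 2 * c2 ^+ 2 * r%:R) +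
    128 ^+ 2 * d%:R * (16 * c1) * (1 + 3 * (16 * c1) * u%:R) /
      ((s - m)%:R ^+ 2 * c2 ^+ 2 * r%:R) +
    (1 + 3 * (16 * c1) * 2 ^+ m) / r%:R + 8 / r%:R) +
  r%:R * d%:R ^+ 2 * (16 * c1 / 2 ^+ u) ^+ 2 + n%:R * d%:R * c1 / 2 ^+ L.

(** The space is cut along the values of the hash function and the signs. Without overload the
    conditional failure is at most 1/200, and at most a fraction 1/200 of the hash functions is
    overloaded; (199/200)^2 exceeds 99/100. *)
Lemma distortion_probability (R : realType)
    (D : probability (measurableTypeR R) R) (c1 c2 x0 : R)
    (n d r m s u L : nat) (kappa : R) :
  symmetric_dist D -> 1 <= c1 -> 0 < c2 ->
  (forall v : R, 0 < v -> tail D v <= c1 / v) ->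
  (forall v : R, x0 <= v -> c2 / v <= tail D v) ->
  (0 < r)%N -> (0 < n)%N -> 200 * r%:R ^+ 2 <= n%:R :> R ->
  (m < s)%N -> x0 <= 2 ^+ m -> 4 * c1 <= 2 ^+ m ->
  d%:R * (16 * c1) * (1 + 2 * (16 * c1) + m%:R * (16 * c1)) / 2 ^+ m <= c2 / 128 ->
  failure_bound c1 c2 n d r m s u L <= 1 / 200 -> 0 < kappa ->
  2 + 32 * (2 + 16 * c1 * m%:R + 4 * (1 + c1 * L%:R)) / ((s - m)%:R * c2) <= kappa ->
  forall (disp : measure_display) (T : measurableType disp) (P : probability T R)
    (A : 'I_n -> 'I_d -> {RV P >-> measurableTypeR R})
    (H : T -> {ffun 'I_n -> 'I_r}) (Lam : 'I_n -> T -> bool),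
  sketch_model D A H Lam ->
  ((99 / 100 : R)%:E <= P (distortion_event A H Lam kappa))%E.
Proof.
move=> symD c1g c2g tle tge r0 n0 rn ms mx mc ha hfail kap0 hk disp T P A H Lam model.
have rR : (1 : R) <= r%:R by rewrite ler1n.
pose N : R := n%:R / r%:R.
have nN : n%:R = N * r%:R by rewrite /N divfK// gt_eqF//; lra.
have N1 : 1 <= N.
  rewrite /N ler_pdivlMr ?mul1r; last lra.
  by rewrite expr2 in rn; nra.
have mxN : x0 <= 2 ^+ m * N.
  by apply: le_trans mx _; rewrite ler_peMr// exprn_ge0.
have mdist := measurable_distortion_event model kap0.
pose dist t := `[< distortion_event A H Lam kappa t >].
have distE : distortion_event A H Lam kappa = [set t | dist t].
  by apply/seteqP; split => t /= /asboolP.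
have mdist' : measurable_fun setT dist.
  apply: (measurable_fun_bool true); rewrite setTI.
  by rewrite (_ : _ @^-1` _ = [set t | dist t]) -?distE.
rewrite distE prE// lee_fin.
pose cs : R := (r ^ n * 2 ^ n)%:R.
have cs0 : 0 < cs by rewrite ltr0n muln_gt0 !expn_gt0 r0.
pose overloaded (h : {ffun 'I_n -> 'I_r}) := [exists k, 2 * N < #|bucket h k|%:R].
have step (hs : {ffun 'I_n -> 'I_r} * {ffun 'I_n -> bool}) : ~~ overloaded hs.1 ->
    199 / 200 / cs <= pr P (fun t => dist t && sketch_event H Lam hs.1 hs.2 t).
  case: hs => h s' /= /existsPn load.
  have {}load k : #|bucket h k|%:R <= 2 * N by rewrite leNgt; exact: load.
  pose Q := cond_prob model h s'.
  pose X := signed_entry A s'.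
  have mX p : measurable_fun setT (X p) := @signed_entry_measurable _ _ _ _ _ _ A s' p.
  have lawX p (B : set (measurableTypeR R)) : measurable B -> Q (X p @^-1` B) = D B.
    by move=> mB; exact: signed_entry_law.
  have indX : mutually_independent Q (fun p => sigma_of (X p)).
    exact: signed_entry_indep.
  have hbad := @pr_bad _ _ _ Q D n d r X mX lawX indX symD c1 c2 x0 c1g c2g tle tge h N
    nN N1 load m s u L ms mxN mc r0 ha.
  pose b t := bad X c1 c2 h N m s u L t.
  have mb : measurable_fun setT b by exact: measurable_bad.
  have mgood : measurable_fun setT (fun t => ~~ b t) by exact: measurable_neg.
  apply: (@le_trans _ _ (pr P (fun t => ~~ b t && sketch_event H Lam h s' t))).
    rewrite (pr_condE model r0 h s' mgood) -/cs ler_pM2r ?invr_gt0// pr_neg//.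
    have := le_trans hbad hfail; rewrite -/b -/Q; lra.
  apply: le_pr.
  - by apply: measurable_and => //; exact: (measurable_sketch_event model).
  - by apply: measurable_and => //; exact: (measurable_sketch_event model).
  move=> t /andP[good ev]; rewrite ev andbT; apply/asboolP => x.
  apply/andP; split; last exact: sketch_le_l1norm.
  move: ev => /andP[/eqP Ht /forallP Lt].
  have := good_embedding c1g c2g N1 ms r0 good kap0 hk (fun j => x j ord0).
  rewrite l1norm_mulE l1norm_sketchE Ht /X /signed_entry /=.
  have -> : \sum_i `|\sum_j (-1) ^+ s' i * (A i j t : R) * x j ord0| =
      \sum_i `|\sum_j (\matrix_(i, j) (A i j t : R)) i j * x j ord0|.
    apply: eq_bigr => i _; under eq_bigr do rewrite -mulrA.
    rewrite -mulr_sumr normrM normrX normrN1 expr1n mul1r; congr (`|_|).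
    by apply: eq_bigr => j _; rewrite mxE.
  move=> /le_trans; apply; rewrite le_eqVlt; apply/orP; left; apply/eqP.
  apply: eq_bigr => k _; congr (`|_|).
  under eq_bigr do rewrite mulr_suml.
  rewrite exchange_big /=; apply: eq_bigr => i _.
  rewrite mxE mulr_sumr (eqP (Lt i)); apply: eq_bigr => j _.
  by rewrite mxE mulrA.
have lower : \sum_(hs : {ffun 'I_n -> 'I_r} * {ffun 'I_n -> bool} | ~~ overloaded hs.1)
    (199 / 200 / cs) <= pr P dist.
  apply: (@le_trans _ _ (\sum_(hs : {ffun 'I_n -> 'I_r} * {ffun 'I_n -> bool} |
      ~~ overloaded hs.1)
     pr P (fun t => dist t && sketch_event H Lam hs.1 hs.2 t))).
    exact: ler_sum.
  have mev hs : measurable_fun setT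
      (fun t => dist t && sketch_event H Lam hs.1 hs.2 t).
    by apply: measurable_and => //; exact: (measurable_sketch_event model).
  rewrite -ex_sum; last by move=> hs _; exact: bm_bool.
  apply: le_ex.
  - by apply: bm_sum => hs _; exact: bm_bool.
  - exact: bm_bool.
  move=> t; case: (dist t); last by rewrite big1.
  (* Exactly one pair of hash function and signs occurs at each point, so the sum of indicators is
     at most 1. *)
  pose hs0 := (H t, [ffun i => Lam i t]).
  rewrite big_mkcond (bigD1 hs0)//= [X in _ + X]big1 ?addr0.
    by case: ifP => // _; rewrite lern1 leq_b1.
  move=> [h s'] /= ne; case: ifP => // _; rewrite /sketch_event /=.
  case: eqP => //= Hh; case: forallP => //= Ls; case/eqP: ne; rewrite /hs0 Hh.
  by congr (_, _); apply/ffunP => i; rewrite ffunE; exact/esym/eqP/Ls.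
apply: le_trans lower.
rewrite sumr_const -[leRHS]mulr_natl.
set G := #|_|.
have cardG : (G = (r ^ n - #|[set h | overloaded h]%SET|) * 2 ^ n)%N.
  have -> : G = #|finset.setX (~: [set h | overloaded h])%SET
      [set: {ffun 'I_n -> bool}]%SET|.
    by apply: eq_card => -[h s']; rewrite !inE andbT.
  rewrite cardsX cardsT card_ffun card_bool card_ord; congr (_ * _)%N.
  by rewrite cardsCs finset.setCK card_ffun !card_ord.
have hover := @overload_le R n r r0 n0.
rewrite -/(overloaded _) in hover.
have nR : (0 : R) < n%:R by rewrite ltr0n.
have rn0 : (0 : R) < r%:R ^+ n by rewrite exprn_gt0//; lra.
have hov : 200 * #|[set h | overloaded h]%SET|%:R <= r%:R ^+ n :> R.
  rewrite -(ler_pM2r nR).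
  have := ler_wpM2l (ltW rn0) rn.
  move: hover; set c := #|_|%:R; lra.
have -> : G%:R = (r%:R ^+ n - #|[set h | overloaded h]%SET|%:R) * 2 ^+ n :> R.
  rewrite cardG natrM natrB ?natrX//.
  by rewrite (leq_trans (max_card _))// card_ffun !card_ord.
have -> : cs = r%:R ^+ n * 2 ^+ n by rewrite /cs natrM !natrX.
set y := #|_|%:R in hov *; set z := r%:R ^+ n in rn0 hov *.
have p2 : (0 : R) < 2 ^+ n by rewrite exprn_gt0.
have -> : (z - y) * 2 ^+ n * (199 / 200 / (z * 2 ^+ n)) = 199 / 200 * ((z - y) / z).
  by field; rewrite !gt_eqF.
have : 199 / 200 <= (z - y) / z by rewrite ler_pdivlMr//; lra.
lra.
Qed.

(** * Choice of the constants *)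

Section LogBounds.
Context {R : realType}.
Implicit Types (x K : R) (k : nat).

Lemma ln_le_subr1 x : 0 < x -> ln x <= x - 1.
Proof.
move=> x0; have := @le_ln1Dx R (x - 1).
by rewrite (_ : 1 + (x - 1) = x); [apply; lra|ring].
Qed.

(** The bound ln x <= x - 1 at 2 and at 1/2. It lets numbers of dyadic levels and natural logarithms
    be exchanged at the cost of a factor 2. *)
Lemma ln2_bounds : 1 / 2 <= ln (2 : R) <= 1.
Proof.
have h1 := @ln_le_subr1 2 (ltr0n R 2).
have h2 := @ln_le_subr1 2^-1.
have h3 : ln (2^-1) = - ln 2 :> R by rewrite lnV// posrE.
by rewrite h3 in h2; apply/andP; split; [have := h2 ltac:(lra)|]; lra.
Qed.

Lemma pow2_le_ln k x : 2 ^+ k <= x -> k%:R <= 2 * ln x.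
Proof.
move=> kx; have /andP[l2 _] := ln2_bounds.
have p0 : (0 : R) < 2 ^+ k by rewrite exprn_gt0.
have : ln (2 ^+ k) <= ln x by rewrite ler_ln ?posrE//; exact: lt_le_trans kx.
rewrite lnXn// -[ln 2 *+ k]mulr_natl.
have := ler_wpM2l (ler0n R k) l2; lra.
Qed.

Lemma ln_le_pow2 k x : 0 < x -> x <= 2 ^+ k -> ln x <= k%:R.
Proof.
move=> x0 xk; have /andP[_ l2] := ln2_bounds.
have p0 : (0 : R) < 2 ^+ k by rewrite exprn_gt0.
have : ln x <= ln (2 ^+ k) by rewrite ler_ln ?posrE.
rewrite lnXn// -[ln 2 *+ k]mulr_natl.
have := ler_wpM2l (ler0n R k) l2; lra.
Qed.

(** The tangent of ln at [K]: a large [K] makes the slope as small as desired, at the price of a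
    constant. *)
Lemma ln_le_linear x K : 0 < x -> 0 < K -> ln x <= x / K + ln K.
Proof.
move=> x0 K0; have := ln_le_subr1 (divr_gt0 x0 K0).
by rewrite ln_div ?posrE//; lra.
Qed.

Lemma ln_nat_ge (d : nat) : (2 <= d)%N -> 1 / 2 <= ln d%:R :> R.
Proof.
move=> d2; have /andP[l2 _] := ln2_bounds; apply: le_trans l2 _.
by rewrite ler_ln ?posrE ?ltr0n ?ler_nat//; exact: leq_trans d2.
Qed.

End LogBounds.

Section ConstantChoice.
Context {R : realType}.
(** One parameter per cutoff: [beta] governs m, [delta] governs s and [eps] governs u. Each of the
    six failure terms is allowed [eta], and [C] is large in terms of all of these. *)
Variables c1 c2 q beta delta eps eta C : R.
Hypothesis c1_ge1 : 1 <= c1.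
Hypothesis c2_gt0 : 0 < c2.
Hypothesis q_ge1 : 1 <= q.
Hypothesis beta_ge1 : 1 <= beta.
Hypothesis beta_ge : 22 * q ^+ 2 / beta <= c2 / 128.
Hypothesis delta_gt0 : 0 < delta.
Hypothesis delta_le1 : delta <= 1.
Hypothesis delta_le : 256 * q * delta <= eta * c2 ^+ 2.
Hypothesis eps_gt0 : 0 < eps.
Hypothesis eps_le : 128 ^+ 2 * (4 * q ^+ 2) * eps <= eta * c2 ^+ 2.
Hypothesis eta_gt0 : 0 < eta.

(** The factor in 2^m of order alpha d ln d. It is a square because m contains ln alpha, which is at
    most 2 beta, so that the mean noise, of order m / alpha, still decays like 1 / beta. *)
Let alpha := beta ^+ 2.
(** The loss in 2^s > gamma rho 2^m: a factor delta / 2 from the choice of s and 2 alpha from that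
    of m. *)
Let gamma := delta / (4 * alpha).
Let K2 := 1 + 12 / eps.

Hypothesis C_bounds : [/\ 2 / (delta / (4 * beta ^+ 2)) ^+ 2 <= C, 4 / delta <= C,
  24 * (1 + ln (1 + 12 / eps)) / eps <= C & 4 <= C].
Hypothesis C_eta : [/\ 2 * (8 * q * beta ^+ 2) <= eta * C, 2 * 16 <= eta * C,
  2 * (2 * q ^+ 2) <= eta * C & 2 * c1 <= eta * C].

Let alpha_ge : beta <= alpha.
Proof. by have b1 := beta_ge1; rewrite /alpha expr2 ler_peMr//; lra. Qed.

Let alpha_ge1 : 1 <= alpha.
Proof. by have b1 := beta_ge1; have := alpha_ge; lra. Qed.

Let gamma_gt0 : 0 < gamma.
Proof.
by have h := alpha_ge1; have dg := delta_gt0; rewrite /gamma divr_gt0//; lra.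
Qed.

Let K2_bounds : 1 <= K2 /\ 0 <= ln K2.
Proof.
have eg := eps_gt0; have h : 1 <= K2 by rewrite /K2 lerDl divr_ge0// ltW.
by split=> //; exact: ln_ge0.
Qed.

(** * Levels and failure terms for given n, d and r *)

Section Fixed.
Variables n d r : nat.
Hypothesis d_ge2 : (2 <= d)%N.
Hypothesis r_ge : C * (d%:R * ln d%:R) ^+ 2 <= r%:R.
Hypothesis n_ge : 200 * r%:R ^+ 2 <= n%:R :> R.

Let l : R := ln d%:R.
Let Z : R := d%:R ^+ 2 * l.
(** The argument of the logarithm in kappa. In these terms [r_ge] reads C l <= rho, and four of the
    failure terms reduce to multiples of 1 / rho. *)
Let rho : R := r%:R / Z.

Let dl : 2 <= d%:R :> R /\ 1 / 2 <= l.
Proof. by split; [rewrite ler_nat|exact: ln_nat_ge]. Qed.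

Let dl_ge1 : 1 <= d%:R * l.
Proof.
have [d2 l2] := dl; have : 2 * (1 / 2) <= d%:R * l by rewrite ler_pM//; lra.
lra.
Qed.

Let Z_ge2 : 2 <= Z.
Proof.
have [d2 l2] := dl; rewrite /Z.
have : 2 * 2 <= d%:R ^+ 2 :> R by rewrite expr2 ler_pM.
move=> h; have : 4 * (1 / 2) <= d%:R ^+ 2 * l by rewrite ler_pM//; lra.
lra.
Qed.

Let rE : r%:R = rho * Z.
Proof. by have z := Z_ge2; rewrite /rho divfK// gt_eqF//; lra. Qed.

Let rho_ge : C * l <= rho.
Proof.
have z := Z_ge2; rewrite /rho ler_pdivlMr; last lra.
apply: le_trans r_ge; rewrite le_eqVlt; apply/orP; left; apply/eqP.
by rewrite /Z -/l; ring.
Qed.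

Let rho_geC : C <= 2 * rho.
Proof.
have [_ l2] := dl; have [_ _ _ C4] := C_bounds.
have C0 : 0 <= C by lra.
have := ler_wpM2l C0 l2; have := rho_ge; lra.
Qed.

Let rho_ge1 : 2 <= rho.
Proof. by have [_ _ _ C4] := C_bounds; have := rho_geC; lra. Qed.

Let r_ge4 : 4 <= r%:R :> R.
Proof.
have z := Z_ge2; have h := rho_ge1; rewrite rE.
by have := ler_pM (ler0n R 2) (ler0n R 2) h z; lra.
Qed.

Let r_le_n : r%:R <= n%:R :> R.
Proof.
apply: le_trans n_ge; have h := r_ge4.
have r0 : 0 <= r%:R :> R by [].
by have := ler_wpM2l r0 h; rewrite expr2; lra.
Qed.

Let small (A : R) : 2 * A <= eta * C -> A / rho <= eta.
Proof.
move=> AC; have h1 := rho_ge1; have h2 := rho_geC; have e0 := eta_gt0.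
by rewrite ler_pdivrMr; [have := ler_wpM2l (ltW e0) h2; lra|lra].
Qed.

Let m_spec : exists m : nat, [/\ alpha * (d%:R * l) < 2 ^+ m,
  2 ^+ m <= 2 * (alpha * (d%:R * l)) &
  d%:R * q * (1 + 2 * q + m%:R * q) / 2 ^+ m <= c2 / 128].
Proof.
have [d2 l2] := dl; have a1 := alpha_ge1; have b1 := beta_ge1; have hb := beta_ge.
have q1 := q_ge1.
have dl1 := dl_ge1.
have x1 : 1 <= alpha * (d%:R * l) by have := ler_pM ler01 ler01 a1 dl1; lra.
have [m h1 h2] := exists_pow2 x1.
exists m; split => //.
have d0 : 0 < d%:R :> R by lra.
have hl : l <= d%:R by rewrite /l; have := ln_le_subr1 d0; lra.
have hm : m%:R <= 2 * (1 + 2 * beta) + 4 * l.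
  apply: le_trans (pow2_le_ln h2) _.
  have ld : ln (d%:R * l) <= 2 * l.
    rewrite lnM ?posrE; [|lra|lra].
    have l0 : 0 < l by lra.
    by have := ln_le_subr1 l0; rewrite -/l; lra.
  have la : ln (2 * alpha) <= 1 + 2 * beta.
    rewrite lnM ?posrE; [|lra|lra].
    have /andP[_ hl2] := @ln2_bounds R.
    have -> : ln alpha = 2 * ln beta by rewrite /alpha lnXn ?mulr_natl//; lra.
    have b0 : 0 < beta by lra.
    have := ln_le_subr1 b0; lra.
  have -> : 2 * (alpha * (d%:R * l)) = 2 * alpha * (d%:R * l) by ring.
  by rewrite lnM ?posrE; [lra|lra|lra].
have p0 : (0 : R) < 2 ^+ m by rewrite exprn_gt0.
apply: le_trans hb.
have b0 : 0 < beta by lra.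
rewrite ler_pdivrMr//.
apply: (@le_trans _ _ (22 * q ^+ 2 / beta * (alpha * (d%:R * l)))); last first.
  rewrite ler_pM2l; first exact: ltW.
  by rewrite divr_gt0// mulr_gt0// exprn_gt0//; lra.
have -> : 22 * q ^+ 2 / beta * (alpha * (d%:R * l)) = d%:R * q * (22 * q * beta * l).
  by rewrite /alpha; field; rewrite gt_eqF.
rewrite ler_wpM2l//; first by rewrite mulr_ge0//; lra.
have q0 : 0 <= q by lra.
(* In units of q beta l, the terms 1 and 2 q cost 2 and 4, and the three parts of m q cost 4, 8 and
   4: together 22. *)
have hmq := ler_wpM2r q0 hm.
have qbl : q * 1 * (1 / 2) <= q * beta * l by rewrite ler_pM ?ler_pM//; lra.
have ql : q * 1 * l <= q * beta * l by rewrite ler_pM ?ler_pM//; lra.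
have qb : q * beta * (1 / 2) <= q * beta * l.
  by rewrite ler_wpM2l// mulr_ge0//; lra.
lra.
Qed.

(** With z = rho l one has r = z d^2, so the claim is u <= eps z where u is of order ln r. This
    splits into ln z, absorbed by the tangent bound of slope 1 / K2, and 2 l, absorbed because rho
    is large. *)
Let u_spec : exists u : nat, [/\ r%:R < 2 ^+ u :> R, (0 < u)%N &
  u%:R * d%:R ^+ 2 <= eps * r%:R :> R].
Proof.
have [d2 l2] := dl; have h4 := r_ge4; have e0 := eps_gt0; have z2 := Z_ge2.
have [k1 k2] := K2_bounds; have [_ _ hC _] := C_bounds; have r1 := rho_ge1.
have rC := rho_geC.
have rg1 : 1 <= r%:R :> R by lra.
have [u hu1 hu2] := exists_pow2 rg1.
exists u; split => //.
  by case: u hu1 {hu2} => //; rewrite expr0; lra.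
have d20 : 0 < d%:R ^+ 2 :> R by rewrite exprn_gt0//; lra.
pose z := rho * l.
have z0 : 0 < z by rewrite mulr_gt0//; lra.
have rz : r%:R = z * d%:R ^+ 2 by rewrite rE /Z /z; ring.
have hu : u%:R <= 2 * (2 * z / K2 + ln K2 + 2 * l).
  apply: le_trans (pow2_le_ln hu2) _; rewrite ler_pM2l// rz.
  have -> : 2 * (z * d%:R ^+ 2) = 2 * z * d%:R ^+ 2 by ring.
  rewrite lnM ?posrE//; last by rewrite mulr_gt0.
  have -> : ln (d%:R ^+ 2) = 2 * l by rewrite lnXn ?mulr_natl//; lra.
  rewrite lerD2r; apply: ln_le_linear; [by rewrite mulr_gt0|lra].
rewrite rz mulrA ler_pM2r//; apply: le_trans hu _.
have hK : 12 * z / K2 <= eps * z.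
  rewrite ler_pdivrMr; last lra.
  have -> : eps * z * K2 = eps * z + 12 * z by rewrite /K2; field; rewrite gt_eqF.
  by have := mulr_gt0 e0 z0; lra.
have hC' : 24 * (1 + ln K2) <= eps * C.
  by rewrite ler_pdivrMr// in hC; lra.
have he := ler_wpM2l (ltW e0) rC.
have hr : 12 * (1 + ln K2) <= eps * rho by lra.
have l0 : 0 <= l by lra.
have hz : 12 * (1 + ln K2) * l <= eps * z.
  by have := ler_wpM2r l0 hr; rewrite /z; lra.
have hlk : ln K2 * (1 / 2) <= ln K2 * l by rewrite ler_wpM2l.
have E : 12 * z / K2 = 12 * (z / K2) by ring.
have E' : 2 * z / K2 = 2 * (z / K2) by ring.
rewrite E in hK; rewrite E'; lra.
Qed.

(** The order r / d of 2^s against d l for 2^m leaves 2^(s - m) > gamma rho. As [C] ensures gamma^2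
    rho >= 1, the constant gamma costs at most half of ln rho. *)
Let s_spec (m : nat) : alpha * (d%:R * l) < 2 ^+ m ->
  2 ^+ m <= 2 * (alpha * (d%:R * l)) ->
  exists s : nat, [/\ (m < s)%N, 2 ^+ s <= delta * r%:R / d%:R &
                       ln rho <= 2 * (s - m)%:R].
Proof.
move=> hm1 hm2.
have [d2 l2] := dl; have h4 := r_ge4; have z2 := Z_ge2; have dg := delta_gt0.
have [hC1 hC2 _ C4] := C_bounds; have r1 := rho_ge1; have rC := rho_geC.
have a1 := alpha_ge1; have gg := gamma_gt0.
have d0 : 0 < d%:R :> R by lra.
(* Half of the intended ceiling, since [exists_pow2] may overshoot by a factor 2. *)
have y1 : 1 <= delta * r%:R / d%:R / 2.
  have dC : 4 <= delta * C by rewrite ler_pdivrMr// in hC2; lra.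
  have := ler_wpM2l (ltW dg) rC.
  have -> : delta * r%:R / d%:R / 2 = delta * rho * (d%:R * l) / 2.
    by rewrite rE /Z; field; rewrite gt_eqF.
  have dl1 := dl_ge1.
  move=> h; have dr : 2 <= delta * rho by lra.
  by have := ler_pM (ler0n R 2) ler01 dr dl1; lra.
have [s hs1 hs2] := exists_pow2 y1.
have p0 k : (0 : R) < 2 ^+ k by rewrite exprn_gt0.
have ratio : gamma * rho * 2 ^+ m < 2 ^+ s.
  apply: le_lt_trans hs1.
  have gr : 0 <= gamma * rho by rewrite mulr_ge0//; lra.
  apply: le_trans (ler_wpM2l gr hm2) _.
  rewrite le_eqVlt; apply/orP; left; apply/eqP.
  by rewrite rE /Z /gamma; field; rewrite !gt_eqF//; lra.
have g2 : 1 <= gamma ^+ 2 * rho.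
  have gp : 0 < gamma ^+ 2 by rewrite exprn_gt0.
  rewrite -/alpha -/gamma ler_pdivrMr// in hC1.
  by have := ler_wpM2r (ltW gp) rC; lra.
have gle1 : gamma <= 1.
  by have dl1 := delta_le1; rewrite /gamma ler_pdivrMr; lra.
have g1 : 1 <= gamma * rho.
  have : gamma ^+ 2 * rho <= gamma * rho.
    by rewrite ler_pM2r; [rewrite expr2 ler_piMr// ltW|lra].
  lra.
have ms : (m < s)%N.
  rewrite -(ltr_eXn2l (x := 2 : R)) ?ltr1n//; apply: le_lt_trans ratio.
  by rewrite ler_peMl// ltW.
exists s; split => //.
  apply: le_trans hs2 _; rewrite le_eqVlt; apply/orP; left; apply/eqP.
  by field; rewrite gt_eqF.
have E : 2 ^+ s = 2 ^+ (s - m) * 2 ^+ m :> R by rewrite -exprD subnK// ltnW.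
have hsm : gamma * rho < 2 ^+ (s - m) by rewrite -(ltr_pM2r (p0 m)) -E.
have hgr : 0 < gamma * rho by lra.
have h := ln_le_pow2 hgr (ltW hsm).
rewrite lnM ?posrE// in h; last lra.
have : 0 <= ln (gamma ^+ 2 * rho) by exact: ln_ge0.
rewrite lnM ?posrE ?exprn_gt0//; last lra.
by rewrite lnXn// -[ln gamma *+ 2]mulr_natl; lra.
Qed.

Let d_gt0 : 0 < d%:R :> R. Proof. by rewrite ltr0n (leq_trans _ d_ge2). Qed.
Let r_gt0 : 0 < r%:R :> R. Proof. by have h := r_ge4; lra. Qed.
Let n_gt0 : 0 < n%:R :> R. Proof. exact: lt_le_trans r_gt0 r_le_n. Qed.
Let q_ge0 : 0 <= q. Proof. exact: le_trans ler01 q_ge1. Qed.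
Let c22_gt0 : 0 < c2 ^+ 2. Proof. by rewrite exprn_gt0. Qed.
Let rho_gt0 : 0 < rho. Proof. by have h := rho_ge1; lra. Qed.
Let l_gt0 : 0 < l. Proof. by have [_ h] := dl; lra. Qed.
Let Z_gt0 : 0 < Z. Proof. by have h := Z_ge2; lra. Qed.

Let d_le_2Z : d%:R <= 2 * Z.
Proof.
have [d2 _] := dl; have h := ler_wpM2l (ltW d_gt0) dl_ge1.
by rewrite /Z expr2 -mulrA; lra.
Qed.

Let drop_square (A w : R) : 0 <= A -> 1 <= w ->
  A / (w ^+ 2 * c2 ^+ 2 * r%:R) <= A / (c2 ^+ 2 * r%:R).
Proof.
move=> A0 w1; have cr := mulr_gt0 c22_gt0 r_gt0.
have w2 : 1 <= w ^+ 2 by rewrite exprn_ege1.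
have w20 : 0 < w ^+ 2 by lra.
rewrite ler_wpM2l// lef_pV2 ?posrE//; last by rewrite -mulrA mulr_gt0.
by rewrite -mulrA ler_peMl// ltW.
Qed.

Let signal_term (s : nat) (w : R) : 1 <= w -> 2 ^+ s <= delta * r%:R / d%:R ->
  d%:R * (256 * q * 2 ^+ s / (w ^+ 2 * c2 ^+ 2 * r%:R)) <= eta.
Proof.
move=> w1 hs; have q256 : 0 <= 256 * q by apply: mulr_ge0 q_ge0; exact: ler0n.
have p0 : (0 : R) < 2 ^+ s by rewrite exprn_gt0.
have cr := mulr_gt0 c22_gt0 r_gt0.
apply: (@le_trans _ _ (d%:R * (256 * q * 2 ^+ s / (c2 ^+ 2 * r%:R)))).
  by rewrite (ler_pM2l d_gt0); apply: drop_square => //; rewrite mulr_ge0// ltW.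
have -> : d%:R * (256 * q * 2 ^+ s / (c2 ^+ 2 * r%:R)) =
   256 * q * 2 ^+ s * (d%:R / (c2 ^+ 2 * r%:R)) by ring.
have i0 : 0 <= d%:R / (c2 ^+ 2 * r%:R) by rewrite divr_ge0// ltW.
apply: le_trans (ler_wpM2r i0 (ler_wpM2l q256 hs)) _.
have -> : 256 * q * (delta * r%:R / d%:R) * (d%:R / (c2 ^+ 2 * r%:R)) =
   256 * q * delta / c2 ^+ 2.
  by field; rewrite (gt_eqF d_gt0) (gt_eqF r_gt0) (gt_eqF c2_gt0).
by rewrite (ler_pdivrMr _ _ c22_gt0).
Qed.

Let noise_term (u : nat) (w : R) : 1 <= w -> (0 < u)%N ->
  u%:R * d%:R ^+ 2 <= eps * r%:R ->
  d%:R * (128 ^+ 2 * d%:R * q * (1 + 3 * q * u%:R) /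
    (w ^+ 2 * c2 ^+ 2 * r%:R)) <= eta.
Proof.
move=> w1 u0 hu; have qg := q_ge1; have q0 := q_ge0.
have u1 : 1 <= u%:R :> R by rewrite ler1n.
have hq : 1 + 3 * q * u%:R <= 4 * q * u%:R.
  have : 1 * 1 <= q * u%:R by apply: ler_pM.
  lra.
have cr := mulr_gt0 c22_gt0 r_gt0.
have pq : 0 <= 128 ^+ 2 * d%:R * q :> R.
  by apply: mulr_ge0 => //; apply: mulr_ge0 => //; exact: sqr_ge0.
apply: (@le_trans _ _ (d%:R * (128 ^+ 2 * d%:R * q * (4 * q * u%:R) /
    (c2 ^+ 2 * r%:R)))).
  rewrite (ler_pM2l d_gt0); apply: le_trans (drop_square _ w1) _.
    apply: mulr_ge0 => //; apply: addr_ge0 => //; apply: mulr_ge0 => //.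
    by apply: mulr_ge0.
  by rewrite ler_wpM2r ?invr_ge0 ?(ltW cr)// ler_wpM2l.
have -> : d%:R * (128 ^+ 2 * d%:R * q * (4 * q * u%:R) / (c2 ^+ 2 * r%:R)) =
   128 ^+ 2 * (4 * q ^+ 2) / (c2 ^+ 2 * r%:R) * (u%:R * d%:R ^+ 2).
  by field; rewrite (gt_eqF r_gt0) (gt_eqF c2_gt0).
have k0 : 0 <= 128 ^+ 2 * (4 * q ^+ 2) / (c2 ^+ 2 * r%:R).
  apply: divr_ge0; last exact: ltW.
  by apply: mulr_ge0; [exact: sqr_ge0|apply: mulr_ge0 => //; exact: sqr_ge0].
apply: le_trans (ler_wpM2l k0 hu) _.
have -> : 128 ^+ 2 * (4 * q ^+ 2) / (c2 ^+ 2 * r%:R) * (eps * r%:R) =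
   128 ^+ 2 * (4 * q ^+ 2) * eps / c2 ^+ 2.
  by field; rewrite (gt_eqF r_gt0) (gt_eqF c2_gt0).
by rewrite (ler_pdivrMr _ _ c22_gt0).
Qed.

Let small_term (m : nat) : 2 ^+ m <= 2 * (alpha * (d%:R * l)) ->
  d%:R * ((1 + 3 * q * 2 ^+ m) / r%:R) <= eta.
Proof.
move=> hm; have [e3 _ _ _] := C_eta; apply: le_trans (small e3).
have qg := q_ge1; have q0 := q_ge0.
have hq : 1 + 3 * q * 2 ^+ m <= 4 * q * 2 ^+ m.
  have : 1 * 1 <= q * 2 ^+ m by apply: ler_pM => //; rewrite exprn_ege1// ler1n.
  lra.
apply: (@le_trans _ _ (d%:R * (4 * q * (2 * (alpha * (d%:R * l))) / r%:R))).
  rewrite (ler_pM2l d_gt0) ler_pM2r ?invr_gt0 ?r_gt0//; apply: le_trans hq _.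
  by rewrite ler_wpM2l// mulr_ge0.
rewrite le_eqVlt; apply/orP; left; apply/eqP; rewrite rE /Z /alpha; field.
by rewrite (gt_eqF d_gt0) (gt_eqF rho_gt0) (gt_eqF l_gt0).
Qed.

Let cross_term : d%:R * (8 / r%:R) <= eta.
Proof.
have [_ e4 _ _] := C_eta; apply: le_trans (small e4).
have -> : d%:R * (8 / r%:R) = 16 / rho * (d%:R / (2 * Z)).
  by rewrite rE; field; rewrite (gt_eqF rho_gt0) (gt_eqF Z_gt0).
rewrite ler_piMr//; first by rewrite divr_ge0// ltW.
by rewrite ler_pdivrMr ?mul1r// mulr_gt0.
Qed.

(** As 2^u exceeds r, the term is at most q^2 d^2 / r = q^2 / (rho l), and l >= 1/2. *)
Let double_term (u : nat) : r%:R < 2 ^+ u :> R ->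
  r%:R * d%:R ^+ 2 * (q / 2 ^+ u) ^+ 2 <= eta.
Proof.
move=> hu; have [_ _ e5 _] := C_eta; apply: le_trans (small e5).
have p0 : (0 : R) < 2 ^+ u by rewrite exprn_gt0.
have q0 := q_ge0; have [_ l2] := dl.
have i1 : (q / 2 ^+ u) ^+ 2 <= (q / r%:R) ^+ 2.
  rewrite ler_sqr ?nnegrE ?divr_ge0 ?(ltW p0)//.
  by rewrite ler_wpM2l// lef_pV2 ?posrE ?r_gt0// ltW.
have rd : 0 <= r%:R * d%:R ^+ 2 :> R by rewrite mulr_ge0// sqr_ge0.
apply: le_trans (ler_wpM2l rd i1) _.
have -> : r%:R * d%:R ^+ 2 * (q / r%:R) ^+ 2 = q ^+ 2 / rho / l.
  by rewrite rE /Z; field; rewrite (gt_eqF d_gt0) (gt_eqF rho_gt0) (gt_eqF l_gt0).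
have qr : 0 <= q ^+ 2 / rho by rewrite divr_ge0 ?sqr_ge0// ltW.
rewrite (ler_pdivrMr _ _ l_gt0); have := ler_wpM2l qr l2.
have -> : 2 * q ^+ 2 / rho * l = 2 * (q ^+ 2 / rho * l) by ring.
lra.
Qed.

(** As 2^L exceeds n^2, the term is at most c1 d / n, and d rho <= 2 r <= n. *)
Let huge_term (L : nat) : n%:R ^+ 2 < 2 ^+ L :> R ->
  n%:R * d%:R * c1 / 2 ^+ L <= eta.
Proof.
move=> hL; have [_ _ _ e6] := C_eta; apply: le_trans (small e6).
have p0 : (0 : R) < 2 ^+ L by rewrite exprn_gt0.
have c10 : 0 <= c1 := le_trans ler01 c1_ge1.
apply: (@le_trans _ _ (n%:R * d%:R * c1 / n%:R ^+ 2)).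
  rewrite ler_wpM2l//; first by rewrite !mulr_ge0.
  by rewrite lef_pV2 ?posrE ?exprn_gt0 ?n_gt0// ltW.
have -> : n%:R * d%:R * c1 / n%:R ^+ 2 = c1 * (d%:R / n%:R).
  by field; rewrite (gt_eqF n_gt0).
rewrite ler_wpM2l// (ler_pdivrMr _ _ n_gt0) mulrC (ler_pdivlMr _ _ rho_gt0).
apply: le_trans n_ge; rewrite rE.
have rZ : 2 * 2 <= rho * Z by apply: ler_pM.
have rZ0 : 0 <= rho * Z by lra.
have k1 : d%:R * rho <= 2 * Z * rho by rewrite (ler_pM2r rho_gt0).
have k2 := ler_wpM2l rZ0 rZ.
rewrite expr2; lra.
Qed.

(** Here m <= 2 ln n, and L <= 6 ln n because 2^L <= 2 n^2, while s - m is at least ln rho / 2. The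
    additive 2 is absorbed since ln rho <= ln n. *)
Let distortion_term (m s L : nat) : (m < s)%N ->
  2 ^+ s <= delta * r%:R / d%:R -> ln rho <= 2 * (s - m)%:R ->
  2 ^+ L <= 2 * n%:R ^+ 2 :> R -> 0 < ln rho -> ln rho <= ln n%:R ->
  1 / 2 <= ln n%:R :> R -> ln 2 <= ln n%:R :> R ->
  2 + 32 * (2 + q * m%:R + 4 * (1 + c1 * L%:R)) / ((s - m)%:R * c2) <=
  (2 + 64 * (12 + 2 * q + 24 * c1) / c2) * (ln n%:R / ln rho).
Proof.
move=> ms hs1 hs2 hL2 lrho ln_rho_n lnn_half ln2n.
have c10 : 0 <= c1 := le_trans ler01 c1_ge1.
have q0 := q_ge0; have cg := c2_gt0; have r0 := r_gt0; have d0 := d_gt0.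
pose w : R := (s - m)%:R; rewrite -/w in hs2 *.
have w1 : 1 <= w by rewrite ler1n subn_gt0.
have hm : m%:R <= 2 * ln n%:R :> R.
  apply: pow2_le_ln.
  have : (2 : R) ^+ m <= 2 ^+ s by rewrite ler_eXn2l ?ltr1n// ltnW.
  move=> /le_trans /(_ hs1) /le_trans; apply.
  apply: le_trans r_le_n; rewrite ler_pdivrMr//.
  have [d2 _] := dl; have := ler_wpM2r (ltW r0) delta_le1.
  have := ler_wpM2l (ltW r0) d2; lra.
have hL : L%:R <= 6 * ln n%:R :> R.
  apply: le_trans (pow2_le_ln hL2) _.
  rewrite lnM ?posrE ?exprn_gt0 ?n_gt0// lnXn ?n_gt0// -[ln n%:R *+ 2]mulr_natl.
  lra.
clear hs1 hL2 ln2n; move: hm hL lnn_half ln_rho_n lrho hs2.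
move: (ln n%:R) (ln rho) => x y hm hL lnn_half ln_rho_n lrho hs2.
set S := 2 + q * m%:R + 4 * (1 + c1 * L%:R).
have hS : S <= (12 + 2 * q + 24 * c1) * x.
  have := ler_wpM2l q0 hm; have := ler_wpM2l c10 hL.
  by rewrite /S; lra.
have S0 : 0 <= S.
  have : 0 <= q * m%:R by rewrite mulr_ge0.
  have : 0 <= c1 * L%:R by rewrite mulr_ge0.
  by rewrite /S; lra.
have wy : y * c2 <= 2 * (w * c2) by rewrite mulrA ler_pM2r.
have b1 : 32 * S / (w * c2) <= 64 * ((12 + 2 * q + 24 * c1) * x) / (y * c2).
  have wc : 0 < w * c2 by rewrite mulr_gt0//; lra.
  have yc : 0 < y * c2 by rewrite mulr_gt0.
  rewrite ler_pdivrMr// mulrAC ler_pdivlMr//.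
  have k1 := ler_wpM2l S0 wy.
  have k2 := ler_wpM2r (ltW wc) hS.
  lra.
have b2 : 2 <= 2 * (x / y) by rewrite ler_peMr// ler_pdivlMr// mul1r.
rewrite [leRHS]mulrDl; apply: (lerD b2); apply: le_trans b1 _.
rewrite le_eqVlt; apply/orP; left; apply/eqP; field.
by rewrite (gt_eqF lrho) (gt_eqF cg).
Qed.

Lemma parameters_exist : [/\ (0 < r)%N, (0 < n)%N, 0 < ln n%:R / ln rho &
  exists m s u L : nat, [/\ (m < s)%N, beta <= 2 ^+ m,
    d%:R * q * (1 + 2 * q + m%:R * q) / 2 ^+ m <= c2 / 128,
    d%:R * (256 * q * 2 ^+ s / ((s - m)%:R ^+ 2 * c2 ^+ 2 * r%:R) +
      128 ^+ 2 * d%:R * q * (1 + 3 * q * u%:R) /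
        ((s - m)%:R ^+ 2 * c2 ^+ 2 * r%:R) +
      (1 + 3 * q * 2 ^+ m) / r%:R + 8 / r%:R) +
      r%:R * d%:R ^+ 2 * (q / 2 ^+ u) ^+ 2 + n%:R * d%:R * c1 / 2 ^+ L <= 6 * eta &
    2 + 32 * (2 + q * m%:R + 4 * (1 + c1 * L%:R)) / ((s - m)%:R * c2) <=
    (2 + 64 * (12 + 2 * q + 24 * c1) / c2) * (ln n%:R / ln rho)]].
Proof.
have rn := r_le_n; have h4 := r_ge4; have r1 := rho_ge1.
have lrho : 0 < ln rho by rewrite ln_gt0//; lra.
have n1 : 1 <= n%:R :> R by lra.
have n2 : 1 <= n%:R ^+ 2 :> R by rewrite exprn_ege1.
have ln_rho_n : ln rho <= ln n%:R.
  rewrite ler_ln ?posrE ?n_gt0 ?rho_gt0//.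
  by apply: le_trans rn; rewrite rE ler_peMr ?(ltW rho_gt0)//; have := Z_ge2; lra.
have ln2n : ln 2 <= ln n%:R :> R by rewrite ler_ln ?posrE ?n_gt0//; lra.
have lnn_half : 1 / 2 <= ln n%:R :> R.
  by have /andP[hl _] := @ln2_bounds R; exact: le_trans hl ln2n.
split; [by rewrite -(ltr0n R) r_gt0|by rewrite -(ltr0n R) n_gt0
       |by rewrite divr_gt0//; lra|].
have [m [hm1 hm2 hm3]] := m_spec.
have [u [hu1 hu2 hu3]] := u_spec.
have [s [ms hs1 hs2]] := s_spec hm1 hm2.
have [L hL1 hL2] := exists_pow2 n2.
have w1 : 1 <= (s - m)%:R :> R by rewrite ler1n subn_gt0.
exists m, s, u, L; split => //; last exact: distortion_term.
- apply: le_trans alpha_ge _; apply: le_trans (ltW hm1).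
  by rewrite ler_peMr ?dl_ge1//; have := alpha_ge1; lra.
- have t1 := signal_term w1 hs1; have t2 := noise_term w1 hu2 hu3.
  have t3 := small_term hm2; have t4 := cross_term.
  have t5 := double_term hu1; have t6 := huge_term hL1.
  rewrite (_ : 6 * eta = eta + eta + eta + eta + eta + eta); last by ring.
  by rewrite !(mulrDr d%:R); do 5 (apply: lerD => //).
Qed.

End Fixed.
End ConstantChoice.

(** * Constants for the asymptotic statement *)

Lemma exists_upper_bounds (R : realType) (e a1 a2 a3 a4 b1 b2 b3 b4 : R) : 0 < e ->
  exists C : R, [/\ 0 < C, [/\ a1 <= C, a2 <= C, a3 <= C & a4 <= C] &
    [/\ b1 <= e * C, b2 <= e * C, b3 <= e * C & b4 <= e * C]].
Proof.
move=> e0; pose B := (`|b1| + `|b2| + `|b3| + `|b4|) / e.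
have B0 : 0 <= B by rewrite divr_ge0 ?(ltW e0)// !addr_ge0.
have eB : e * B = `|b1| + `|b2| + `|b3| + `|b4| by rewrite mulrC divfK// gt_eqF.
exists (1 + `|a1| + `|a2| + `|a3| + `|a4| + B).
set A := 1 + _ + _ + _ + _.
have A0 : 0 <= A by rewrite !addr_ge0.
have eA : 0 <= e * A by rewrite mulr_ge0// ltW.
have [] := (normr_ge0 a1, normr_ge0 a2, normr_ge0 a3, normr_ge0 a4).
move=> [[p1 p2] p3] p4; have [] := (ler_norm a1, ler_norm a2, ler_norm a3, ler_norm a4).
move=> [[u1 u2] u3] u4.
have [] := (normr_ge0 b1, normr_ge0 b2, normr_ge0 b3, normr_ge0 b4).
move=> [[q1 q2] q3] q4; have [] := (ler_norm b1, ler_norm b2, ler_norm b3, ler_norm b4).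
move=> [[v1 v2] v3] v4.
by rewrite mulrDr eB; split; [rewrite /A|rewrite /A; split|split]; lra.
Qed.

Theorem theorem6p9 (R : realType) (D : probability (measurableTypeR R) R)
    (hD : symmetric_power_law 1 D) :
  exists C K : R, [/\ 0 < C, 0 < K &
    forall d r : nat -> nat,
      (forall n, (2 <= d n)%N) ->
      (\forall n \near \oo,
         C * ((d n)%:R * ln (d n)%:R) ^+ 2 <= (r n)%:R) ->
      (fun n => (r n)%:R : R^o) =o_\oo (fun n => Num.sqrt n%:R : R^o) ->
      \forall n \near \oo, exists kappa : R,
        [/\ 0 < kappa,
            kappa <= K * (ln n%:R /
                          ln ((r n)%:R / ((d n)%:R ^+ 2 * ln (d n)%:R))) &
            forall (disp : measure_display) (T : measurableType disp)
              (P : probability T R)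
              (A : 'I_n -> 'I_(d n) -> {RV P >-> measurableTypeR R})
              (H : T -> {ffun 'I_n -> 'I_(r n)}) (L : 'I_n -> T -> bool),
              sketch_model D A H L ->
              let Amx t : 'M[R]_(n, d n) := \matrix_(i, j) A i j t in
              let S t : 'M[R]_(r n, n) :=
                countsketch_mx R (H t) (fun i => L i t) in
              let distortion : set T := [set t | forall x : 'cV[R]_(d n),
                kappa^-1 * l1norm (Amx t *m x)
                  <= l1norm (S t *m Amx t *m x)
                  <= l1norm (Amx t *m x)] in
              ((99 / 100 : R)%:E <= P distortion)%E]].
Proof.
have [c1 [c2 [x0 [c1_ge1 c2_gt0 _ tail_le tail_ge]]]] := power_law_tails hD.
have symD := hD.1.
pose q := 16 * c1.
have q_ge1 : 1 <= q by rewrite /q; lra.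
have c22 : 0 < c2 ^+ 2 by rewrite exprn_gt0.
have q2 : 0 < q ^+ 2 by rewrite exprn_gt0//; lra.
(* Six failure terms of size [eta] have to fit into 1/200. *)
have [eta eta_gt0 eta_le] : exists2 eta : R, 0 < eta & 6 * eta <= 1 / 200.
  by exists (1 / 200 / 6); [rewrite !divr_gt0|rewrite mulrC divfK].
have [beta [beta_ge1 beta_c1 beta_x0 beta_ge]] : exists beta : R,
    [/\ 1 <= beta, 4 * c1 <= beta, x0 <= beta & 22 * q ^+ 2 / beta <= c2 / 128].
  pose b := 22 * q ^+ 2 * 128 / c2.
  have p22 : 0 < 22 :> R by rewrite ltr0n.
  have p128 : 0 < 128 :> R by rewrite ltr0n.
  have b0 : 0 < b := divr_gt0 (mulr_gt0 (mulr_gt0 p22 q2) p128) c2_gt0.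
  (* Since 2^m >= beta, the summands 4 c1 and |x0| put all levels from m on in the range of the
     lower tail bounds; [b] makes the mean noise small. *)
  exists (1 + b + 4 * c1 + `|x0|).
  have ax := normr_ge0 x0; have nx := ler_norm x0.
  split; [lra|lra|lra|rewrite ler_pdivrMr; last lra].
  have -> : 22 * q ^+ 2 = c2 / 128 * b by rewrite /b; field; rewrite gt_eqF.
  by rewrite (ler_pM2l (divr_gt0 c2_gt0 p128)); lra.
have [delta [delta_gt0 delta_le1 delta_le]] : exists delta : R,
    [/\ 0 < delta, delta <= 1 & 256 * q * delta <= eta * c2 ^+ 2].
  have q256 : 0 < 256 * q by rewrite mulr_gt0 ?ltr0n//; lra.
  exists (Num.min 1 (eta * c2 ^+ 2 / (256 * q))); split.
  - by rewrite lt_min ltr01 divr_gt0// mulr_gt0.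
  - by rewrite ge_min lexx.
  - by rewrite mulrC -ler_pdivlMr// ge_min lexx orbT.
have [eps eps_gt0 eps_le] : exists2 eps : R, 0 < eps &
    128 ^+ 2 * (4 * q ^+ 2) * eps <= eta * c2 ^+ 2.
  have p4 : 0 < 4 :> R by rewrite ltr0n.
  have p128 : 0 < 128 :> R by rewrite ltr0n.
  have k0 : 0 < 128 ^+ 2 * (4 * q ^+ 2) :=
    mulr_gt0 (exprn_gt0 2 p128) (mulr_gt0 p4 q2).
  exists (eta * c2 ^+ 2 / (128 ^+ 2 * (4 * q ^+ 2))).
    by rewrite divr_gt0// mulr_gt0.
  by rewrite mulrC divfK// gt_eqF.
have [C [C_gt0 C_bounds C_eta]] : exists C : R, [/\ 0 < C,
    [/\ 2 / (delta / (4 * beta ^+ 2)) ^+ 2 <= C, 4 / delta <= C,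
       24 * (1 + ln (1 + 12 / eps)) / eps <= C & 4 <= C] &
    [/\ 2 * (8 * q * beta ^+ 2) <= eta * C, 2 * 16 <= eta * C,
       2 * (2 * q ^+ 2) <= eta * C & 2 * c1 <= eta * C]].
  exact: exists_upper_bounds.
pose K := 2 + 64 * (12 + 2 * q + 24 * c1) / c2.
have K_gt0 : 0 < K.
  by rewrite ltr_pwDl// divr_ge0 ?(ltW c2_gt0)// mulr_ge0 ?ler0n//; lra.
exists C, K; split => // d r d_ge2 hr ho.
have near1 : \forall n \near \oo, 200 * (r n)%:R ^+ 2 <= n%:R :> R.
  (* As 15^2 = 225 exceeds 200, r <= sqrt n / 15 yields 200 r^2 <= n. *)
  have e0 : (0 : R) < 1 / 15 by lra.
  have /eqoP /(_ _ e0) := ho; apply: filterS => n /= h.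
  have : (r n)%:R ^+ 2 <= (1 / 15 * Num.sqrt n%:R) ^+ 2 :> R.
    have s0 := sqrtr_ge0 (n%:R : R).
    have s1 := mulr_ge0 (ltW e0) s0.
    rewrite ler_sqr ?nnegrE//.
    by move: h; rewrite !ger0_norm.
  rewrite exprMn sqr_sqrtr// => h2.
  by have n0 : 0 <= n%:R :> R by []; lra.
near=> n.
have h1 : C * ((d n)%:R * ln (d n)%:R) ^+ 2 <= (r n)%:R by near: n.
have h2 : 200 * (r n)%:R ^+ 2 <= n%:R :> R by near: n.
have [r0 n0 lpos [m [s [u [L [ms bm hm hfail hk]]]]]] :=
  parameters_exist c1_ge1 c2_gt0 q_ge1 beta_ge1 beta_ge delta_gt0 delta_le1
    delta_le eps_gt0 eps_le eta_gt0 C_bounds C_eta (d_ge2 n) h1 h2.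
exists (K * (ln n%:R / ln ((r n)%:R / ((d n)%:R ^+ 2 * ln (d n)%:R)))).
have kap0 := mulr_gt0 K_gt0 lpos.
split => // disp T P A H Lam model.
apply: (distortion_probability (m := m) (s := s) (u := u) (L := L) symD c1_ge1 c2_gt0
  tail_le tail_ge r0 n0 h2 ms _ _ hm _ kap0 hk model).
- exact: le_trans beta_x0 bm.
- exact: le_trans beta_c1 bm.
- exact: le_trans hfail eta_le.
Unshelve. all: by end_near.
Qed.
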